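(* Let $R$ be a ring and let $(\mathcal{F},\mathcal{C})$ be a cotorsion pair of classes of right $R$-modules such that $\mathcal{F}$ is closed under direct limits and every module has an $\mathcal{F}$-cover. (1) If $M\in\mathcal{F}$ is $\mathcal{C}$-automorphism-invariant, then: (i) $\mathrm{End}(M)/J(\mathrm{End}(M))$ is von Neumann regular and idempotents lift modulo $J(\mathrm{End}(M))$; consequently, $M$ satisfies the finite exchange property. (ii) $M=N\oplus L$ where $N$ is square-free and $L$ is $\mathcal{C}$-endomorphism-invariant. (iii) $M$ is a clean module. (2) If $M\in\mathcal{C}$ is $\mathcal{F}$-automorphism-coinvariant, then: (i) $\mathrm{End}(M)/J(\mathrm{End}(M))$ is von Neumann regular and idempotents lift modulo $J(\mathrm{End}(M))$; consequently, $M$ satisfies the finite exchange property. (ii) $M=N\oplus L$ where $N$ is square-free and $L$ is $\mathcal{F}$-endomorphism-coinvariant. (iii) $M$ is a clean module.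
   Context: Rings are associative with identity, modules are unital right modules, $J(-)$ is the Jacobson radical. A pair $(\mathcal{F},\mathcal{C})$ of classes of modules is a cotorsion pair if $F\in\mathcal{F}\Leftrightarrow \mathrm{Ext}^1(F,C)=0$ for all $C\in\mathcal{C}$, and $C\in\mathcal{C}\Leftrightarrow \mathrm{Ext}^1(F,C)=0$ for all $F\in\mathcal{F}$. Under the stated assumptions every module also has a $\mathcal{C}$-envelope. For a class $\mathcal{X}$ closed under isomorphisms: an $\mathcal{X}$-preenvelope of $M$ is a homomorphism $u:M\to X$ with $X\in\mathcal{X}$ such that every homomorphism $M\to X'$ with $X'\in\mathcal{X}$ factors through $u$; it is an $\mathcal{X}$-envelope if, moreover, every $h\in\mathrm{End}(X)$ with $h\circ u=u$ is an automorphism. Dually, an $\mathcal{X}$-precover is a homomorphism $p:X\to M$ with $X\in\mathcal{X}$ through which every homomorphism $X'\to M$ with $X'\in\mathcal{X}$ factors; it is an $\mathcal{X}$-cover if, moreover, every $h\in\mathrm{End}(X)$ with $p\circ h=p$ is an automorphism. $M$ is $\mathcal{X}$-automorphism-invariant (resp. $\mathcal{X}$-endomorphism-invariant) if there is an $\mathcal{X}$-envelope $u:M\to X$ such that for every automorphism (resp. endomorphism) $g$ of $X$ there is $f\in\mathrm{End}(M)$ with $u\circ f=g\circ u$. $M$ is $\mathcal{X}$-automorphism-coinvariant (resp. $\mathcal{X}$-endomorphism-coinvariant) if there is an $\mathcal{X}$-cover $p:X\to M$ such that for every automorphism (resp. endomorphism) $g$ of $X$ there is $f\in\mathrm{End}(M)$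 with $f\circ p=p\circ g$. A module $N$ is square-free if there is no decomposition $N=N_1\oplus N_2\oplus N_3$ with $N_1\cong N_2\neq 0$. A module $M$ has the finite exchange property if for every module $A$ and decompositions $A=M'\oplus N=\bigoplus_{i\in I}A_i$ with $M'\cong M$ and $I$ finite there are submodules $B_i\subseteq A_i$ with $A=M'\oplus\bigl(\bigoplus_{i\in I}B_i\bigr)$. A ring is clean if each element is the sum of an idempotent and a unit; a module $M$ is clean if $\mathrm{End}(M)$ is a clean ring. *)

(* Defs.v *)
From HB Require Import structures.
From mathcomp Require Import all_boot all_order all_algebra.
From mathcomp Require Import boolp.

Set Implicit Arguments.
Unset Strict Implicit.
Unset Printing Implicit Defensive.

Import GRing.Theory.
Local Open Scope ring_scope.
Local Open Scope quotient_scope.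

(* Right R-modules are left modules over the converse ring.  [pzRingType] is
   used throughout, since the endomorphism ring of the zero module is the zero
   ring.  Auxiliary notions are stated for left modules over a ring A, which is
   instantiated with [R^c]. *)
Notation rmodType R := (lmodType R^c).

Section Rings.
Variable S : pzRingType.
Implicit Types I K : {pred S}.

Definition right_ideal I : Prop :=
  zmod_closed I /\ forall x a, x \in I -> x * a \in I.

Definition proper_right_ideal I : Prop :=
  right_ideal I /\ exists x, x \notin I.

Definition maximal_right_ideal I : Prop :=
  proper_right_ideal I /\
  forall K, proper_right_ideal K -> {subset I <= K} -> {subset K <= I}.

Definition jacobson : {pred S} :=
  fun x => `[< forall I, maximal_right_ideal I -> x \in I >].

Lemma jacobsonP x :
  reflect (forall I, maximal_right_ideal I -> x \in I) (x \in jacobson).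
Proof. exact: asboolP. Qed.

Lemma jacobson_zmod_closed : zmod_closed jacobson.
Proof.
split=> [|x y /jacobsonP Jx /jacobsonP Jy]; apply/jacobsonP => I mI;
  have [[[[I0 IB] _] _] _] := mI => //.
exact: IB (Jx _ mI) (Jy _ mI).
Qed.

Lemma jacobsonMr x a : x \in jacobson -> x * a \in jacobson.
Proof.
move=> /jacobsonP Jx; apply/jacobsonP => I mI.
by have [[[_ IM] _] _] := mI; apply/IM/Jx.
Qed.

Lemma right_ideal1 I : right_ideal I -> 1 \in I -> forall x, x \in I.
Proof. by move=> [_ IM] I1 x; rewrite -[x]mul1r IM. Qed.

(* If s is not in the maximal right ideal I, then {y | s y in I} is again a
   maximal right ideal. *)
Lemma jacobsonMl s x : x \in jacobson -> s * x \in jacobson.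
Proof.
move=> /jacobsonP Jx; apply/jacobsonP => I mI.
have [[rI [z Iz]] maxI] := mI; have [[I0 IB] IM] := rI.
have [Is|Is] := boolP (s \in I); first exact: IM.
pose I' : {pred S} := [pred y | s * y \in I].
suff mI' : maximal_right_ideal I' by have := Jx _ mI'; rewrite inE.
split.
  split; last by exists 1; rewrite inE mulr1.
  split; last by move=> y a; rewrite !inE mulrA => /IM.
  by split=> [|y w]; rewrite !inE ?mulr0 ?mulrBr => // Iy Iw; apply: IB.
move=> K [rK [w Kw]] I'K k Kk; have [[K0 KB] KM] := rK.
rewrite inE; apply: contraT => Isk.
have K1 : 1 \notin K by apply/negP => K1; rewrite (right_ideal1 rK K1) in Kw.
pose P : {pred S} := fun y => `[< exists r, y - s * k * r \in I >].
have PP y : reflect (exists r, y - s * k * r \in I) (y \in P) by exact: asboolP.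
have rP : right_ideal P.
  split; last first.
    move=> y a /PP[r Pr]; apply/PP; exists (r * a).
    by rewrite [s * k * _]mulrA -mulrBl IM.
  split=> [|y y' /PP[r Ir] /PP[r' Ir']]; apply/PP.
    by exists 0; rewrite mulr0 subr0.
  exists (r - r'); rewrite mulrBr opprB addrACA [- y' - _]addrC.
  by have := IB _ _ Ir Ir'; rewrite opprB addrACA.
have IP : {subset I <= P}.
  by move=> y Iy; apply/PP; exists 0; rewrite mulr0 subr0.
have Psk : s * k \in P by apply/PP; exists 1; rewrite mulr1 subrr.
have Ps : s \in P.
  apply: contraT => Ps.
  have /maxI/(_ IP)/(_ _ Psk) : proper_right_ideal P by split=> //; exists s.
  by rewrite (negPf Isk).
have /PP[r Ir] := Ps.
have : 1 - k * r \in K by apply: I'K; rewrite inE mulrBr mulr1 mulrA.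
move=> K1kr; case/negP: K1.
have /(KB _ _ K1kr) : - (k * r) \in K by rewrite -sub0r KB // KM.
by rewrite opprK subrK.
Qed.

HB.instance Definition _ := GRing.isZmodClosed.Build S jacobson
  jacobson_zmod_closed.

Definition jacobson_quot := Quotient.quot (GRing.ZmodClosed.clone S jacobson _).

HB.instance Definition _ := GRing.Zmodule.on jacobson_quot.
HB.instance Definition _ : EqQuotient S _ jacobson_quot :=
  EqQuotient.on jacobson_quot.

Lemma jacobson_eqmod x y :
  (x - y \in jacobson) = (x == y %[mod jacobson_quot]).
Proof. exact: Quotient.idealrBE. Qed.

Definition jquot_one : jacobson_quot := \pi_jacobson_quot 1.
Definition jquot_mul := lift_op2 jacobson_quot *%R.

Lemma pi_jquotD x y :
  \pi_jacobson_quot (x + y) = \pi_jacobson_quot x + \pi_jacobson_quot y.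
Proof. exact: Quotient.pi_add. Qed.

Lemma pi_jquotM x y :
  \pi_jacobson_quot (x * y) = jquot_mul (\pi x) (\pi y).
Proof.
unlock jquot_mul; apply/eqP; rewrite -jacobson_eqmod.
set x' := repr (\pi x); set y' := repr (\pi y).
have Jx : x - x' \in jacobson by rewrite jacobson_eqmod reprK.
have Jy : y - y' \in jacobson by rewrite jacobson_eqmod reprK.
rewrite -[x * y](subrK (x' * y)) -mulrBl -addrA -mulrBr.
by apply: rpredD; [exact: jacobsonMr | exact: jacobsonMl].
Qed.

Fact jquot_mulA : associative jquot_mul.
Proof.
by move=> x y z; rewrite -[x]reprK -[y]reprK -[z]reprK -!pi_jquotM mulrA.
Qed.

Fact jquot_mul1r : left_id jquot_one jquot_mul.
Proof. by move=> x; rewrite -[x]reprK -pi_jquotM mul1r. Qed.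

Fact jquot_mulr1 : right_id jquot_one jquot_mul.
Proof. by move=> x; rewrite -[x]reprK -pi_jquotM mulr1. Qed.

Fact jquot_mulDl : left_distributive jquot_mul +%R.
Proof.
move=> x y z; rewrite -[x]reprK -[y]reprK -[z]reprK.
by rewrite -!pi_jquotD -!pi_jquotM -pi_jquotD mulrDl.
Qed.

Fact jquot_mulDr : right_distributive jquot_mul +%R.
Proof.
move=> x y z; rewrite -[x]reprK -[y]reprK -[z]reprK.
by rewrite -!pi_jquotD -!pi_jquotM -pi_jquotD mulrDr.
Qed.

HB.instance Definition _ := GRing.Zmodule_isPzRing.Build jacobson_quot
  jquot_mulA jquot_mul1r jquot_mulr1 jquot_mulDl jquot_mulDr.

Definition idempotent_elt (e : S) : Prop := e * e = e.

Definition invertible (u : S) : Prop := exists v, u * v = 1 /\ v * u = 1.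

Definition von_neumann_regular : Prop :=
  forall a : S, exists x, a * x * a = a.

Definition clean_ring : Prop :=
  forall a : S, exists e u, [/\ idempotent_elt e, invertible u & a = e + u].

End Rings.

Definition idempotents_lift_mod_jacobson (S : pzRingType) : Prop :=
  forall a : jacobson_quot S, idempotent_elt a ->
    exists e : S, idempotent_elt e /\ \pi_(jacobson_quot S) e = a.

Section Modules.
Variable A : pzRingType.
Implicit Types (L M N X Y Z : lmodType A) (F C P : lmodType A -> Prop).

Lemma linear_ext M N (f g : {linear M -> N}) : f =1 g -> f = g.
Proof.
case: f g => f [[fN] [fZ]] [g [[gN] [gZ]]] /= /funext fg; subst g.
by rewrite (Prop_irrelevance fN gN) (Prop_irrelevance fZ gZ).
Qed.

Definition lmodEnd M := {linear M -> M}.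
HB.instance Definition _ M := gen_eqMixin (lmodEnd M).
HB.instance Definition _ M := gen_choiceMixin (lmodEnd M).

Section EndRing.
Variable M : lmodType A.
Implicit Types f g h : lmodEnd M.

Definition End_add f g : lmodEnd M := f \+ g.
Definition End_opp f : lmodEnd M := \- f.
Definition End_zero : lmodEnd M := \0.
Definition End_one : lmodEnd M := idfun.
Definition End_mul f g : lmodEnd M := f \o g.

Fact End_addA : associative End_add.
Proof. by move=> f g h; apply: linear_ext => x /=; rewrite addrA. Qed.
Fact End_addC : commutative End_add.
Proof. by move=> f g; apply: linear_ext => x /=; rewrite addrC. Qed.
Fact End_add0r : left_id End_zero End_add.
Proof. by move=> f; apply: linear_ext => x /=; rewrite add0r. Qed.
Fact End_addNr : left_inverse End_zero End_opp End_add.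
Proof. by move=> f; apply: linear_ext => x /=; rewrite addNr. Qed.
Fact End_mulA : associative End_mul.
Proof. by move=> f g h; apply: linear_ext. Qed.
Fact End_mul1r : left_id End_one End_mul.
Proof. by move=> f; apply: linear_ext. Qed.
Fact End_mulr1 : right_id End_one End_mul.
Proof. by move=> f; apply: linear_ext. Qed.
Fact End_mulDl : left_distributive End_mul End_add.
Proof. by move=> f g h; apply: linear_ext. Qed.
Fact End_mulDr : right_distributive End_mul End_add.
Proof. by move=> f g h; apply: linear_ext => x /=; rewrite linearD. Qed.

HB.instance Definition _ := GRing.isPzRing.Build (lmodEnd M)
  End_addA End_addC End_add0r End_addNr
  End_mulA End_mul1r End_mulr1 End_mulDl End_mulDr.
End EndRing.

(* The class of extensions 0 -> Y -> E -> X -> 0 represents the Yoneda group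
   Ext^1(X, Y), whose zero element is the class of the split extension. *)
Record extension X Y := Extension {
  ext_mod :> lmodType A;
  ext_in : {linear Y -> ext_mod};
  ext_out : {linear ext_mod -> X};
  ext_in_inj : injective ext_in;
  ext_out_surj : forall x, exists e, ext_out e = x;
  ext_exact : forall e, ext_out e = 0 <-> exists y, e = ext_in y
}.

Definition ext_equiv X Y (E E' : extension X Y) : Prop :=
  exists h : {linear E -> E'},
    h \o ext_in E =1 ext_in E' /\ ext_out E' \o h =1 ext_out E.

Definition inl_fun X Y (y : Y) : (Y * X)%type := (y, 0).

Fact inl_fun_linear X Y : linear (@inl_fun X Y).
Proof. by move=> a y y'; congr pair; rewrite /= scaler0 addr0. Qed.

HB.instance Definition _ X Y :=
  GRing.isLinear.Build A Y (Y * X)%type _ (@inl_fun X Y) (@inl_fun_linear X Y).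

Fact split_in_inj X Y : injective (@inl_fun X Y).
Proof. by move=> y y' []. Qed.

Fact split_out_surj X Y (x : X) : exists e : Y * X, e.2 = x.
Proof. by exists (0, x). Qed.

Fact split_exact X Y (e : Y * X) : e.2 = 0 <-> exists y, e = inl_fun X y.
Proof. by split=> [|[y ->] //]; case: e => y x /= ->; exists y. Qed.

Definition split_extension X Y : extension X Y :=
  @Extension X Y (Y * X)%type (@inl_fun X Y) snd
    (@split_in_inj X Y) (@split_out_surj X Y) (@split_exact X Y).

Definition Ext1_eq0 X Y : Prop :=
  forall E : extension X Y, ext_equiv E (split_extension X Y).

Definition cotorsion_pair F C : Prop :=
  (forall X, F X <-> forall Y, C Y -> Ext1_eq0 X Y) /\
  (forall Y, C Y <-> forall X, F X -> Ext1_eq0 X Y).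

Definition is_preenvelope P M X (u : {linear M -> X}) : Prop :=
  P X /\ forall X' (g : {linear M -> X'}), P X' ->
    exists h : {linear X -> X'}, h \o u =1 g.

Definition is_envelope P M X (u : {linear M -> X}) : Prop :=
  is_preenvelope P u /\ forall h : {linear X -> X}, h \o u =1 u -> bijective h.

Definition is_precover P M X (p : {linear X -> M}) : Prop :=
  P X /\ forall X' (g : {linear X' -> M}), P X' ->
    exists h : {linear X' -> X}, p \o h =1 g.

Definition is_cover P M X (p : {linear X -> M}) : Prop :=
  is_precover P p /\ forall h : {linear X -> X}, p \o h =1 p -> bijective h.

Definition automorphism_invariant P M : Prop :=
  exists X (u : {linear M -> X}), is_envelope P u /\
    forall g : {linear X -> X}, bijective g ->
      exists f : {linear M -> M}, u \o f =1 g \o u.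

Definition endomorphism_invariant P M : Prop :=
  exists X (u : {linear M -> X}), is_envelope P u /\
    forall g : {linear X -> X}, exists f : {linear M -> M}, u \o f =1 g \o u.

Definition automorphism_coinvariant P M : Prop :=
  exists X (p : {linear X -> M}), is_cover P p /\
    forall g : {linear X -> X}, bijective g ->
      exists f : {linear M -> M}, f \o p =1 p \o g.

Definition endomorphism_coinvariant P M : Prop :=
  exists X (p : {linear X -> M}), is_cover P p /\
    forall g : {linear X -> X}, exists f : {linear M -> M}, f \o p =1 p \o g.

Section DirectLimit.
Variables (d : Order.disp_t) (I : porderType d) (X_ : I -> lmodType A).
Variable f : forall i j, (i <= j)%O -> {linear X_ i -> X_ j}.

Definition direct_system : Prop :=
  [/\ inhabited I,
      forall i j : I, exists k : I, (i <= k)%O /\ (j <= k)%O,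
      forall i (le_ii : (i <= i)%O), f le_ii =1 id
    & forall i j k (le_ij : (i <= j)%O) (le_jk : (j <= k)%O) (le_ik : (i <= k)%O),
        f le_jk \o f le_ij =1 f le_ik].

Definition cocone L (u : forall i, {linear X_ i -> L}) : Prop :=
  forall i j (le_ij : (i <= j)%O), u j \o f le_ij =1 u i.

Definition direct_limit L (u : forall i, {linear X_ i -> L}) : Prop :=
  cocone u /\
  forall L' (v : forall i, {linear X_ i -> L'}), cocone v ->
    exists g : {linear L -> L'}, (forall i, g \o u i =1 v i) /\
      forall g' : {linear L -> L'}, (forall i, g' \o u i =1 v i) -> g' =1 g.

End DirectLimit.

Definition closed_under_direct_limits P : Prop :=
  forall (d : Order.disp_t) (I : porderType d) (X_ : I -> lmodType A)
    (f : forall i j, (i <= j)%O -> {linear X_ i -> X_ j}) L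
    (u : forall i, {linear X_ i -> L}),
  direct_system f -> (forall i, P (X_ i)) -> direct_limit f u -> P L.

Definition submod M (N : submodClosed M) := {x : M | x \in N}.

HB.instance Definition _ M (N : submodClosed M) := Choice.on (submod N).
HB.instance Definition _ M (N : submodClosed M) := SubType.on (submod N).
HB.instance Definition _ M (N : submodClosed M) :=
  [SubChoice_isSubLmodule of submod N by <:].

Definition lmod_iso M N : Prop := exists f : {linear M -> N}, bijective f.

Definition direct_sum M (I : finType) (B : I -> submodClosed M) : Prop :=
  forall x : M, exists! b : {ffun I -> M},
    (forall i, b i \in B i) /\ x = \sum_i b i.

Definition direct_sum_of M n (B : n.-tuple (submodClosed M)) : Prop :=
  direct_sum (tnth B).

Definition square_free M : Prop :=
  ~ exists N1 N2 N3 : submodClosed M,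
      [/\ direct_sum_of [tuple N1; N2; N3],
          lmod_iso (submod N1) (submod N2)
        & exists2 x, x \in N2 & x != 0].

Definition finite_exchange_property M : Prop :=
  forall (V : lmodType A) (M' N : submodClosed V)
    (I : finType) (V_ : I -> submodClosed V),
  lmod_iso (submod M') M -> direct_sum_of [tuple M'; N] -> direct_sum V_ ->
  exists B : I -> submodClosed V,
    (forall i, {subset B i <= V_ i}) /\
    direct_sum (fun o : option I => if o is Some i then B i else M').

Definition clean_module M : Prop := clean_ring (lmodEnd M).

End Modules.

(* Main.v *)
(* If M lies in F and u : M -> X is its C-envelope (or M lies in C and p : X -> M
   is its F-cover), then X lies in both classes.  Let S = End X and J its radical.
   For a + b = 1 in S, closure of F under direct limits and the vanishing of
   Ext^1(F, X) give a cocone in the category of such pairs for every chain of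
   pairs; a cardinality argument then yields maximal pairs, from which one reads
   off that idempotents lift modulo J and that every left ideal not inside J
   contains a nonzero idempotent.  Directed unions of direct summands of X have
   quotient in F, so maps defined on them extend to X; hence S/J is von Neumann
   regular and right self-injective, so that S/J is clean and splits as a part
   generated by square-zero 2 x 2 matrix units and a part without nonzero
   square-zero elements.

   Invariance under automorphisms says that the endomorphisms of X that induce
   one of M form a subring of S containing all units.  Such a subring contains J,
   and modulo J it contains every square-zero element; this gives the regularity
   and cleanness of End M, and it contains the whole corner of the matrix part,
   which therefore provides the endomorphism-invariant summand L, whereas the
   other part provides the square-free summand N.  The finite exchange property
   follows from cleanness. *)

From Stdlib Require Import Ncring Ncring_tac.
Require Import Defs.
From HB Require Import structures.
From mathcomp Require Import all_boot all_order all_algebra.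
From mathcomp Require Import boolp classical_sets functions wochoice.

Set Implicit Arguments.
Unset Strict Implicit.
Unset Printing Implicit Defensive.

Import Order.TTheory GRing.Theory Num.Theory.
Local Open Scope ring_scope.
Local Open Scope quotient_scope.

(** A pair a + b = 1 yields the split exact sequence 0 -> X -> X x X -> X -> 0 with maps z |-> (a z,
    b z) and (x, y) |-> b x - a y. Along a chain of pairs the left-hand X does not move, while the
    right-hand term becomes a direct limit of copies of X and so lies in F. The limit sequence
    therefore splits, and the retraction onto X is the cocone. Zorn's lemma for the preorder of
    pairs is out of reach: cocones exist only over chains with compatible arrows, and a chain of the
    preorder does not come with such arrows. They are built by transfinite recursion instead, along
    a well-order too long for the objects to stay distinct. The invariance of M is kept as a
    relation between End X and End M, read as: g induces f. It is a partial ring homomorphism onto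
    End M, which lets the envelope and the cover share one transfer argument. *)

(** Applying [Zorn_bigcup] to the sets whose union with A0 satisfies [P] turns the empty chain into
    the case P A0 and puts the maximal set above A0. *)
Lemma zorn_set (T : Type) (P : set T -> Prop) (A0 : set T) :
  P A0 ->
  (forall F : set (set T), (exists A, F A) -> (forall A, F A -> P A) ->
     (forall A B, F A -> F B -> A `<=` B \/ B `<=` A)%classic ->
     P (fun x => exists2 A, F A & A x)) ->
  exists A, [/\ P A, (A0 `<=` A)%classic
    & forall B, P B -> (A `<=` B)%classic -> (B `<=` A)%classic].
Proof.
move=> P0 Pchain.
have [F FQ Ftot|A [PA Amax]] := @Zorn_bigcup T (fun A => P (A `|` A0)%classic).
  have [[A FA]|F0] := pselect (exists A, F A); last first.
    have -> : ((\bigcup_(X in F) X) `|` A0 = A0)%classic.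
      by apply/seteqP; split=> x; [case=> // -[B FB]; case: F0; exists B|right].
    exact: P0.
  pose F' B := exists2 A, F A & B = (A `|` A0)%classic.
  have -> : ((\bigcup_(X in F) X) `|` A0)%classic = fun x => exists2 B, F' B & B x.
    apply/seteqP; split=> [x [[B FB Bx]|A0x]|x [_ [B FB ->] [Bx|A0x]]].
    - by exists (B `|` A0)%classic; [exists B|left].
    - by exists (A `|` A0)%classic; [exists A|right].
    - by left; exists B.
    - by right.
  apply: Pchain => [|_ [B FB ->]|_ _ [B FB ->] [C FC ->]].
  - by exists (A `|` A0)%classic; exists A.
  - exact: FQ.
  - by have [h|h] := Ftot B C FB FC; [left|right]; apply: setSU.
exists (A `|` A0)%classic; split=> // B PB AB x Bx.
have [Ax|nAx] := pselect (A x); first by left.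
have eB : (B `|` A0)%classic = B.
  by apply/seteqP; split=> y; [case=> // ?; apply: AB; right|left].
case: (Amax B); last by rewrite eB.
by split=> [y Ay|BA]; [apply: AB; left|apply/nAx/BA].
Qed.

(** Registers MathComp rings with [Ncring], so that [nc] proves identities valid in every
    noncommutative ring. *)
#[local] Instance pzRing_ops (T : pzRingType) :
  @Ring_ops T 0 1 +%R *%R (fun x y => x - y) -%R eq := {}.

#[local] Instance pzRing_Ring (T : pzRingType) :
  @Ring T _ _ _ _ _ _ _ (pzRing_ops T).
Proof.
constructor; try exact _.
all: try by move=> ? ? -> ? ? ->.
- exact: (@add0r T).
- exact: (@addrC T).
- exact: (@addrA T).
- exact: (@mul1r T).
- exact: (@mulr1 T).
- exact: (@mulrA T).
- exact: (@mulrDl T).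
- by move=> x y z; exact: (@mulrDr T).
- by [].
- exact: (@subrr T).
Qed.

Ltac nc := rewrite /idempotent_elt; non_commutative_ring.

(** * Regular right self-injective rings are clean *)

Section SelfInjective.
Variable T : pzRingType.
Implicit Types (G : set (T * T)) (N Z : set T).

Definition rideal N : Prop :=
  [/\ N 0, forall x y, N x -> N y -> N (x - y) & forall x r, N x -> N (x * r)].

(** A submodule of T x T stands for a partial, possibly multivalued, right linear map; such graphs
    are ordered by inclusion, ready for Zorn's lemma. *)
Definition rgraph G : Prop :=
  [/\ G (0, 0),
      forall x y x' y', G (x, y) -> G (x', y') -> G (x - x', y - y')
    & forall x y r, G (x, y) -> G (x * r, y * r)].

(** Baer's criterion, with homomorphisms from right ideals to T given by their graphs. *)
Definition right_self_injective : Prop :=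
  forall G, rgraph G -> (forall y, G (0, y) -> y = 0) ->
    exists t, forall x y, G (x, y) -> t * x = y.

Lemma chain2 (U : Type) (F : set (set U)) x y :
  (forall A B, F A -> F B -> A `<=` B \/ B `<=` A)%classic ->
  (exists2 A, F A & A x) -> (exists2 A, F A & A y) ->
  exists A, [/\ F A, A x & A y].
Proof.
move=> tot [A FA Ax] [B FB By]; case: (tot A B FA FB) => h.
  by exists B; split=> //; apply: h.
by exists A; split=> //; apply: h.
Qed.

Lemma rideal_chain (F : set (set T)) : (exists A, F A) ->
  (forall A, F A -> rideal A) ->
  (forall A B, F A -> F B -> A `<=` B \/ B `<=` A)%classic ->
  rideal (fun x => exists2 A, F A & A x).
Proof.
move=> [A FA] Fr tot; split.
- by exists A => //; case: (Fr _ FA).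
- move=> x y Fx Fy; have [B [FB Bx By]] := chain2 tot Fx Fy.
  by exists B => //; case: (Fr _ FB) => _ + _; apply.
- by move=> x r [B FB Bx]; exists B => //; case: (Fr _ FB) => _ _; apply.
Qed.

Lemma rgraph_chain (F : set (set (T * T))) : (exists A, F A) ->
  (forall A, F A -> rgraph A) ->
  (forall A B, F A -> F B -> A `<=` B \/ B `<=` A)%classic ->
  rgraph (fun x => exists2 A, F A & A x).
Proof.
move=> [A FA] Fr tot; split.
- by exists A => //; case: (Fr _ FA).
- move=> x y x' y' Fx Fy; have [B [FB Bx By]] := chain2 tot Fx Fy.
  by exists B => //; case: (Fr _ FB) => _ + _; apply.
- by move=> x y r [B FB Bx]; exists B => //; case: (Fr _ FB) => _ _; apply.
Qed.

Hypothesis Treg : von_neumann_regular T.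
Hypothesis Tinj : right_self_injective.

(** e T is an injective hull of N in T. With Z maximal among the right ideals meeting N in 0, the
    projection of N + Z onto N extends to left multiplication by e. By regularity only 0 annihilates
    N + Z from the left ([ess]). The last clause lets later identities be checked on N alone. *)
Lemma hull N : rideal N -> exists e : T,
  [/\ e * e = e, forall x, N x -> e * x = x
    & forall d, (forall x, N x -> d * x = 0) -> d * e = 0].
Proof.
move=> [N0 NB NM].
pose P Z := rideal Z /\ forall x, N x -> Z x -> x = 0.
have [||Z [[[Z0 ZB ZM] NZ] _ Zmax]] := @zorn_set T P (fun x => x = 0).
- split=> //; split=> [|x y -> ->|x r ->] //; first by rewrite subr0.
  by rewrite mul0r.
- move=> F F0 FP tot; split.
    by apply: rideal_chain => // A /FP[].
  by move=> x Nx [A /FP[_ +] Ax]; apply.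
have ess d : (forall x, N x -> d * x = 0) -> (forall z, Z z -> d * z = 0) -> d = 0.
  move=> dN dZ; have [y dyd] := Treg d.
  suff : y * d = 0 by move=> yd; rewrite -dyd -mulrA yd mulr0.
  (* Z + y d T still meets N in 0: applying d to x = z + y d r in N gives d r = 0. Maximality of Z
     then puts y d in Z. *)
  pose B x := exists2 z, Z z & exists r, x = z + y * d * r.
  have PB : P B.
    split.
      split; first by exists 0 => //; exists 0; rewrite mulr0 addr0.
        move=> _ _ [z Zz [r ->]] [z' Zz' [r' ->]]; exists (z - z'); first exact: ZB.
        by exists (r - r'); nc.
      move=> _ r' [z Zz [r ->]]; exists (z * r'); first exact: ZM.
      by exists (r * r'); nc.
    move=> x Nx [z Zz [r xE]]; have := dN _ Nx.
    rewrite xE mulrDr dZ // add0r 2!mulrA dyd => dr.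
    by move: (xE); rewrite -mulrA dr mulr0 addr0 => xz; apply: NZ; rewrite -?xz // xz.
  have /(Zmax _ PB) h : (Z `<=` B)%classic.
    by move=> z Zz; exists z => //; exists 0; rewrite mulr0 addr0.
  have /h/dZ : B (y * d).
    by exists 0 => //; exists 1; rewrite mulr1 add0r.
  by rewrite mulrA dyd => ->; rewrite mulr0.
pose G : set (T * T) := fun p => N p.2 /\ Z (p.1 - p.2).
have [||e eP] := Tinj (G := G).
- split; rewrite /G /=; first by rewrite subr0.
    move=> x y x' y' [Ny Zxy] [Ny' Zxy']; split; first exact: NB.
    by have := ZB _ _ Zxy Zxy'; congr Z; nc.
  by move=> x y r [Ny Zxy]; split; [apply: NM|rewrite -mulrBl; apply: ZM].
- move=> y [/= Ny]; rewrite sub0r => ZNy; apply: NZ => //.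
  by have := ZB _ _ Z0 ZNy; rewrite sub0r opprK.
have eN x : N x -> e * x = x by move=> Nx; apply: eP; split; rewrite //= subrr.
have eZ z : Z z -> e * z = 0 by move=> Zz; apply: eP; split; rewrite //= subr0.
exists e; split=> //.
  apply/eqP; rewrite -subr_eq0; apply/eqP/ess => [x Nx|z Zz].
    by rewrite mulrBl -mulrA !eN // subrr.
  by rewrite mulrBl -mulrA !eZ // subrr.
move=> d dN; apply: ess => [x Nx|z Zz]; first by rewrite -mulrA eN ?dN.
by rewrite -mulrA eZ // mulr0.
Qed.

(** G is maximal among the graphs of isomorphisms between two right ideals with direct sum; the
    condition on x + y' = 0 says just this. s is G on the first ideal and 0 on the second, t is its
    inverse, and e is the hull of the sum. A square-zero x in the corner of 1 - e would enlarge
    G. *)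
Lemma matrix_units_decomposition : exists e s t : T,
  [/\ e * e = e, e * s * e = s & e * t * e = t] /\
  [/\ s * s = 0, t * t = 0, s * t + t * s = e
    & forall x, (1 - e) * x * (1 - e) = x -> x * x = 0 -> x = 0].
Proof.
pose P G := rgraph G /\ forall x y x' y', G (x, y) -> G (x', y') ->
  x + y' = 0 -> [/\ x = 0, y = 0, x' = 0 & y' = 0].
have [||G [[rG Gdir] _ Gmax]] := @zorn_set (T * T) P (fun p => p = (0, 0)).
- split; first split=> [//|x y x' y' [-> ->] [-> ->]|x y r [-> ->]].
  + by rewrite subr0.
  + by rewrite mul0r.
  + by move=> x y x' y' [ex ey] [ex' ey']; rewrite ex ey ex' ey'.
- move=> F F0 FP tot; split; first by apply: rgraph_chain => // A /FP[].
  move=> x y x' y' Fx Fx'; have [A [FA Ax Ax']] := chain2 tot Fx Fx'.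
  by have [_] := FP _ FA; apply.
have [G0 GB GM] := rG.
(* Directness makes x + y' determine x, y, x' and y', so a right linear function of these four is
   left multiplication by some t. *)
have ext (f : T -> T -> T -> T -> T) :
    (forall a b c d a' b' c' d', f a b c d - f a' b' c' d' =
       f (a - a') (b - b') (c - c') (d - d')) ->
    (forall a b c d r, f a b c d * r = f (a * r) (b * r) (c * r) (d * r)) ->
    f 0 0 0 0 = 0 ->
    exists t, forall x y x' y', G (x, y) -> G (x', y') ->
      t * (x + y') = f x y x' y'.
  move=> fB fM f0.
  pose H : set (T * T) := fun p => exists x y x' y',
    [/\ G (x, y), G (x', y') & p = (x + y', f x y x' y')].
  have [||t tH] := Tinj (G := H).
  - split.
    + by exists 0, 0, 0, 0; split=> //; rewrite addr0 f0.
    + move=> k1 v1 k2 v2 [x [y [x' [y' [Gx Gx' [-> ->]]]]]].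
      move=> [z [w [z' [w' [Gz Gz' [-> ->]]]]]].
      exists (x - z), (y - w), (x' - z'), (y' - w').
      by split; [exact: GB|exact: GB|rewrite fB; congr pair; nc].
    + move=> k1 v1 r [x [y [x' [y' [Gx Gx' [-> ->]]]]]].
      exists (x * r), (y * r), (x' * r), (y' * r).
      by split; [exact: GM|exact: GM|rewrite fM; congr pair; nc].
  - move=> y0 [x [y [x' [y' [Gx Gx' [xy' ->]]]]]].
    by have [] := Gdir _ _ _ _ Gx Gx' (esym xy') => -> -> -> ->.
  by exists t => x y x' y' Gx Gx'; apply: tH; exists x, y, x', y'.
have [//|a b c d r //|//|sg sgP] := ext (fun x y x' y' => y).
have [//|a b c d r //|//|ta taP] := ext (fun x y x' y' => x').
pose K : set T := fun k => exists x y x' y',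
  [/\ G (x, y), G (x', y') & k = x + y'].
have [|e [ee eK eess]] := hull (N := K).
  split.
  - by exists 0, 0, 0, 0; rewrite addr0.
  - move=> _ _ [x [y [x' [y' [Gx Gx' ->]]]]] [z [w [z' [w' [Gz Gz' ->]]]]].
    exists (x - z), (y - w), (x' - z'), (y' - w').
    by split; [exact: GB|exact: GB|nc].
  - move=> _ r [x [y [x' [y' [Gx Gx' ->]]]]].
    exists (x * r), (y * r), (x' * r), (y' * r).
    by split; [exact: GM|exact: GM|nc].
have K1 x y : G (x, y) -> K x.
  by move=> Gx; exists x, y, 0, 0; rewrite addr0.
have K2 x y : G (x, y) -> K y.
  by move=> Gx; exists 0, 0, x, y; rewrite add0r.
have KP x y x' y' : G (x, y) -> G (x', y') -> K (x + y').
  by move=> Gx Gx'; exists x, y, x', y'.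
have sP x y x' y' : G (x, y) -> G (x', y') -> e * sg * e * (x + y') = y.
  move=> Gx Gx'; rewrite -mulrA (eK _ (KP _ _ _ _ Gx Gx')) -mulrA.
  by rewrite (sgP _ _ _ _ Gx Gx') (eK _ (K2 _ _ Gx)).
have tP x y x' y' : G (x, y) -> G (x', y') -> e * ta * e * (x + y') = x'.
  move=> Gx Gx'; rewrite -mulrA (eK _ (KP _ _ _ _ Gx Gx')) -mulrA.
  by rewrite (taP _ _ _ _ Gx Gx') (eK _ (K1 _ _ Gx')).
set s := e * sg * e in sP; set t := e * ta * e in tP.
have se : s * e = s by rewrite /s -mulrA ee.
have te : t * e = t by rewrite /t -mulrA ee.
have es : e * s = s by rewrite /s !mulrA ee.
have et : e * t = t by rewrite /t !mulrA ee.
have s1 x y : G (x, y) -> s * x = y by move=> /sP/(_ G0); rewrite addr0.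
have s2 x y : G (x, y) -> s * y = 0 by move=> /(sP _ _ _ _ G0); rewrite add0r.
have t1 x y : G (x, y) -> t * x = 0 by move=> /tP/(_ G0); rewrite addr0.
have t2 x y : G (x, y) -> t * y = x by move=> /(tP _ _ _ _ G0); rewrite add0r.
clearbody s t.
exists e, s, t; split; first by split; rewrite // ?es ?et.
split.
- rewrite -{2}se mulrA; apply: eess => _ [x [y [x' [y' [Gx Gx' ->]]]]].
  by rewrite -mulrA (sP _ _ _ _ Gx Gx') (s2 _ _ Gx).
- rewrite -{2}te mulrA; apply: eess => _ [x [y [x' [y' [Gx Gx' ->]]]]].
  by rewrite -mulrA (tP _ _ _ _ Gx Gx') (t1 _ _ Gx').
- have : (s * t + t * s - 1) * e = 0.
    apply: eess => _ [x [y [x' [y' [Gx Gx' ->]]]]].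
    rewrite mulrBl mulrDl -!mulrA (sP _ _ _ _ Gx Gx') (tP _ _ _ _ Gx Gx').
    by rewrite (s1 _ _ Gx') (t2 _ _ Gx); nc.
  by move/eqP; rewrite mulrBl mulrDl -!mulrA se te mul1r subr_eq0 => /eqP.
have idemC : (1 - e) * (1 - e) = 1 - e.
  have -> : (1 - e) * (1 - e) = 1 - e - e + e * e by nc.
  by rewrite ee; nc.
move=> x fxf xx.
have xK k : K k -> x * k = 0.
  by move=> Kk; rewrite -fxf -mulrA [(1 - e) * k]mulrBl eK // mul1r subrr mulr0.
have fx : (1 - e) * x = x by rewrite -fxf !mulrA idemC.
have [y0 xy0x] := Treg x; pose y := y0 * (1 - e).
have xyx : x * y * x = x by rewrite /y -!mulrA fx mulrA.
have yK k : K k -> y * k = 0.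
  by move=> Kk; rewrite /y -mulrA mulrBl eK // mul1r subrr mulr0.
have [g gE] : exists g, g = y * x by exists (y * x).
have xg : x * g = x by rewrite gE mulrA.
(* As x g = x and g = y x, left multiplication by x is an isomorphism of g T onto x T. Independence
   follows on multiplying by x, where x x = 0, and then by y. *)
pose G' : set (T * T) := fun p => exists a b r,
  G (a, b) /\ p = (a + g * r, b + x * r).
have PG' : P G'.
  split.
    split.
    - by exists 0, 0, 0; rewrite !mulr0 addr0.
    - move=> k1 v1 k2 v2 [a [b [r [Ga [-> ->]]]]] [a' [b' [r' [Ga' [-> ->]]]]].
      exists (a - a'), (b - b'), (r - r'); split; first exact: GB.
      by congr pair; nc.
    - move=> k1 v1 r' [a [b [r [Ga [-> ->]]]]].
      exists (a * r'), (b * r'), (r * r'); split; first exact: GM.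
      by congr pair; nc.
  move=> k1 v1 k2 v2 [a [b [r [Ga [-> ->]]]]] [a' [b' [r' [Ga' [-> ->]]]]] sum0.
  have xr : x * r = 0.
    have := congr1 ( *%R x) sum0; rewrite !mulrDr (xK _ (K1 _ _ Ga)).
    by rewrite (xK _ (K2 _ _ Ga')) !mulrA xg xx mul0r !addr0 add0r mulr0.
  have gr : g * r = 0 by rewrite gE -mulrA xr mulr0.
  have gr' : g * r' = 0.
    have := congr1 ( *%R y) sum0; rewrite gr addr0 !mulrDr (yK _ (K1 _ _ Ga)).
    by rewrite (yK _ (K2 _ _ Ga')) !add0r mulr0 mulrA -gE.
  have xr' : x * r' = 0 by rewrite -xg -mulrA gr' mulr0.
  move: sum0; rewrite gr xr gr' xr' !addr0; exact: Gdir.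
have GG' : (G `<=` G')%classic.
  by case=> a b Ga; exists a, b, 0; rewrite !mulr0 !addr0.
have h := Gmax _ PG' GG' (g, x).
have /h/K1/xK : G' (g, x) by exists 0, 0, 1; rewrite !mulr1 !add0r.
by rewrite xg.
Qed.

(* For b = 1 - a, G records a partial clean decomposition a = e + u on the sum of
   the right ideals {x | G (x, 0)} and {y | G (0, y)}: the idempotent e is the
   projection x + y |-> y and the unit u is x + y |-> a x - b y.  Since (x, - y)
   is in G along with (x, y), the sign in the definition of u is irrelevant. *)
Definition clean_graph (a b : T) G : Prop :=
  [/\ rgraph G, forall x y, G (x, y) -> G (x, 0),
      forall x y, G (x, y) -> x + y = 0 -> x = 0 /\ y = 0,
      forall x y, G (x, y) -> a * x + b * y = 0 -> x = 0 /\ y = 0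
    & (forall x y, G (x, y) ->
         exists x' y', G (x', y') /\ a * x + b * y = x' + y') /\
      (forall x y, G (x, y) ->
         exists x' y', G (x', y') /\ x + y = a * x' + b * y')].

Section Shift.
Variables f a y : T.
Hypotheses (fa : f * a = a) (af : a * f = a) (yf : y * f = y).
Hypotheses (ff : f * f = f) (fy : f * y = y) (ya : y * a = f).
Let w := f - a * y.

(* [even_part n] is the sum of the right ideals a^(2i) w T for i < n.  When a is
   injective but not onto on f T, the ideals a^i w T are independent, w T being
   a complement of the image of a. *)
Fixpoint even_part (n : nat) (p : T) : Prop :=
  if n is n'.+1 then
    exists r p1, even_part n' p1 /\ p = w * r + a * a * p1
  else p = 0.

Lemma even_partS n p : even_part n p -> even_part n.+1 p.
Proof.
elim: n p => [p ->|n IH p [r [p1 [/IH Ap1 ->]]]]; last by exists r, p1.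
by exists 0, 0; split=> //; rewrite !mulr0 addr0.
Qed.

Lemma even_part_le n m p : (n <= m)%N -> even_part n p -> even_part m p.
Proof.
by move=> /subnK <-; elim: (m - n)%N => // k IH /IH; rewrite addSn => /even_partS.
Qed.

Lemma even_partB n p q : even_part n p -> even_part n q -> even_part n (p - q).
Proof.
elim: n p q => [p q -> ->|n IH p q [r [p1 [Ap ->]]] [r' [q1 [Aq ->]]]].
  by rewrite /= subr0.
by exists (r - r'), (p1 - q1); split; [exact: IH|nc].
Qed.

Lemma even_partM n p r : even_part n p -> even_part n (p * r).
Proof.
elim: n p => [p ->|n IH p [r' [p1 [Ap ->]]]]; first by rewrite /= mul0r.
by exists (r' * r), (p1 * r); split; [exact: IH|nc].
Qed.

Let fw : f * w = w. Proof. by rewrite /w mulrBr ff mulrA fa. Qed.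

Let wa : w * a = 0.
Proof. by rewrite /w mulrBl fa -mulrA ya af subrr. Qed.

Let ww : w * w = w.
Proof. by rewrite {2}/w mulrBr mulrA wa mul0r subr0 /w mulrBl ff -mulrA yf. Qed.

Lemma even_part_corner n p : even_part n p -> f * p = p.
Proof.
case: n => [->|n [r [p1 [_ ->]]]]; first by rewrite mulr0.
by rewrite mulrDr !mulrA fw fa.
Qed.

(** Multiplying by w kills the multiples of a and isolates w r = 0. Multiplying the rest by y strips
    one factor a and exchanges the roles of p and q, whence the induction on n + m. *)
Lemma even_odd_independent (n m : nat) p q : even_part n p -> even_part m q ->
  p + a * q = 0 -> p = 0 /\ q = 0.
Proof.
have [k] := ubnP (n + m)%N; elim: k n m p q => // k IH [|n] m p q lt_nm.
  move=> /= -> Aq; rewrite add0r => aq; split=> //.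
  by rewrite -(even_part_corner Aq) -ya -mulrA aq mulr0.
move=> [r [p1 [Ap1 ->]]] Aq sum0.
have wr : w * r = 0.
  have := congr1 ( *%R w) sum0; rewrite !mulrDr !mulrA wa ww.
  by rewrite !mul0r !addr0 mulr0.
have : q + a * p1 = 0.
  have := congr1 ( *%R y) sum0; rewrite wr add0r mulr0 => <-.
  rewrite mulrDr !mulrA ya fa -{1}(even_part_corner Aq); exact: addrC.
case/(IH m n _ _ _ Aq Ap1) => [|-> ->]; first by rewrite addnC.
by rewrite wr mulr0 addr0.
Qed.

Lemma shift_clean_graph : w != 0 -> exists G,
  [/\ clean_graph a (f - a) G,
      forall x z, G (x, z) -> f * x = x /\ f * z = z
    & exists x z, G (x, z) /\ (x != 0 \/ z != 0)].
Proof.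
move=> w0; pose A p := exists n, even_part n p.
have AB p q : A p -> A q -> A (p - q).
  move=> [n Ap] [m Aq]; exists (maxn n m); apply: even_partB.
    by apply: even_part_le Ap; rewrite leq_maxl.
  by apply: even_part_le Aq; rewrite leq_maxr.
have A0 : A 0 by exists 0.
have AN p : A p -> A (- p) by move=> /(AB _ _ A0); rewrite sub0r.
have AD p q : A p -> A q -> A (p + q) by move=> Ap /AN/(AB _ _ Ap); rewrite opprK.
have AM p r : A p -> A (p * r) by move=> [n Ap]; exists n; apply: even_partM.
have Aaa p : A p -> A (a * a * p).
  by move=> [n Ap]; exists n.+1, 0, p; rewrite mulr0 add0r.
have Af p : A p -> f * p = p by move=> [n /even_part_corner].
have Apq p q : A p -> A q -> A (p + q + q - a * a * q).
  by move=> Ap Aq; exact: (AB _ _ (AD _ _ (AD _ _ Ap Aq) Aq) (Aaa _ Aq)).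
have Aw : A w by exists 1, 1, 0; rewrite mulr1 mulr0 addr0.
have Aind p q : A p -> A q -> p + a * q = 0 -> p = 0 /\ q = 0.
  by move=> [n Ap] [m Aq]; apply: even_odd_independent Ap Aq.
(* For (x, z) = (p, c q), the elements x + z and a x + (f - a) z have components (p - q + a^2 q, q)
   and (- q, p + 2 q - a^2 q) along A + a A. Both are bijective functions of (p, q) in A x A, so
   both sums fill A + a A. *)
pose c := a + a * a - f.
have nuE p q : A q -> p + c * q = (p - q + a * a * q) + a * q.
  by move=> Aq; rewrite -{2}(Af _ Aq) /c; nc.
have muE p q : A q -> a * p + (f - a) * (c * q) =
    - q + a * (p + q + q - a * a * q).
  move=> Aq; rewrite -{2}(Af _ Aq).
  have -> : (f - a) * (c * q) = f * a * q + (f * a) * a * q - f * f * q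
    - a * a * q - a * a * a * q + a * f * q by rewrite /c; nc.
  by rewrite fa ff af; nc.
exists (fun z => exists p q, [/\ A p, A q & z = (p, c * q)]); split.
- split.
  + split.
    * by exists 0, 0; rewrite mulr0.
    * move=> x z x' z' [p [q [Ap Aq [-> ->]]]] [p' [q' [Ap' Aq' [-> ->]]]].
      by exists (p - p'), (q - q'); split; [exact: AB|exact: AB|rewrite mulrBr].
    * move=> x z r [p [q [Ap Aq [-> ->]]]].
      by exists (p * r), (q * r); split; [exact: AM|exact: AM|rewrite mulrA].
  + by move=> x z [p [q [Ap Aq [-> _]]]]; exists p, 0; rewrite mulr0.
  + move=> x z [p [q [Ap Aq [-> ->]]]]; rewrite nuE // => /Aind.
    case=> // [|e1 e2]; first by apply: AD; [apply: AB|apply: Aaa].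
    by move: e1; rewrite e2 !mulr0 addr0 subr0 => ->.
  + move=> x z [p [q [Ap Aq [-> ->]]]]; rewrite muE // => /Aind.
    case=> // [||/eqP]; first exact: AN.
      exact: Apq.
    by rewrite oppr_eq0 => /eqP ->; rewrite !mulr0 !addr0 subr0.
  + split=> x z [p [q [Ap Aq [-> ->]]]].
    * exists (- q - a * a * (p + q + q - a * a * q) + (p + q + q - a * a * q)).
      exists (c * (p + q + q - a * a * q)).
      have Aq' : A (p + q + q - a * a * q).
        exact: Apq.
      split; last by rewrite muE // nuE //; nc.
      do 2!eexists; split; last reflexivity; last by [].
      by apply: AD => //; apply: AB; [apply: AN|apply: Aaa].
    * pose p1 := p - q + a * a * q.
      have Ap1 : A p1 by apply: AD; [apply: AB|apply: Aaa].
      exists (q + p1 + p1 - a * a * p1), (c * - p1); split.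
        do 2!eexists; split; last reflexivity; last exact: AN.
        exact: Apq.
      rewrite muE; last exact: AN.
      by rewrite nuE //; rewrite /p1; nc.
- move=> x z [p [q [Ap Aq [-> ->]]]]; split; first exact: Af.
  by rewrite /c mulrA mulrBr mulrDr !mulrA fa ff.
- by exists w, 0; split; [exists w, 0; rewrite mulr0|left].
Qed.

End Shift.

(** If a kills a nonzero g in f T, then (0, g T) is a solution, a acting there as the identity minus
    a unit; if f - a kills such a g, swap the coordinates. If a is invertible in the corner, (f T,
    0) will do. An a with only a left inverse acts like a shift. *)
Lemma corner_clean_graph f a : f * f = f -> f * a * f = a -> f != 0 -> exists G,
  [/\ clean_graph a (f - a) G,
      forall x z, G (x, z) -> f * x = x /\ f * z = z
    & exists x z, G (x, z) /\ (x != 0 \/ z != 0)].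
Proof.
move=> ff faf f0.
have fa : f * a = a by rewrite -faf !mulrA ff.
have af : a * f = a by rewrite -faf -!mulrA ff.
have triv b g (h := f - b) : f * b = b -> f * g = g -> g != 0 -> b * g = 0 ->
    exists G, [/\ clean_graph b h G,
      forall x z, G (x, z) -> f * x = x /\ f * z = z
    & exists x z, G (x, z) /\ (x != 0 \/ z != 0)].
  move=> fb fg g0 bg; have hg r : h * (g * r) = g * r.
    by rewrite mulrA mulrBl bg fg subr0.
  exists (fun p => exists r, p = (0, g * r)); split; last 2 first.
  - by move=> x z [r [-> ->]]; rewrite mulr0 mulrA fg.
  - by exists 0, g; split; [exists 1; rewrite mulr1|right].
  split; first split.
  - by exists 0; rewrite mulr0.
  - by move=> x z x' z' [r [-> ->]] [r' [-> ->]]; exists (r - r'); rewrite mulrBr subr0.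
  - by move=> x z r' [r [-> ->]]; exists (r * r'); rewrite mul0r mulrA.
  - by move=> x z [r [-> _]]; exists 0; rewrite mulr0.
  - by move=> x z [r [-> ->]]; rewrite add0r.
  - by move=> x z [r [-> ->]]; rewrite mulr0 add0r hg.
  - by split=> x z [r [-> ->]]; exists 0, (g * r);
      rewrite mulr0 !add0r ?hg; split=> //; exists r.
have swap b (G : set (T * T)) : clean_graph (f - b) b G ->
    clean_graph b (f - b) (fun p => G (p.2, p.1)).
  move=> [rG Gp G1 G2 [G3 G4]]; have [G0 GB GM] := rG.
  split; first split=> //=.
  - by move=> x z x' z' Gx Gx'; apply: GB.
  - by move=> x z r; apply: GM.
  - move=> x z /= Gzx; have := GB _ _ _ _ Gzx (Gp _ _ Gzx).
    by rewrite subrr subr0.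
  - by move=> x z /= /G1 h; rewrite addrC => /h[].
  - by move=> x z /= /G2 h; rewrite addrC => /h[].
  - split=> x z /=; first move/G3; last move/G4.
      by move=> [x' [z' [Gx' e]]]; exists z', x'; rewrite addrC e addrC.
    by move=> [x' [z' [Gx' e]]]; exists z', x'; rewrite addrC e addrC.
have [a1 aa1a] := Treg a.
have [ia|ni] := eqVneq (f - f * a1 * a) 0; last first.
  apply: triv ni _; rewrite ?mulrBr ?mulrA ?ff ?fa //.
  by rewrite af -!mulrA [a * (a1 * a)]mulrA aa1a subrr.
have [b1 bb1b] := Treg (f - a).
have fb : f * (f - a) = f - a by rewrite mulrBr ff fa.
have bf : (f - a) * f = f - a by rewrite mulrBl ff af.
have [ib|nj] := eqVneq (f - f * b1 * (f - a)) 0; last first.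
  have [||||G [cG Gf [x [z [Gxz xz0]]]]] := triv (f - a) (f - f * b1 * (f - a)).
  - exact: fb.
  - by rewrite mulrBr !mulrA ff.
  - exact: nj.
  - by rewrite mulrBr bf !mulrA bf bb1b subrr.
  have ffa : f - (f - a) = a by nc.
  rewrite ffa in cG.
  exists (fun p => G (p.2, p.1)); split; first exact: swap.
    by move=> x' z' /= /Gf[].
  by exists z, x; split=> //; case: xz0; [right|left].
have [w0|w0] := eqVneq (f - a * (f * a1 * f)) 0; last first.
  apply: shift_clean_graph w0 => //.
  - by rewrite -!mulrA ff.
  - by rewrite -mulrA fa; apply/esym/eqP; rewrite -subr_eq0 ia.
have aY : a * (f * a1 * f) = f by apply/esym/eqP; rewrite -subr_eq0 w0.
have Ya : f * a1 * a = f by apply/esym/eqP; rewrite -subr_eq0 ia.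
exists (fun p => exists r, p = (f * r, 0)); split; last 2 first.
- by move=> x z [r [-> ->]]; rewrite mulr0 mulrA ff.
- by exists f, 0; split; [exists 1; rewrite mulr1|left].
have inj r : a * (f * r) = 0 -> f * r = 0.
  move=> h; have ar : a * r = 0 by rewrite -{1}af -mulrA h.
  by rewrite -Ya -mulrA ar mulr0.
split; first split.
- by exists 0; rewrite mulr0.
- by move=> x z x' z' [r [-> ->]] [r' [-> ->]]; exists (r - r'); rewrite mulrBr subr0.
- by move=> x z r' [r [-> ->]]; exists (r * r'); rewrite mul0r mulrA.
- by move=> x z [r [-> _]]; exists r.
- by move=> x z [r [-> ->]]; rewrite addr0.
- by move=> x z [r [-> ->]]; rewrite mulr0 addr0 => /inj.
- split=> x z [r [-> ->]].
    exists (f * (a * r)), 0; split; first by exists (a * r).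
    by rewrite mulr0 !mulrA af fa.
  exists (f * (a1 * f * r)), 0; split; first by exists (a1 * f * r).
  by rewrite mulr0 !addr0 -{1}aY !mulrA.
Qed.

(** For a maximal partial decomposition with hull e, the maps o and u = a e - o extend its
    idempotent and its unit to e T. If e were not 1, a partial decomposition of f a f in the corner
    of f = 1 - e could be glued on. *)
Theorem self_injective_clean : clean_ring T.
Proof.
move=> a; pose b : T := 1 - a.
have [||G [cG _ Gmax]] := @zorn_set (T * T) (clean_graph a b) (fun p => p = (0, 0)).
- split; first split=> [//|x y x' y' [-> ->] [-> ->]|x y r [-> ->]].
  + by rewrite subr0.
  + by rewrite mul0r.
  + by move=> x y [-> _].
  + by move=> x y [-> ->].
  + by move=> x y [-> ->].
  + by split=> x y [-> ->]; exists 0, 0; rewrite !mulr0.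
- move=> F F0 FP tot; split.
  + by apply: rgraph_chain => // A /FP[].
  + by move=> x y [A FA Ax]; exists A => //; have [_ h _ _ _] := FP _ FA; apply: h Ax.
  + by move=> x y [A FA Ax]; have [_ _ h _ _] := FP _ FA; apply: h Ax.
  + by move=> x y [A FA Ax]; have [_ _ _ h _] := FP _ FA; apply: h Ax.
  + split=> x y [A FA Ax]; have [_ _ _ _ [h1 h2]] := FP _ FA.
      by have [x' [y' [Ax' ->]]] := h1 _ _ Ax; exists x', y'; split=> //; exists A.
    by have [x' [y' [Ax' ->]]] := h2 _ _ Ax; exists x', y'; split=> //; exists A.
have [rG Gp Gnu Gmu [Gmunu Gnumu]] := cG; have [G0 GB GM] := rG.
have Gq x y : G (x, y) -> G (0, y).
  by move=> Gxy; have := GB _ _ _ _ Gxy (Gp _ _ Gxy); rewrite subrr subr0.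
have Gn x y : G (x, y) -> G (x, - y).
  by move=> Gxy; have := GB _ _ _ _ (Gp _ _ Gxy) (Gq _ _ Gxy); rewrite subr0 sub0r.
pose N : set T := fun k => exists x y, G (x, y) /\ k = x + y.
have rN : rideal N.
  split; first by exists 0, 0; rewrite addr0.
    move=> _ _ [x [y [Gx ->]]] [x' [y' [Gx' ->]]].
    by exists (x - x'), (y - y'); split; [exact: GB|nc].
  move=> _ r [x [y [Gx ->]]].
  by exists (x * r), (y * r); split; [exact: GM|nc].
have [N0 NB NM] := rN.
have ND x y : N x -> N y -> N (x + y).
  by move=> Nx Ny; have := NB _ _ Nx (NB _ _ N0 Ny); rewrite sub0r opprK.
have N1 x y : G (x, y) -> N x by move=> /Gp Gx; exists x, 0; rewrite addr0.
have N2 x y : G (x, y) -> N y by move=> /Gq Gx; exists 0, y; rewrite add0r.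
have NP x y : G (x, y) -> N (x + y) by move=> Gx; exists x, y.
have [e [ee eN eess]] := hull rN.
have [||o0 o0P] := Tinj (G := fun p => exists x y, G (x, y) /\ p = (x + y, y)).
- split.
  + by exists 0, 0; rewrite addr0.
  + move=> k1 v1 k2 v2 [x [y [Gx [-> ->]]]] [x' [y' [Gx' [-> ->]]]].
    by exists (x - x'), (y - y'); split; [exact: GB|congr pair; nc].
  + move=> k1 v1 r [x [y [Gx [-> ->]]]].
    by exists (x * r), (y * r); split; [exact: GM|congr pair; nc].
- by move=> y0 [x [y [Gx [xy ->]]]]; have [] := Gnu _ _ Gx (esym xy).
have [||v0 v0P] := Tinj (G := fun p => exists x y,
    G (x, y) /\ p = (a * x + b * y, x - y)).
- split.
  + by exists 0, 0; rewrite !mulr0 subr0 addr0.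
  + move=> k1 v1 k2 v2 [x [y [Gx [-> ->]]]] [x' [y' [Gx' [-> ->]]]].
    by exists (x - x'), (y - y'); split; [exact: GB|congr pair; nc].
  + move=> k1 v1 r [x [y [Gx [-> ->]]]].
    by exists (x * r), (y * r); split; [exact: GM|congr pair; nc].
- move=> y0 [x [y [Gx [xy ->]]]]; have [-> ->] := Gmu _ _ Gx (esym xy).
  by rewrite subr0.
have [o [oP eo oe]] : exists o, [/\ forall x y, G (x, y) -> o * (x + y) = y,
    e * o = o & o * e = o].
  exists (e * o0 * e); split=> [x y Gx||]; last by rewrite -mulrA ee.
    rewrite -mulrA (eN _ (NP _ _ Gx)).
    rewrite -mulrA (o0P (x + y) y) ?(eN _ (N2 _ _ Gx)) //.
    by exists x, y.
  by rewrite !mulrA ee.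
have [v [vP ev ve]] : exists v, [/\ forall x y, G (x, y) -> v * (a * x + b * y) = x - y,
    e * v = v & v * e = v].
  exists (e * v0 * e); split=> [x y Gx||]; last by rewrite -mulrA ee.
    rewrite -mulrA (eN _ (Gmunu _ _ Gx)) -mulrA (v0P _ (x - y)).
      exact: eN (NP _ _ (Gn _ _ Gx)).
    by exists x, y.
  by rewrite !mulrA ee.
have aN k : N k -> N (a * k).
  move=> [x [y [Gx ->]]].
  have -> : a * (x + y) = (a * x + b * 0) + y - (a * 0 + b * y) by rewrite /b; nc.
  apply: NB; last exact: Gmunu (Gq _ _ Gx).
  by apply: ND (N2 _ _ Gx); exact: Gmunu (Gp _ _ Gx).
(* Stability of N under a passes to e T by the annihilator clause of the hull. *)
have eae : e * a * e = a * e.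
  have : (1 - e) * a * e = 0.
    apply: eess => k Nk; rewrite -mulrA mulrBl mul1r eN ?subrr //; exact: aN.
  by rewrite mulrBl mul1r mulrBl => /subr0_eq.
have oo : o * o = o.
  have : (o * o - o) * e = 0.
    apply: eess => _ [x [y [Gx ->]]]; rewrite mulrBl -mulrA !(oP _ _ Gx).
    by have := oP _ _ (Gq _ _ Gx); rewrite add0r => ->; rewrite subrr.
  by rewrite mulrBl -mulrA oe => /subr0_eq.
pose u := a * e - o.
have eu : e * u = u by rewrite /u mulrBr mulrA eae eo.
have ue : u * e = u by rewrite /u mulrBl -mulrA ee oe.
have uP x y : G (x, y) -> u * (x - y) = a * x + b * y.
  move=> Gx; rewrite /u mulrBl -mulrA eN.
    by rewrite (oP _ _ (Gn _ _ Gx)) /b; nc.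
  exact: NP (Gn _ _ Gx).
have uv : u * v = e.
  have : (u * v - 1) * e = 0.
    apply: eess => _ [x [y [/Gnumu [x' [y' [Gx' ->]]] ->]]].
    by rewrite mulrBl -mulrA vP // uP // mul1r subrr.
  by rewrite mulrBl -mulrA ve mul1r => /subr0_eq.
have vu : v * u = e.
  have : (v * u - 1) * e = 0.
    apply: eess => _ [x [y [/Gn Gx ->]]].
    have uxy := uP _ _ Gx; rewrite opprK in uxy.
    by rewrite mulrBl -mulrA uxy vP // opprK mul1r subrr.
  by rewrite mulrBl -mulrA ue mul1r => /subr0_eq.
have [e1|f0] := eqVneq (1 - e) 0.
  move/subr0_eq in e1; exists o, u; split=> //; last by rewrite /u -e1; nc.
  by exists v; rewrite uv vu.
pose f : T := 1 - e; have fe : f * e = 0 by rewrite mulrBl ee mul1r subrr.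
have ff : f * f = f by rewrite {2}/f mulrBr fe; nc.
have [|G' [[[G'0 G'B G'M] G'p G'nu G'mu [G'munu G'numu]] fG' [x0 [y0 [G'x0 x0y0]]]]] :=
  corner_clean_graph (a := f * a * f) ff _ f0; first by rewrite !mulrA ff -!mulrA ff.
pose mu (x y : T) : T := a * x + b * y.
pose mu' (x y : T) : T := f * a * f * x + (f - f * a * f) * y.
(* Compression to the corner of f loses only a component in e T. The glued map is thus triangular,
   and u, invertible on e T, absorbs that component. *)
have muE p q : G' (p, q) -> mu p q = mu' p q + e * mu p q.
  move=> /fG'[fp fq]; have -> : mu' p q = f * a * (f * p) + (f * q) - f * a * (f * q).
    by rewrite /mu'; nc.
  have eE : e = 1 - f by rewrite /f; nc.
  have -> : f * a * (f * p) + f * q - f * a * (f * q) + e * mu p q =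
      mu p q + f * a * (f * p - p) - f * a * (f * q - q).
    by rewrite eE /mu /b; nc.
  by rewrite fp fq !subrr !mulr0 subr0 addr0.
have er r : (e - o) * r = r -> e * r = r.
  by move=> <-; rewrite mulrA mulrBr ee eo.
have or r : (e - o) * r = r -> o * r = 0.
  by move=> <-; rewrite mulrA mulrBr oe oo subrr mul0r.
have es s : o * s = s -> e * s = s by move=> <-; rewrite mulrA eo.
have fe0 k : e * k = k -> f * k = 0 by move=> <-; rewrite mulrA fe mul0r.
have uz r s : (e - o) * r = r -> o * s = s -> mu r s = u * (r - s).
  move=> hr hs; rewrite /u mulrBl -mulrA !mulrBr er // es // or // hs.
  by rewrite /mu /b; nc.
pose G2 : set (T * T) := fun z => exists r s p q,
  [/\ (e - o) * r = r, o * s = s, G' (p, q) & z = (r + p, s + q)].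
have mu2 r s p q : mu (r + p) (s + q) = mu r s + mu p q by rewrite /mu; nc.
have cG2 : clean_graph a b G2.
  split.
  - split.
    + by exists 0, 0, 0, 0; rewrite !mulr0 addr0.
    + move=> k1 v1 k2 v2 [r [s [p [q [hr hs Gp' [-> ->]]]]]].
      move=> [r' [s' [p' [q' [hr' hs' Gp'' [-> ->]]]]]].
      exists (r - r'), (s - s'), (p - p'), (q - q'); split.
      * by rewrite mulrBr hr hr'.
      * by rewrite mulrBr hs hs'.
      * exact: G'B.
      * by congr pair; nc.
    + move=> k1 v1 r' [r [s [p [q [hr hs Gp' [-> ->]]]]]].
      exists (r * r'), (s * r'), (p * r'), (q * r'); split.
      * by rewrite mulrA hr.
      * by rewrite mulrA hs.
      * exact: G'M.
      * by congr pair; nc.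
  - move=> x y [r [s [p [q [hr hs /G'p Gp' [-> _]]]]]].
    by exists r, 0, p, 0; rewrite mulr0 addr0.
  - move=> x y [r [s [p [q [hr hs Gp' [-> ->]]]]]] sum0.
    have [fp fq] := fG' _ _ Gp'.
    have pq0 : p + q = 0.
      have := congr1 ( *%R f) sum0; rewrite !mulrDr fp fq (fe0 _ (er _ hr)).
      by rewrite (fe0 _ (es _ hs)) !add0r mulr0.
    have [p0 q0] := G'nu _ _ Gp' pq0; rewrite p0 q0 !addr0 in sum0 *.
    have s0 : s = 0.
      by have := congr1 ( *%R o) sum0; rewrite mulrDr (or _ hr) hs add0r mulr0.
    by rewrite s0 addr0 in sum0 *.
  - move=> x y [r [s [p [q [hr hs Gp' [-> ->]]]]]].
    rewrite -/(mu _ _) mu2 (muE _ _ Gp') (uz _ _ hr hs) => sum0.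
    have [fp fq] := fG' _ _ Gp'.
    have fu k : f * (u * k) = 0 by apply: fe0; rewrite mulrA eu.
    have fmu' : f * mu' p q = mu' p q.
      by rewrite /mu' mulrDr !mulrA mulrBr !mulrA ff.
    have pq0 : mu' p q = 0.
      have := congr1 ( *%R f) sum0.
      rewrite mulrDr [f * (mu' _ _ + _)]mulrDr fu fmu'.
      by rewrite (mulrA f e) fe mul0r addr0 add0r mulr0.
    have [p0 q0] := G'mu _ _ Gp' pq0.
    have m0 : mu p q = 0 by rewrite p0 q0 /mu; nc.
    rewrite pq0 m0 mulr0 !addr0 in sum0; rewrite p0 q0 !addr0.
    have z0 : r - s = 0.
      have : e * (r - s) = 0 by rewrite -vu -mulrA sum0 mulr0.
      by rewrite mulrBr (er _ hr) (es _ hs).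
    have s0 : s = 0.
      have := congr1 ( *%R o) z0; rewrite mulrBr (or _ hr) hs sub0r mulr0 => /eqP.
      by rewrite oppr_eq0 => /eqP.
    by rewrite s0 subr0 in z0 *.
  - have split_e k : e * k = k -> (e - o) * ((e - o) * k) = (e - o) * k.
      move=> ek; rewrite mulrA; congr (_ * k).
      have -> : (e - o) * (e - o) = e * e - e * o - o * e + o * o by nc.
      by rewrite ee eo oe oo; nc.
    split=> x y [r [s [p [q [hr hs Gp' [-> ->]]]]]].
    + rewrite -/(mu _ _) mu2 (muE _ _ Gp') (uz _ _ hr hs).
      have [p' [q' [Gp'' mupq]]] := G'munu _ _ Gp'.
      pose k := u * (r - s) + e * mu p q.
      have ek : e * k = k by rewrite /k mulrDr !mulrA eu ee.
      exists ((e - o) * k + p'), (o * k + q'); split.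
        exists ((e - o) * k), (o * k), p', q'; split=> //; first exact: split_e.
        by rewrite mulrA oo.
      have -> : (e - o) * k + p' + (o * k + q') = e * k + (p' + q') by nc.
      by rewrite ek -mupq /k /mu'; nc.
    + have [p' [q' [Gp'' pqE]]] := G'numu _ _ Gp'.
      pose k := r + s - e * mu p' q'.
      have ek : e * k = k.
        by rewrite /k mulrBr mulrDr (er _ hr) (es _ hs) mulrA ee.
      have ez : e * (v * k) = v * k by rewrite mulrA ev.
      have hr' := split_e _ ez.
      have hs' : o * - (o * (v * k)) = - (o * (v * k)) by rewrite mulrN mulrA oo.
      exists ((e - o) * (v * k) + p'), (- (o * (v * k)) + q'); split.
        by exists ((e - o) * (v * k)), (- (o * (v * k))), p', q'; split.
      rewrite -/(mu _ _) mu2 (uz _ _ hr' hs') (muE _ _ Gp'').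
      have -> : (e - o) * (v * k) - - (o * (v * k)) = e * (v * k) by nc.
      rewrite ez mulrA uv ek /mu' -pqE /k; nc.
have GG2 : (G `<=` G2)%classic.
  move=> [x y] Gx; exists x, y, 0, 0; split=> //; last by rewrite !addr0.
    have := oP _ _ (Gp _ _ Gx); rewrite addr0 => ox.
    by rewrite mulrBl ox subr0 eN //; exact: N1 Gx.
  by have := oP _ _ (Gq _ _ Gx); rewrite add0r.
have /(Gmax _ cG2 GG2) G12 : G2 (x0, y0).
  by exists 0, 0, x0, y0; rewrite !mulr0 !add0r.
have [fx fy] := fG' _ _ G'x0; case: x0y0 => /eqP[].
  by rewrite -fx fe0 //; exact: eN (N1 _ _ G12).
by rewrite -fy fe0 //; exact: eN (N2 _ _ G12).
Qed.

End SelfInjective.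

(** * Transfer along the envelope or the cover *)

Section Jacobson.
Variable S : pzRingType.
Implicit Types x y u v : S.

(** Otherwise (1 - x) S lies in a maximal right ideal by Zorn's lemma; this ideal contains x, hence
    1. *)
Lemma jacobson_right_inverse x : x \in @jacobson S -> exists y, (1 - x) * y = 1.
Proof.
move=> /jacobsonP Jx; apply: contrapT => nx.
pose P (A : set S) := rideal A /\ ~ A 1.
have [||A [[rA A1] A0 Amax]] := @zorn_set S P (fun z => exists y, z = (1 - x) * y).
- split; last by move=> [y]; move/esym => h; apply: nx; exists y.
  split=> [|_ _ [y ->] [z ->]|_ r [y ->]]; first by exists 0; rewrite mulr0.
    by exists (y - z); rewrite mulrBr.
  by exists (y * r); rewrite mulrA.
- move=> F F0 FP tot; split; first by apply: rideal_chain => // A /FP[].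
  by move=> [A /FP[_ nA1] A1].
have [AA0 AB AM] := rA.
pose I : {pred S} := fun z => `[< A z >].
have IP z : reflect (A z) (z \in I) by exact: asboolP.
have mI : maximal_right_ideal I.
  split.
    split; last by exists 1; apply/IP.
    split; last by move=> z a /IP/AM h; apply/IP.
    by split=> [|y z /IP Ay /IP Az]; apply/IP => //; apply: AB.
  move=> K [[[K0 KB] KM] [z Kz]] IK z' Kz'; apply/IP.
  apply: (Amax (fun y => y \in K)) Kz'; last by move=> y /IP/IK.
  split; first by split=> // y r; apply: KM.
  by move=> K1; move: Kz; rewrite -[z]mul1r KM.
have /IP Ax := Jx _ mI.
have Ax' : A (1 - x) by apply: A0; exists 1; rewrite mulr1.
have := AB _ _ Ax' (AB _ _ AA0 Ax); rewrite sub0r opprK subrK; exact: A1.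
Qed.

Lemma jacobson_invertible x : x \in @jacobson S -> invertible (1 - x).
Proof.
move=> Jx; have [y xy] := jacobson_right_inverse Jx.
have [|z yz] := @jacobson_right_inverse (- (x * y)).
  by rewrite rpredN jacobsonMr.
have yE : 1 - - (x * y) = y by rewrite -xy; nc.
rewrite yE in yz; exists y; split=> //.
have <- : z = 1 - x by rewrite -[LHS]mul1r -{1}xy -mulrA yz mulr1.
exact: yz.
Qed.

(** If x is outside a maximal right ideal I, some 1 - x a lies in I. The left inverse z of 1 - a x
    equals 1 + z a x and so is itself left invertible; hence z is a two-sided inverse, and 1 + x z a
    is a right inverse of 1 - x a. *)
Lemma jacobson_char x :
  (forall y, exists z, z * (1 - y * x) = 1) -> x \in @jacobson S.
Proof.
move=> linv; apply/jacobsonP => I [[[[I0 IB] IM] [z0 Iz0]] Imax].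
apply: contraT => Ix.
pose K : {pred S} := fun z => `[< exists a, z - x * a \in I >].
have KP z : reflect (exists a, z - x * a \in I) (z \in K) by exact: asboolP.
have [K1|nK1] := boolP (1 \in K); last first.
  case/negP: (Ix); apply: (Imax K).
  - split; last by exists 1.
    split; last first.
      by move=> z r /KP[a Ia]; apply/KP; exists (a * r); rewrite mulrA -mulrBl IM.
    split=> [|z y /KP[a Ia] /KP[b Ib]]; apply/KP.
      by exists 0; rewrite mulr0 subrr.
    exists (a - b); have -> : z - y - x * (a - b) = (z - x * a) - (y - x * b) by nc.
    exact: IB.
  - by move=> z Iz; apply/KP; exists 0; rewrite mulr0 subr0.
  - by apply/KP; exists 1; rewrite mulr1 subrr.
move/KP: K1 => [a Ia].
have [z zE] := linv a; have [z' z'E] := linv (- (z * a)).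
have z1 : 1 - - (z * a) * x = z by rewrite -zE; nc.
rewrite z1 in z'E.
have Ez : 1 - a * x = z' by rewrite -[LHS]mul1r -{1}z'E -mulrA zE mulr1.
have az : (1 - a * x) * z = 1 by rewrite Ez.
have inv : (1 - x * a) * (1 + x * z * a) = 1.
  have -> : (1 - x * a) * (1 + x * z * a) = 1 + x * ((1 - a * x) * z - 1) * a by nc.
  by rewrite az subrr mulr0 mul0r addr0.
by move: Iz0; rewrite -[z0]mul1r -inv -[_ * _ * z0]mulrA IM.
Qed.

Lemma jacobson_idempotent x : x * x = x -> x \in @jacobson S -> x = 0.
Proof.
move=> xx /jacobson_invertible[y [xy _]].
by rewrite -[x]mulr1 -xy mulrA mulrBr mulr1 xx subrr mul0r.
Qed.

Local Notation "'π' x" := (\pi_(jacobson_quot S) x) (at level 8, x at level 2).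

Lemma jpi_eq0 x : (π x = 0) <-> (x \in @jacobson S).
Proof.
have -> : (0 : jacobson_quot S) = π 0.
  by apply: (addrI (π 0)); rewrite -pi_jquotD !addr0.
by rewrite -[x in x \in _]subr0 jacobson_eqmod; split=> [->|/eqP].
Qed.

Lemma jpiN x : π (- x) = - π x.
Proof.
by apply/eqP; rewrite -addr_eq0 -pi_jquotD addNr; apply/eqP/jpi_eq0/rpred0.
Qed.

Lemma jpiB x y : π (x - y) = π x - π y.
Proof. by rewrite pi_jquotD jpiN. Qed.

Lemma jpiM x y : π (x * y) = π x * π y.
Proof. exact: pi_jquotM. Qed.

Lemma jpi_eq x y : π x = π y <-> x - y \in @jacobson S.
Proof. by rewrite -jpi_eq0 jpiB; split=> [->|/subr0_eq //]; rewrite subrr. Qed.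

Lemma jpi_invertible x : invertible (π x) -> invertible x.
Proof.
move=> [v]; rewrite -[v]reprK; set w := repr v; rewrite -!jpiM.
move=> [/(jpi_eq (x * w) 1) h1 /(jpi_eq (w * x) 1) h2].
have inv y : y - 1 \in @jacobson S -> exists z, y * z = 1 /\ z * y = 1.
  move=> Jy; have [] := @jacobson_invertible (1 - y); last first.
    by rewrite (_ : 1 - (1 - y) = y) => [z zP|]; [exists z|nc].
  by rewrite -opprB rpredN.
have [a [xwa _]] := inv _ h1; have [b [_ bwx]] := inv _ h2.
have e : w * a = b * w.
  by rewrite -[LHS]mul1r -bwx -!mulrA [x * _]mulrA xwa mulr1.
by exists (w * a); split; [rewrite mulrA|rewrite e -mulrA].
Qed.
End Jacobson.

(** * Subrings of a regular ring that contain all units *)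

Section UnitClosedSubring.
Variables (T : pzRingType) (D : T -> Prop).
Hypothesis Treg : von_neumann_regular T.
Hypothesis DB : forall x y, D x -> D y -> D (x - y).
Hypothesis DM : forall x y, D x -> D y -> D (x * y).
Hypothesis DU : forall u, invertible u -> D u.

Let D1 : D 1. Proof. by apply: DU; exists 1; rewrite mulr1. Qed.

Let D0 : D 0. Proof. by rewrite -(subrr 1); apply: DB. Qed.

Let DD x y : D x -> D y -> D (x + y).
Proof. by move=> Dx Dy; rewrite -[y]opprK -(sub0r y); apply/DB/DB. Qed.

(** 1 + x is a unit with inverse 1 - x. *)
Lemma unit_closed_square_zero x : x * x = 0 -> D x.
Proof.
move=> xx; have -> : x = (1 + x) - 1 by nc.
apply: DB D1; apply: DU; exists (1 - x); split.
  have -> : (1 + x) * (1 - x) = 1 - x * x by nc.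
  by rewrite xx subr0.
have -> : (1 - x) * (1 + x) = 1 - x * x by nc.
by rewrite xx subr0.
Qed.

Variables e s t : T.
Hypotheses (ee : e * e = e) (ese : e * s * e = s) (ete : e * t * e = t).
Hypotheses (ss : s * s = 0) (tt : t * t = 0) (ste : s * t + t * s = e).
Hypothesis red : forall x, (1 - e) * x * (1 - e) = x -> x * x = 0 -> x = 0.
Let f := 1 - e.

Let fe : f * e = 0. Proof. by rewrite mulrBl ee mul1r subrr. Qed.
Let ef : e * f = 0. Proof. by rewrite mulrBr ee mulr1 subrr. Qed.
Let ff : f * f = f. Proof. by rewrite {2}/f mulrBr fe subr0 mulr1. Qed.

Let eE : e = 1 - f. Proof. by rewrite /f; nc. Qed.

Let De : D e.
Proof.
have Ds := unit_closed_square_zero ss; have Dt := unit_closed_square_zero tt.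
by rewrite -ste; apply: DD; apply: DM.
Qed.

Let Df : D f. Proof. exact: DB. Qed.

(** Writing e = s t + t s on both sides of x gives four terms, each square-zero or a square-zero
    element times s or t. *)
Lemma unit_closed_corner x : D (e * x * e).
Proof.
have Ds := unit_closed_square_zero ss; have Dt := unit_closed_square_zero tt.
have -> : e * x * e = (s * t * x * s) * t + s * t * x * t * s
    + t * s * x * s * t + (t * s * x * t) * s by rewrite -ste; nc.
have D1' : D (s * t * x * s).
  apply: unit_closed_square_zero.
  have -> : s * t * x * s * (s * t * x * s) = s * t * x * (s * s) * t * x * s by nc.
  by rewrite ss; nc.
have D2' : D (t * s * x * t).
  apply: unit_closed_square_zero.
  have -> : t * s * x * t * (t * s * x * t) = t * s * x * (t * t) * s * x * t by nc.
  by rewrite tt; nc.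
have D3' : D (s * t * x * t * s).
  apply: unit_closed_square_zero.
  have -> : s * t * x * t * s * (s * t * x * t * s)
    = s * t * x * t * (s * s) * t * x * t * s by nc.
  by rewrite ss; nc.
have D4' : D (t * s * x * s * t).
  apply: unit_closed_square_zero.
  have -> : t * s * x * s * t * (t * s * x * s * t)
    = t * s * x * s * (t * t) * s * x * s * t by nc.
  by rewrite tt; nc.
by apply: DD; [apply: DD; [apply: DD|]|] => //; apply: DM.
Qed.

Let De_f x : D (e * x * f).
Proof.
apply: unit_closed_square_zero.
have -> : e * x * f * (e * x * f) = e * x * (f * e) * x * f by nc.
by rewrite fe; nc.
Qed.

Let Df_e x : D (f * x * e).
Proof.
apply: unit_closed_square_zero.
have -> : f * x * e * (f * x * e) = f * x * (e * f) * x * e by nc.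
by rewrite ef; nc.
Qed.

(** g z (f - g) and (f - g) z g are square-zero in the reduced corner, so both vanish. *)
Let corner_idempotent_central g z : g * g = g -> f * g * f = g -> f * z * f = z ->
  g * z = z * g.
Proof.
move=> gg fgf fzf.
have fg : f * g = g by rewrite -fgf !mulrA ff.
have gf : g * f = g by rewrite -fgf -!mulrA ff.
have fz : f * z = z by rewrite -fzf !mulrA ff.
have zf : z * f = z by rewrite -fzf -!mulrA ff.
have h1 : g * z * (f - g) = 0.
  apply: red; rewrite -/f.
    have -> : f * (g * z * (f - g)) * f = f * g * z * (f * f - g * f) by nc.
    by rewrite fg ff gf.
  have -> : g * z * (f - g) * (g * z * (f - g)) = g * z * (f * g - g * g) * z * (f - g).
    by nc.
  by rewrite fg gg; nc.
have h2 : (f - g) * z * g = 0.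
  apply: red; rewrite -/f.
    have -> : f * ((f - g) * z * g) * f = (f * f - f * g) * z * (g * f) by nc.
    by rewrite fg ff gf.
  have -> : (f - g) * z * g * ((f - g) * z * g) = (f - g) * z * (g * f - g * g) * z * g.
    by nc.
  by rewrite gf gg; nc.
have : g * z * f - g * z * g = 0 by rewrite -h1; nc.
have : f * z * g - g * z * g = 0 by rewrite -h2; nc.
by rewrite -(mulrA g z f) zf fz => /subr0_eq -> /subr0_eq.
Qed.

(** Centrality of idempotents gives q y = y q = g. Then v inverts q on the g part and is the
    identity on f - g, so it is a unit of the corner with inverse q + (f - g). Adding e makes it a
    unit of T, and e lies in D. *)
Let reduced_corner_unit_regular q : f * q * f = q ->
  exists v, [/\ D v, f * v * f = v & q * v * q = q].
Proof.
move=> fqf; have [y0 qyq0] := Treg q.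
have fq : f * q = q by rewrite -fqf !mulrA ff.
have qf : q * f = q by rewrite -fqf -!mulrA ff.
have [y [fy yf qyq]] : exists y, [/\ f * y = y, y * f = y & q * y * q = q].
  exists (f * y0 * f); split; rewrite ?mulrA ?ff // -?mulrA ?ff //.
  by rewrite fq (mulrA q f) qf mulrA.
have c1 : q * y * q = q * (q * y).
  apply: corner_idempotent_central => //; first by rewrite mulrA qyq.
  by rewrite mulrA fq -mulrA yf.
have c2 : y * q * q = q * (y * q).
  apply: corner_idempotent_central => //; first by rewrite -mulrA (mulrA q) qyq.
  by rewrite mulrA fy -mulrA qf.
have qqy : q * (q * y) = q by rewrite -c1.
have yqq : y * q * q = q by rewrite c2 mulrA.
have eg : q * y = y * q.
  have e1 : q * y = y * q * (q * y) by rewrite -{1}yqq mulrA.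
  by rewrite e1 -mulrA qqy.
pose g := q * y; pose v := y * q * y + (f - g).
have fg : f * g = g by rewrite /g mulrA fq.
have gf : g * f = g by rewrite /g -mulrA yf.
have gg : g * g = g by rewrite /g mulrA qyq.
have gq : g * q = q by rewrite /g qyq.
have qg : q * g = q by rewrite /g qqy.
have yg : y * g = g * y by rewrite /g mulrA -eg.
have fv : f * v = v.
  have -> : f * v = (f * y) * q * y + (f * f - f * g) by rewrite /v; nc.
  by rewrite fy ff fg.
have vf : v * f = v.
  have -> : v * f = y * q * (y * f) + (f * f - g * f) by rewrite /v; nc.
  by rewrite yf ff gf.
have qyE : q * y = g by [].
have yqE : y * q = g by rewrite -eg.
have vE : v = y * g + (f - g) by rewrite /v -mulrA.
clearbody g v.
have wv : (q + (f - g)) * v = f.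
  have -> : (q + (f - g)) * v = (q * y) * g + (q * f - q * g)
    + (f - g) * (y * g) + (f * f - f * g - g * f + g * g).
    by rewrite vE; nc.
  rewrite qyE gg qf qg ff fg gf yg mulrBl !mulrA fg gg; nc.
have vw : v * (q + (f - g)) = f.
  have -> : v * (q + (f - g)) = y * (g * q) + y * (g * f - g * g) + (f * q - g * q)
      + (f * f - f * g - g * f + g * g) by rewrite vE; nc.
  rewrite gq gf gg fq yqE ff fg; nc.
have wf : (q + (f - g)) * f = q + (f - g).
  have -> : (q + (f - g)) * f = q * f + (f * f - g * f) by nc.
  by rewrite qf ff gf.
have fw : f * (q + (f - g)) = q + (f - g).
  have -> : f * (q + (f - g)) = f * q + (f * f - f * g) by nc.
  by rewrite fq ff fg.
exists v; split; last 2 first.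
- by rewrite fv vf.
- have -> : q * v * q = (q * y) * (g * q) + (q * f - q * g) * q by rewrite vE; nc.
  by rewrite qyE gq qf qg subrr mul0r addr0.
have -> : v = (v + e) - e by nc.
apply: DB De; apply: DU; exists (q + (f - g) + e).
have ev : e * v = 0 by rewrite -fv mulrA ef mul0r.
have ve : v * e = 0 by rewrite -vf -mulrA fe mulr0.
have ew : e * (q + (f - g)) = 0 by rewrite -fw mulrA ef mul0r.
have we : (q + (f - g)) * e = 0 by rewrite -wf -mulrA fe mulr0.
have prod a b : (a + e) * (b + e) = a * b + a * e + e * b + e * e by nc.
by rewrite !prod vw wv ev ve ew we ee /f; split; nc.
Qed.

(** McCoy's lemma, applied twice: a quasi-inverse of b - b y b yields one of b. First v removes the
    compression of a to the corner of f; then z - f z f, which lies in D, leaves an element of the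
    corner of e, and that corner lies entirely in D. *)
Lemma unit_closed_regular a : D a -> exists2 x, D x & a * x * a = a.
Proof.
move=> Da.
have mccoy (b y : T) : D b -> D y ->
    (exists2 z, D z & (b - b * y * b) * z * (b - b * y * b) = b - b * y * b) ->
    exists2 x, D x & b * x * b = b.
  move=> Db Dy [z Dz zE].
  exists (y + (1 - y * b) * z * (1 - b * y)).
    apply: DD => //; apply: DM; last by apply/DB/DM.
    by apply: DM => //; apply/DB/DM.
  have -> : b * (y + (1 - y * b) * z * (1 - b * y)) * b
    = b * y * b + (b - b * y * b) * z * (b - b * y * b) by nc.
  by rewrite zE; nc.
have [|v [Dv fvf qvq]] := @reduced_corner_unit_regular (f * a * f).
  by rewrite !mulrA ff -!mulrA ff.
have fv : f * v = v by rewrite -fvf !mulrA ff.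
have vf : v * f = v by rewrite -fvf -!mulrA ff.
apply: (mccoy _ v) => //.
set b := a - a * v * a.
have Db : D b by apply: DB => //; apply: DM => //; apply: DM.
have fbf : f * b * f = 0.
  have -> : f * b * f = f * a * f - f * a * v * a * f by rewrite /b; nc.
  have -> : f * a * v * a * f = f * a * f * v * (f * a * f).
    by rewrite -{1}fv -{1}vf; nc.
  by rewrite qvq subrr.
have [z zE] := Treg b.
have Dz : D (z - f * z * f).
  have -> : z - f * z * f = e * z * e + e * z * f + f * z * e by rewrite /f; nc.
  by apply: DD => //; apply: DD => //; exact: unit_closed_corner.
apply: (mccoy _ _ Db Dz).
have fb : f * b * e = f * b.
  have -> : f * b * e = f * b - f * b * f by rewrite eE; nc.
  by rewrite fbf subr0.
have bf : e * b * f = b * f.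
  have -> : e * b * f = b * f - f * b * f by rewrite eE; nc.
  by rewrite fbf subr0.
set c := b - _ * b.
have cE : c = (b * f) * z * (f * b).
  have -> : c = b - b * z * b + b * f * z * f * b by rewrite /c; nc.
  by rewrite zE; nc.
have ec : e * c = c by rewrite cE !mulrA bf.
have ce : c * e = c by rewrite cE -(mulrA _ (f * b) e) fb.
have [y yE] := Treg c; exists (e * y * e); first exact: unit_closed_corner.
by rewrite !mulrA ce -mulrA ec.
Qed.
End UnitClosedSubring.

(** * Exchange in clean rings, and transfer along a partial ring homomorphism *)

(** Nicholson's argument: for a = w + u, the idempotent e = u^-1 (1 - w) u satisfies e - a = u^-1 (a
    - a^2). *)
Lemma clean_exchange (E : pzRingType) : clean_ring E ->
  forall a : E, exists e r r', [/\ e * e = e, e = r * a & 1 - e = r' * (1 - a)].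
Proof.
move=> Ecl a; have [w [u [ww [v [uv vu]] aE]]] := Ecl a.
have ww' : w * w = w by [].
exists (v * (1 - w) * u).
have e1 : v * (1 - w) * u - a = v * (a - a * a).
  have -> : v * (1 - w) * u - a = v * ((1 - w) * u - u * a) + (v * u - 1) * a by nc.
  have -> : (1 - w) * u - u * a = (a - a * a) + (w * w - w) by rewrite aE; nc.
  by rewrite vu ww' !subrr mul0r !addr0.
exists (1 + v * (1 - a)), (1 - v * a); split.
- have -> : v * (1 - w) * u * (v * (1 - w) * u)
    = v * (1 - w) * (u * v) * (1 - w) * u by nc.
  have -> : v * (1 - w) * (u * v) * (1 - w) * u
    = v * ((1 - w) * (u * v) * (1 - w)) * u by nc.
  rewrite uv; have -> : (1 - w) * 1 * (1 - w) = 1 - w - w + w * w by nc.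
  by rewrite ww'; nc.
- by rewrite -[LHS](subrK a) e1; nc.
- have -> : 1 - v * (1 - w) * u = 1 - a - (v * (1 - w) * u - a) by nc.
  by rewrite e1; nc.
Qed.

Section Transfer.
(** Q g f reads: the endomorphism g of X induces f on M. *)
Variables (S E : pzRingType) (Q : S -> E -> Prop).
Hypothesis Q1 : Q 1 1.
Hypothesis QB : forall g g' f f', Q g f -> Q g' f' -> Q (g - g') (f - f').
Hypothesis QM : forall g g' f f', Q g f -> Q g' f' -> Q (g * g') (f * f').
Hypothesis Qsurj : forall f, exists g, Q g f.
Hypothesis Qunit : forall u, invertible u -> exists f, Q u f.
Hypothesis Qker : forall g, Q g 0 -> g \in @jacobson S.
Hypothesis Qfun : forall f, Q 0 f -> f = 0.
Hypothesis Treg : von_neumann_regular (jacobson_quot S).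
Hypothesis Tinj : right_self_injective (jacobson_quot S).
Hypothesis Slift : idempotents_lift_mod_jacobson S.
Local Notation "'π' x" := (\pi_(jacobson_quot S) x) (at level 8, x at level 2).

Let Q_inj g f f' : Q g f -> Q g f' -> f = f'.
Proof. by move=> Qf /(QB Qf); rewrite subrr => /Qfun/subr0_eq. Qed.

Let Q0 : Q 0 0.
Proof. by have := QB Q1 Q1; rewrite !subrr. Qed.

Let QJ j : j \in @jacobson S -> exists f, Q j f.
Proof.
move=> /jacobson_invertible/Qunit[f Qf]; exists (1 - f).
by have := QB Q1 Qf; rewrite opprB addrC subrK.
Qed.

(** Since the radical lies in the domain of Q, membership does not depend on the representative; see
    [D_dom]. *)
Let D (t : jacobson_quot S) := exists g f, Q g f /\ t = π g.

Let D_dom g : D (π g) -> exists f, Q g f.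
Proof.
move=> [g' [f' [Qg' /jpi_eq/QJ[f Qf]]]]; exists (f - (0 - f')).
by have := QB Qf (QB Q0 Qg'); rewrite sub0r opprK subrK.
Qed.

Let DB x y : D x -> D y -> D (x - y).
Proof.
move=> [g [f [Qg ->]]] [g' [f' [Qg' ->]]].
by exists (g - g'), (f - f'); split; [exact: QB|rewrite jpiB].
Qed.

Let DM x y : D x -> D y -> D (x * y).
Proof.
move=> [g [f [Qg ->]]] [g' [f' [Qg' ->]]].
by exists (g * g'), (f * f'); split; [exact: QM|rewrite jpiM].
Qed.

Let DU u : invertible u -> D u.
Proof.
rewrite -[u]reprK => /jpi_invertible/Qunit[f Qf].
by exists (repr u), f.
Qed.

Lemma transfer_jacobson j f : j \in @jacobson S -> Q j f -> f \in @jacobson E.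
Proof.
move=> Jj Qj; apply: jacobson_char => y; have [g Qg] := Qsurj y.
have [v [gv vg]] := jacobson_invertible (jacobsonMl g Jj).
have [|v' Qv] := Qunit (u := v); first by exists (1 - g * j).
exists v'; have := QM Qv (QB Q1 (QM Qg Qj)); rewrite vg => h.
exact: Q_inj h Q1.
Qed.

Lemma transfer_clean : clean_ring E.
Proof.
move=> f; have [g Qg] := Qsurj f.
have [w [u [/Slift[e [ee <-]] uU aE]]] := self_injective_clean Treg Tinj (π g).
have uE : u = π (g - e) by rewrite jpiB aE addrC addKr.
have ue : invertible (g - e) by apply: jpi_invertible; rewrite -uE.
have [f' Qf'] := Qunit ue.
exists (f - f'), f'; rewrite subrK; split=> //.
  have Qe : Q e (f - f') by have := QB Qg Qf'; rewrite opprB addrC subrK.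
  by apply: Q_inj (QM Qe Qe) _; rewrite ee.
have [v [uv vu]] := ue; have [|v' Qv] := Qunit (u := v); first by exists (g - e).
exists v'; split; [have := QM Qf' Qv|have := QM Qv Qf']; rewrite ?uv ?vu => h.
  exact: Q_inj h Q1.
exact: Q_inj h Q1.
Qed.

Let quasi_inverse g f : Q g f ->
  exists x x', Q x x' /\ g - g * x * g \in @jacobson S.
Proof.
have [e [s [t [[ee ese ete] [ss tt ste red]]]]] :=
  matrix_units_decomposition Treg Tinj.
move=> Qg.
have [|y Dy] := unit_closed_regular Treg DB DM DU ee ss tt ste red (a := π g).
  by exists g, f.
rewrite -[y]reprK -!jpiM => /jpi_eq Jg; move: Dy; rewrite -{1}[y]reprK.
move=> /D_dom[x' Qx]; exists (repr y), x'; split=> //.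
by rewrite -rpredN opprB.
Qed.

(** Let h induce (1 - x' f)^-1. Then (g - g x g) h lies in the radical and induces f, as g does; the
    difference induces 0 and so lies in the radical too. *)
Lemma transfer_jacobson_lift g f : f \in @jacobson E -> Q g f -> g \in @jacobson S.
Proof.
move=> Jf Qg; have [x [x' [Qx Jg]]] := quasi_inverse Qg.
have [w [w1 w2]] := jacobson_invertible (jacobsonMl x' Jf).
have [h Qh] := Qsurj w.
have := QM (QB Qg (QM (QM Qg Qx) Qg)) Qh.
have -> : (f - f * x' * f) * w = f.
  have -> : (f - f * x' * f) * w = f * ((1 - x' * f) * w) by nc.
  by rewrite w1 mulr1.
move=> Qj; have := QB Qg Qj; rewrite subrr => /Qker Jd.
rewrite -(subrK ((g - g * x * g) * h) g); apply: rpredD => //.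
exact: jacobsonMr.
Qed.

Theorem transfer_regular : von_neumann_regular (jacobson_quot E).
Proof.
move=> a; rewrite -[a]reprK; set f := repr a.
have [g Qg] := Qsurj f; have [x [x' [Qx Jg]]] := quasi_inverse Qg.
exists (\pi_(jacobson_quot E) x'); rewrite -!jpiM; apply/jpi_eq.
rewrite -rpredN opprB; apply: transfer_jacobson Jg _.
exact: QB (QM (QM Qg Qx) Qg).
Qed.

Theorem transfer_lift : idempotents_lift_mod_jacobson E.
Proof.
move=> a; rewrite -[a]reprK; set f := repr a.
have [g Qg] := Qsurj f; rewrite /idempotent_elt -jpiM => /jpi_eq Jf.
have Jg := transfer_jacobson_lift Jf (QB (QM Qg Qg) Qg).
have [|e [ee eg]] := Slift (a := π g).
  by rewrite /idempotent_elt -jpiM; apply/jpi_eq.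
have [|h Qh] := D_dom (g := e); first by rewrite eg; exists g, f.
exists h; split; last first.
  apply/jpi_eq; apply: transfer_jacobson (QB Qh Qg); exact/jpi_eq.
by apply: Q_inj (QM Qh Qh) _; rewrite ee.
Qed.

(** A square-zero x in the corner of 1 - h is induced by some y in the corner of 1 - e with y y in
    the radical. Modulo the radical, y is square-zero in a reduced corner, hence 0. *)
Theorem transfer_decomposition : exists e h, [/\ e * e = e, Q e h,
  h * h = h, forall x, exists f, Q (e * x * e) f
  & forall x, (1 - h) * x * (1 - h) = x -> x * x = 0 -> x \in @jacobson E].
Proof.
have [e0 [s [t [[ee ese ete] [ss tt ste red]]]]] :=
  matrix_units_decomposition Treg Tinj.
have [e [e2 eE]] := Slift ee; rewrite -eE in ee ese ete ste red.
have De := unit_closed_corner DB DM DU ss tt ste.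
have dom x : exists f, Q (e * x * e) f by apply: D_dom; rewrite !jpiM.
have [h] := dom e; rewrite !e2 => Qh; exists e, h; split=> //.
  by apply: Q_inj (QM Qh Qh) _; rewrite e2.
move=> x hxh xx; have [g Qg] := Qsurj x.
have Q1e := QB Q1 Qh.
have Qx := QM (QM Q1e Qg) Q1e; rewrite hxh in Qx.
set y := (1 - e) * g * (1 - e) in Qx.
have Jyy : y * y \in @jacobson S by apply: Qker; rewrite -xx; exact: QM.
suff Jy : y \in @jacobson S by exact: transfer_jacobson Jy Qx.
apply/jpi_eq0; apply: red; last by rewrite -jpiM; apply/jpi_eq0.
have -> : 1 - π e = π (1 - e) by rewrite jpiB.
rewrite -!jpiM; congr (π _).
have ff : (1 - e) * (1 - e) = 1 - e.
  have -> : (1 - e) * (1 - e) = 1 - e - e + e * e by nc.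
  by rewrite e2; nc.
by rewrite /y !mulrA ff -!mulrA ff.
Qed.

End Transfer.

(** Ring form of finite exchange. The idempotents are built one at a time: p is the sum of those
    already there, and the x i express 1 - p through the remaining f i. Exchange for x k f k (1 - p)
    yields the next one. *)
Lemma clean_orthogonal_exchange (E : pzRingType) (n : nat) (f : nat -> E) :
  clean_ring E -> \sum_(i < n) f i = 1 ->
  exists e r : nat -> E, [/\ forall i, (i < n)%N -> e i = r i * f i,
    forall i j, (i < n)%N -> (j < n)%N -> e i * e j = if i == j then e i else 0
    & \sum_(i < n) e i = 1].
Proof.
move=> Ecl fsum.
suff /(_ n (leqnn n)) : forall k, (k <= n)%N -> exists e r x : nat -> E,
    let p := \sum_(i < k) e i in
    [/\ forall i, (i < k)%N -> e i = r i * f i,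
      forall i j, (i < k)%N -> (j < k)%N -> e i * e j = if i == j then e i else 0,
      forall i, (1 - p) * x i = x i
      & 1 - p = (\sum_(k <= i < n) x i * f i) * (1 - p)].
  move=> [e [r [x [er ee _ p1]]]]; exists e, r; split=> //.
  by move: p1; rewrite big_geq // mul0r => /subr0_eq.
elim=> [_|k IH lt_kn].
  exists (fun _ => 0), (fun _ => 0), (fun _ => 1); rewrite /= big_ord0 subr0.
  split=> // [i|]; first by rewrite mulr1.
  rewrite mulr1 -[LHS]fsum big_mkord; apply: eq_bigr => i _.
  by rewrite mul1r.
have [e [r [x /= [er ee hx pE]]]] := IH (ltnW lt_kn).
set p := \sum_(i < k) e i in hx pE.
pose h := 1 - p; rewrite -/h in hx pE.
have ep i : (i < k)%N -> e i * p = e i.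
  move=> ik; rewrite mulr_sumr (bigD1 (Ordinal ik)) //= ee // eqxx big1 ?addr0 //.
  by move=> j ji; rewrite ee // -val_eqE /= in ji *; rewrite eq_sym (negPf ji).
have pe i : (i < k)%N -> p * e i = e i.
  move=> ik; rewrite mulr_suml (bigD1 (Ordinal ik)) //= ee // eqxx big1 ?addr0 //.
  by move=> j ji; rewrite ee // -val_eqE /= in ji *; rewrite (negPf ji).
have pp : p * p = p.
  by rewrite {1}/p mulr_suml; apply: eq_bigr => i _; exact: ep.
have ph : p * h = 0 by rewrite /h mulrBr pp mulr1 subrr.
have hp : h * p = 0 by rewrite /h mulrBl pp mul1r subrr.
have hh : h * h = h by rewrite {2}/h mulrBr hp subr0 mulr1.
pose a := x k * f k * h.
have [g [s [s' [gg gE g'E]]]] := clean_exchange Ecl a.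
have ha : h * a = a by rewrite /a !mulrA hx.
have ah : a * h = a by rewrite /a -!mulrA hh.
have gh : g * h = g by rewrite gE -mulrA ah.
have [q qdef] : exists q, q = h * g by exists (h * g).
have qq : q * q = q by rewrite qdef !mulrA -(mulrA h g h) gh -mulrA gg.
have hq : h * q = q by rewrite qdef mulrA hh.
have qh : q * h = q by rewrite qdef -mulrA gh.
have [y ydef] : exists y, y = q * h * s * x k by exists (q * h * s * x k).
have qy : q * y = y by rewrite ydef !mulrA qq.
have qE : q = y * f k * h.
  have -> : y * f k * h = q * (h * (s * a)) by rewrite ydef /a !mulrA.
  by rewrite -gE -qdef qq.
have hqE : h - q = h * s' * (h - a).
  have -> : h - q = (h - q) * h by rewrite mulrBl hh qh.
  have -> : h - q = h * (1 - g) by rewrite qdef; nc.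
  rewrite g'E; have -> : h * (s' * (1 - a)) * h = h * s' * (h - a * h) by nc.
  by rewrite ah.
(* q = y f k h carries the factor h on the right, so the left multiple q' = y f k replaces it. The
   excess q' p = q' - q is taken out of the old idempotents by the factor 1 - q', and the new sum is
   p + q. *)
have [q' q'def] : exists q', q' = y * f k by exists (y * f k).
have pq : p * q = 0 by rewrite -hq mulrA ph mul0r.
have qp : q * p = 0 by rewrite -qh -mulrA hp mulr0.
have py : p * y = 0 by rewrite -qy mulrA pq mul0r.
have pq' : p * q' = 0 by rewrite q'def mulrA py mul0r.
have eq' i : (i < k)%N -> e i * q' = 0.
  by move=> ik; rewrite -(ep _ ik) -mulrA pq' mulr0.
have q'E : q' * p = q' - q by rewrite qE -q'def /h; nc.
have q'q : q' * q = q.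
  by rewrite -{1}hq mulrA q'def -qE qq.
have q'q' : q' * q' = q' by rewrite {2}q'def -{1}qy !mulrA q'q -mulrA -q'def {1}q'def mulrA qy.
have p'E : \sum_(i < k.+1) (if (i < k)%N then (1 - q') * e i else q') = p + q.
  rewrite big_ord_recr /= ltnn (eq_bigr (fun i : 'I_k => (1 - q') * e i)); last first.
    by move=> i _; rewrite ltn_ord.
  by rewrite -mulr_sumr -/p mulrBl mul1r q'E; nc.
exists (fun i => if (i < k)%N then (1 - q') * e i else q').
exists (fun i => if (i < k)%N then (1 - q') * r i else y).
exists (fun i => (h - q) * h * s' * x i); rewrite /= p'E.
have hqhq : (h - q) * (h - q) = h - q.
  have -> : (h - q) * (h - q) = h * h - h * q - q * h + q * q by nc.
  by rewrite hh hq qh qq; nc.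
have hhq : h * (h - q) = h - q by rewrite mulrBr hh hq.
have p'h : 1 - (p + q) = h - q by rewrite /h; nc.
rewrite p'h; split.
- move=> i; rewrite ltnS leq_eqVlt => /orP[/eqP ->|ik].
    by rewrite ltnn.
  by rewrite ik er // mulrA.
- move=> i j; rewrite ltnS leq_eqVlt => /orP[/eqP ->|ik];
    rewrite ltnS leq_eqVlt => /orP[/eqP ->|jk].
  + by rewrite ltnn eqxx.
  + rewrite ltnn jk; have -> : (k == j) = false by rewrite gtn_eqF.
    by rewrite mulrA mulrBr q'q' mulr1 subrr mul0r.
  + by rewrite ltnn ik (ltn_eqF ik) -mulrA eq' // mulr0.
  + have eiq' : e i * (1 - q') = e i by rewrite mulrBr mulr1 eq' // subr0.
    rewrite ik jk -mulrA (mulrA (e i)) eiq' ee //.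
    by case: eqP; rewrite ?mulr0.
- by move=> i; rewrite !mulrA hqhq.
have hsum : h - a = (\sum_(k.+1 <= i < n) x i * f i) * h.
  by rewrite {1}pE big_ltn // mulrDl /a; nc.
have -> : \sum_(k.+1 <= i < n) (h - q) * h * s' * x i * f i =
    (h - q) * h * s' * \sum_(k.+1 <= i < n) x i * f i.
  by rewrite mulr_sumr; apply: eq_bigr => i _; rewrite !mulrA.
rewrite -{1}hqhq -{1}hqhq {2}hqE hsum.
move: (\sum_(k.+1 <= i < n) x i * f i) => sg.
have -> : (h - q) * (h * s' * (sg * h)) * (h - q) =
    (h - q) * h * s' * sg * (h * (h - q)) by nc.
by rewrite hhq.
Qed.

(** * Chains of pairs a + b = 1 *)

(** W is the power set of A, well-ordered; Cantor's diagonal set excludes an injection into A. *)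
Lemma large_well_order (A : Type) : exists (W : Type) (lt : W -> W -> Prop),
  [/\ well_founded lt, forall i j k, lt i j -> lt j k -> lt i k,
      forall i j, [\/ lt i j, i = j | lt j i]
    & forall f : W -> A, ~ injective f].
Proof.
have [R woR] := well_ordering_principle {classic (A -> Prop)}.
pose W : Type := {classic (A -> Prop)}.
exists W, (fun x y => ~~ R y x).
have minR (x0 : W) (B : W -> Prop) : B x0 -> exists2 z, B z & forall y, B y -> R z y.
  move=> Bx; have [|z [[/asboolP Bz zmin] _]] := woR (fun y => `[< B y >]).
    by exists x0; apply/asboolP.
  by exists z => // y By; apply/zmin/asboolP.
have Rtot x y : R x y || R y x.
  have [_ [->|->] zmin] := minR x (fun z => z = x \/ z = y) (or_introl erefl).
    by rewrite zmin //; right.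
  by rewrite orbC zmin //; left.
have Ranti (x y : W) : R x y -> R y x -> x = y.
  move=> xy yx.
  have [|z [_ zuniq]] := woR (fun u => `[< u = x \/ u = y >]).
    by exists x; apply/asboolP; left.
  have Rxx u : R u u by move: (Rtot u u); rewrite orbb.
  rewrite -(zuniq x) ?(zuniq y) //; split; try by [apply/asboolP; left|apply/asboolP; right].
    by move=> u /asboolP[->|->].
  by move=> u /asboolP[->|->].
have ltW x y : ~~ R y x -> R x y by move: (Rtot x y); case: (R y x); rewrite ?orbF.
split.
- move=> x; apply: contrapT => nx.
  have [z nz zmin] := minR x (fun y => ~ Acc (fun x y => ~~ R y x) y) nx.
  apply: nz; split=> y yz; apply: contrapT => ny.
  by move: yz; rewrite zmin.
- move=> x y z nyx nzy; apply/negP => zx.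
  have [_ [->|->|->] mmin] :=
    minR x (fun u => [\/ u = x, u = y | u = z]) (Or31 _ _ erefl).
  + have xz : x = z by apply: Ranti => //; apply: mmin; exact: Or33.
    by move: nzy; rewrite -xz ltW.
  + by move: nyx; rewrite mmin //; exact: Or31.
  + by move: nzy; rewrite mmin //; exact: Or32.
- move=> x y; have [yx|nyx] := boolP (R y x); last exact: Or31.
  have [xy|nxy] := boolP (R x y); last exact: Or33.
  by apply: Or32; exact: Ranti.
- move=> f finj.
  pose B : W := fun a => exists2 b : W, f b = a & ~ b a.
  have nB : ~ B (f B) by move=> /[dup] BfB [b /finj ->].
  by apply: (nB); exists B.
Qed.

(** Existence of a value at d is a premise about the constructed f itself, so it can be proved
    afterwards by induction from the earlier values; v0 is the default where no value exists. *)
Lemma wf_dependent_choice (W : Type) (lt : W -> W -> Prop) (V : Type) (v0 : V)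
    (G : W -> (W -> V) -> V -> Prop) :
  well_founded lt ->
  (forall d f g v, (forall i, lt i d -> f i = g i) -> G d f v -> G d g v) ->
  exists f, forall d, (exists v, G d f v) -> G d f (f d).
Proof.
move=> wf Gext.
pose ext d (prev : forall y, lt y d -> V) y :=
  if pselect (lt y d) is left h then prev y h else v0.
pose F d (prev : forall y, lt y d -> V) : V :=
  if pselect (exists v, G d (ext d prev) v) is left h then projT1 (cid h) else v0.
exists (Fix wf (fun _ => V) F) => d [v Gv].
rewrite Fix_eq; last first.
  move=> x f g fg; congr F.
  by apply: functional_extensionality_dep => y; apply: functional_extensionality_dep.
set f := Fix _ _ _ in Gv *.
have fE i : lt i d -> f i = ext d (fun y _ => f y) i.
  by move=> lt_id; rewrite /ext; case: pselect.
rewrite /F; case: pselect => [h|[]]; last first.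
  by exists v; apply: Gext fE Gv.
by apply: Gext (projT2 (cid h)) => i /fE ->.
Qed.

Section Chains.
Variables (P : Type) (mul : P -> P -> P).
Hypothesis mulA : associative mul.
Implicit Types (O : P -> Prop) (Q : P -> P -> Prop).
Local Notation "x * y" := (mul x y).

(* [mul s x] is the target of the arrow [s] out of [x]: a subset [O] of [P] is
   seen as a category whose arrows act by left multiplication. *)
Definition chain_cocones O : Prop :=
  forall (D : Type) (lt : D -> D -> Prop) (x : D -> P) (t : D -> D -> P),
  inhabited D -> (forall i, ~ lt i i) ->
  (forall i j k, lt i j -> lt j k -> lt i k) ->
  (forall i j, [\/ lt i j, i = j | lt j i]) ->
  (forall i, O (x i)) -> (forall i j, lt i j -> t i j * x i = x j) ->
  (forall i j k, lt i j -> lt j k -> t j k * t i j = t i k) ->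
  exists c u, [/\ O c, forall i, u i * x i = c
    & forall i j, lt i j -> u j * t i j = u i].

(** At stage d a cocone over the earlier objects is followed by one step s, so that every arrow
    passes through a step and Q records a property of it. The recursion carries an object together
    with the arrows into it. *)
Lemma long_chain O Q x0 (W : Type) (lt : W -> W -> Prop) :
  chain_cocones O -> O x0 -> (forall x, O x -> exists s, O (s * x) /\ Q x s) ->
  well_founded lt -> (forall i j k, lt i j -> lt j k -> lt i k) ->
  (forall i j, [\/ lt i j, i = j | lt j i]) ->
  exists x t, [/\ forall i, O (x i), forall i j, lt i j -> t i j * x i = x j,
    forall i j k, lt i j -> lt j k -> t j k * t i j = t i k
    & forall i j, lt i j ->
        exists r s, [/\ O (r * x i), Q (r * x i) s & t i j = s * r]].
Proof.
move=> coc Ox0 step wf ltT ltot.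
have irr i : ~ lt i i by move=> h; elim: (wf i) h => y _ IH yy; exact (IH _ yy yy).
pose G (d : W) (f : W -> P * (W -> P)) (v : P * (W -> P)) :=
  [/\ O v.1, forall i, lt i d -> v.2 i * (f i).1 = v.1,
    forall i j, lt i j -> lt j d -> v.2 j * (f j).2 i = v.2 i
    & forall i, lt i d ->
      exists r s, [/\ O (r * (f i).1), Q (r * (f i).1) s & v.2 i = s * r]].
have [|f fP] := @wf_dependent_choice W lt _ (x0, fun _ => x0) G wf.
  move=> d f g v fg [h1 h2 h3 h4]; split=> // [i id|i j ij jd|i id].
  - by rewrite -fg // h2.
  - by rewrite -fg // h3.
  - by rewrite -fg //; exact: h4.
have fG d : G d f (f d).
  elim: (wf d) => {}d _ IH; apply: fP.
  have [[i0 i0d]|none] := pselect (exists i, lt i d); last first.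
    exists (x0, fun _ => x0).
    by split=> // [i h|j i _ h|i h]; case: none; exists i.
  have [|||||||c [u [Oc uc ut]]] := coc {i | lt i d}
    (fun i j => lt (projT1 i) (projT1 j)) (fun i => (f (projT1 i)).1)
    (fun i j => (f (projT1 j)).2 (projT1 i)).
  - by exists; exists i0.
  - by move=> i; exact: irr.
  - by move=> i j k; exact: ltT.
  - move=> [i id] [j jd]; have [ij|ij|ji] := ltot i j; [exact: Or31| |exact: Or33].
    by apply: Or32; subst j; rewrite (Prop_irrelevance id jd).
  - by move=> [i id]; have [] := IH i id.
  - by move=> [i id] [j jd] /= ij; have [_ h _ _] := IH j jd; exact: h.
  - move=> [i id] [j jd] [k kd] /= ij jk.
    by have [_ _ h _] := IH k kd; exact: h.
  have [s [Os Qs]] := step c Oc.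
  exists (s * c, fun i =>
    if pselect (lt i d) is left h then s * u (exist _ i h) else s); split=> //=.
  - by move=> i id; case: pselect => // h; rewrite -mulA (uc (exist _ i h)).
  - move=> i j ij jd; case: pselect => // hj; case: pselect => [hi|[]].
      by rewrite -mulA (ut (exist _ i hi) (exist _ j hj)).
    exact: ltT jd.
  - move=> i id; case: pselect => // h; exists (u (exist _ i h)), s.
    by rewrite (uc (exist _ i h)).
exists (fun i => (f i).1), (fun i j => (f j).2 i); split.
- by move=> i; have [] := fG i.
- by move=> i j ij; have [_ h _ _] := fG j; exact: h.
- by move=> i j k ij jk; have [_ _ h _] := fG k; exact: h.
- by move=> i j ij; have [_ _ _ h] := fG j; exact: h.
Qed.

(* A chain of non-invertible arrows would have distinct objects, so it cannot be
   longer than the cardinality of P allows. *)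
Lemma chain_maximal O x0 : chain_cocones O -> O x0 ->
  exists2 x, O x & forall t, O (t * x) -> exists t', t' * (t * x) = x.
Proof.
move=> coc Ox0; apply: contrapT => nmax.
pose Q x s := ~ exists t', t' * (s * x) = x.
have step x : O x -> exists s, O (s * x) /\ Q x s.
  move=> Ox; apply: contrapT => ns; apply: nmax; exists x => // t Otx.
  by apply: contrapT => nt; apply: ns; exists t.
have [W [lt [wf ltT ltot large]]] := large_well_order P.
have [x [t [Ox tx _ tQ]]] := long_chain coc Ox0 step wf ltT ltot.
have neq i j : lt i j -> x i <> x j.
  move=> ij xij; have [r [s [_ Qs tE]]] := tQ i j ij.
  by apply: Qs; exists r; rewrite (mulA s) -tE tx // xij.
apply: (large x) => i j xij.
by have [/neq|//|/neq h] := ltot i j; last by case: h.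
Qed.

End Chains.

Lemma linear_bundle (A : pzRingType) (M N : lmodType A) (f : M -> N) :
  linear f -> exists g : {linear M -> N}, g =1 f.
Proof.
by move=> lf; exists (HB.pack_for {linear M -> N} f (GRing.isLinear.Build A M N _ f lf)).
Qed.

(** Maps below are described through representatives, hence as relations; linearity reduces
    single-valuedness to the value at 0. *)
Lemma linear_of_relation (A : pzRingType) (M N : lmodType A) (R : M -> N -> Prop) :
  (forall a x y x' y', R x y -> R x' y' -> R (a *: x + x') (a *: y + y')) ->
  (forall x, exists y, R x y) -> (forall y, R 0 y -> y = 0) ->
  exists f : {linear M -> N}, forall x, R x (f x).
Proof.
move=> Rlin /choice[f fR] R0.
have Runiq x y y' : R x y -> R x y' -> y = y'.
  move=> /(Rlin (-1) _ _ _ _) h /h; rewrite !scaleN1r addNr => /R0 e.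
  by apply/esym/subr0_eq; rewrite addrC.
have lf : linear f by move=> a x y; apply: Runiq (fR _) (Rlin _ _ _ _ _ _ _).
by have [g gf] := linear_bundle lf; exists g => x; rewrite gf.
Qed.

(** * Idempotents from maximal pairs *)

Section Pair.
Variables (A : pzRingType) (X : lmodType A).
Local Notation S := (lmodEnd X).

Definition pair_mul (g h : S * S) : S * S := (g.1 * h.1, g.2 * h.2).

Lemma pair_mulA : associative pair_mul.
Proof. by move=> x y z; rewrite /pair_mul !mulrA. Qed.

Definition pair_sum1 (g : S * S) : Prop := g.1 + g.2 = 1.

Local Notation "x ** y" := (pair_mul x y) (at level 40, left associativity).

Lemma pair_mul_assoc x y z : x ** (y ** z) = x ** y ** z.
Proof. exact: pair_mulA. Qed.

Lemma lmodEndM (f g : S) x : (f * g) x = f (g x).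
Proof. by []. Qed.

Lemma lmodEnd_ext (f g : S) : (forall x, f x = g x) -> f = g.
Proof. exact: linear_ext. Qed.

(* Take g0 = (al, be) maximal above (a, b), then m maximal among the pairs fixing
   g0.  A pair g fixing g0 maps im m.1 isomorphically onto a complement of
   ker m.1, and maximality of g0 produces such a g with g.1 in S al; the
   idempotent e onto im m.1 is obtained by inverting m.1 g.1 there. *)
Theorem pair_idempotent : chain_cocones pair_mul pair_sum1 ->
  forall a b : S, a + b = 1 -> exists al be e ya yb y : S,
    [/\ al = ya * a, be = yb * b & al + be = 1] /\
    [/\ e * e = e, e = y * al & e * al = al].
Proof.
move=> coc a b ab.
(* Restricting to multiples of (a, b) makes al and be left multiples of a and b. *)
pose O g := pair_sum1 g /\ exists t, g = t ** (a, b).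
have cocO : chain_cocones pair_mul O.
  move=> D lt x t [i0] irr ltT ltot Ox tx tt.
  have [c [u [Oc uc ut]]] := coc D lt x t (inhabits i0) irr ltT ltot
    (fun i => (Ox i).1) tx tt.
  exists c, u; split=> //; split=> //; have [_ [t0 x0E]] := Ox i0.
  by exists (u i0 ** t0); rewrite -(uc i0) x0E pair_mul_assoc.
have [|g0 [g01 [t0 g0E]] g0max] := chain_maximal pair_mulA (x0 := (a, b)) cocO.
  by split=> //; exists (1, 1); rewrite /pair_mul !mul1r.
have {}g0max t : pair_sum1 (t ** g0) -> exists t', t' ** (t ** g0) = g0.
  move=> h; apply: g0max; split=> //; exists (t ** t0).
  by rewrite {1}g0E pair_mul_assoc.
(* A cocone over copies of g0 may end elsewhere; maximality of g0 supplies an arrow t' back. *)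
have coc0 : chain_cocones pair_mul (eq^~ g0).
  move=> D lt x t [i0] irr ltT ltot Ox tx tt.
  have [|c [u [Oc uc ut]]] := coc D lt x t (inhabits i0) irr ltT ltot _ tx tt.
    by move=> i; rewrite Ox.
  have [|t' t'E] := g0max (u i0).
    by rewrite -(Ox i0) uc.
  have t'c : t' ** c = g0 by rewrite -(uc i0) (Ox i0).
  exists g0, (fun i => t' ** u i); split=> // [i|i j ij].
    by rewrite -pair_mul_assoc uc.
  by rewrite -pair_mul_assoc ut.
pose M m := m ** g0 = g0.
have cocM : chain_cocones pair_mul M.
  move=> D lt x t [i0] irr ltT ltot Mx tx tt.
  have [//||c [u [-> uc ut]]] := coc0 D lt (fun=> g0) t (inhabits i0) irr ltT ltot _ _ tt.
    by move=> i j ij; rewrite -[X in t i j ** X](Mx i) pair_mul_assoc tx // Mx.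
  have um i j : lt i j -> u j ** x j = u i ** x i.
    by move=> ij; rewrite -(tx i j ij) pair_mul_assoc ut.
  exists (u i0 ** x i0), u; split=> // [|i].
    by rewrite /M -pair_mul_assoc Mx uc.
  by have [/um|->|/um] := ltot i i0.
have M1 : M (1, 1) by rewrite /M /pair_mul !mul1r; case: (g0).
have MM x y : M x -> M y -> M (x ** y).
  by move=> Mx My; rewrite /M -pair_mul_assoc My.
have [m Mm mmax] := chain_maximal pair_mulA cocM M1.
have {}mmax t : M t -> exists t', t' ** (t ** m) = m by move=> Mt; apply/mmax/MM.
(* Some t' restores m after t, so t.1 is injective on im m.1. *)
have m_inj t y : M t -> t.1 (m.1 y) = 0 -> m.1 y = 0.
  by move=> /mmax[t' t'E] ty; rewrite -t'E /= ty linear0.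
(* If no z existed, iterating m g along W would give cocone arrows u i with pairwise distinct values
   at m y, too many for X. *)
have m_surj g y : M g -> exists z, m.1 y = m.1 (g.1 z).
  move=> Mg; apply: contrapT => ny.
  pose Q (x s : S * S) := s = m ** g.
  have [W [lt [wf ltT ltot large]]] := large_well_order X.
  have [[i0]|noW] := pselect (inhabited W); last first.
    by apply: (large (fun=> 0)) => i; case: noW.
  have [||x [t [xE tx tt tQ]]] :=
    long_chain pair_mulA (O := eq^~ g0) (Q := Q) (x0 := g0) coc0 _ _ wf ltT ltot.
  - by [].
  - by move=> _ ->; exists (m ** g); split=> //; apply: MM.
  have [|c [u [-> uc ut]]] := coc0 W lt x t (inhabits i0) _ ltT ltot xE tx tt.
    by move=> i h; elim: (wf i) h => z _ IH zz; exact (IH _ zz zz).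
  have Mu i : M (u i) by rewrite /M -{1}(xE i).
  have neq i j : lt i j -> (u i).1 (m.1 y) <> (u j).1 (m.1 y).
    move=> ij; have [r [s [_ sE tE]]] := tQ i j ij.
    rewrite -(ut i j ij) tE sE /= => /eqP.
    rewrite -subr_eq0 -linearB /= -linearB => /eqP/(m_inj _ _ (Mu j))/eqP.
    rewrite linearB subr_eq0 => /eqP h.
    by apply: ny; exists (r.1 (m.1 y)).
  apply: (large (fun i => (u i).1 (m.1 y))) => i j uij.
  by have [/neq|//|/neq h] := ltot i j; last by case: h.
pose al := g0.1; pose be := g0.2.
have beE : be = 1 - al by rewrite -g01 addrC addKr.
(* (al, 1 + al) sends (al, 1 - al) to (al^2, 1 - al^2), still of sum 1. Returning by t' gives a pair
   g that fixes g0 and has g.1 = t'.1 al. *)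
have [|t' t'E] := g0max (al, 1 + al).
  by rewrite /pair_sum1 /= -/al -/be beE; nc.
pose g := t' ** (al, 1 + al).
have Mg : M g by rewrite /M /g -pair_mul_assoc.
(* The graph of y: x goes to the v in im m.1 with m g v = m x, so y g is the identity on im m.1. *)
pose R x v := (exists w, v = m.1 w) /\ m.1 (g.1 v) = m.1 x.
have Runiq v : R 0 v -> v = 0.
  move=> [[w ->]]; rewrite linear0; exact: (m_inj (m ** g)) (MM _ _ Mm Mg).
have Rlin c x v x' v' : R x v -> R x' v' -> R (c *: x + x') (c *: v + v').
  move=> [[w ->] Rx] [[w' ->] Rx']; split; first by exists (c *: w + w'); rewrite linearP.
  by rewrite !linearP /= Rx Rx'.
have Rtot x : exists v, R x v.
  have [z xz] := m_surj (g ** m) x (MM _ _ Mg Mm).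
  by exists (m.1 z); split; [exists z|rewrite xz].
have [y yR] := linear_of_relation Rlin Rtot Runiq.
pose e : S := (y : S) * g.1.
have eV w : e (m.1 w) = m.1 w.
  have Rw : R (g.1 (m.1 w)) (m.1 w) by split; first by exists w.
  have := Rlin (-1) _ _ _ _ (yR (g.1 (m.1 w))) Rw.
  by rewrite !scaleN1r addNr => /Runiq/eqP; rewrite addrC subr_eq0 => /eqP.
have eim x : exists w, e x = m.1 w by have [] := yR (g.1 x).
have mal : m.1 * al = al by exact: (congr1 fst Mm).
exists al, be, e, t0.1, t0.2, ((y : S) * t'.1); split.
  by split; rewrite ?beE; [rewrite /al g0E|rewrite -beE /be g0E|nc].
split.
- by apply: lmodEnd_ext => x; rewrite lmodEndM; have [w ->] := eim x; rewrite eV.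
- by rewrite /e /g /= mulrA.
- by apply: lmodEnd_ext => x; rewrite lmodEndM -mal lmodEndM eV.
Qed.

End Pair.

(** * Extensions and direct limits *)

Section Modules.
Variable A : pzRingType.
Implicit Types (V W X Y Z E M N L Q : lmodType A).

(** Prop-valued predicates suit submodules described by existentials; [smod_mem] makes them boolean
    closed predicates. *)
Record smod V := Smod {
  smod_pred :> V -> Prop;
  smodP : smod_pred 0 /\
    forall a x y, smod_pred x -> smod_pred y -> smod_pred (a *: x + y)
}.

Lemma smod_exists V (P : V -> Prop) :
  P 0 /\ (forall a x y, P x -> P y -> P (a *: x + y)) ->
  exists K : smod V, forall x, K x = P x.
Proof. by move=> KP; exists (Smod KP). Qed.

Lemma smod_eq V (K L : smod V) : (forall x, K x <-> L x) -> K = L.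
Proof.
case: K L => [K Kp] [L Lp] /= KL.
have E : K = L by apply: functional_extensionality_dep => x; apply: propext.
by subst L; rewrite (Prop_irrelevance Kp Lp).
Qed.

Definition smod_mem V (K : smod V) : {pred V} := fun x => `[< K x >].

Lemma smod_memP V (K : smod V) x : reflect (K x) (x \in smod_mem K).
Proof. exact: asboolP. Qed.

Fact smod_submod_closed V (K : smod V) : submod_closed (smod_mem K).
Proof.
have [K0 KZ] := smodP K.
by split=> [|a x y /smod_memP Kx /smod_memP Ky]; apply/smod_memP => //; apply: KZ.
Qed.

HB.instance Definition _ V (K : smod V) :=
  GRing.isSubmodClosed.Build A V (smod_mem K) (smod_submod_closed K).

Definition quotm V (K : smod V) :=
  Quotient.quot (GRing.ZmodClosed.clone V (smod_mem K) _).

HB.instance Definition _ V (K : smod V) := GRing.Zmodule.on (quotm K).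
HB.instance Definition _ V (K : smod V) : EqQuotient V _ (quotm K) :=
  EqQuotient.on (quotm K).

Section Quotm.
Variables (V : lmodType A) (K : smod V).

Lemma quotm_eq x y : \pi_(quotm K) x = \pi_(quotm K) y <-> K (x - y).
Proof.
have -> : K (x - y) <-> x - y \in smod_mem K by split=> /smod_memP.
by rewrite Quotient.idealrBE; split=> [->|/eqP].
Qed.

Lemma quotmD x y : \pi_(quotm K) (x + y) = \pi_(quotm K) x + \pi_(quotm K) y.
Proof. exact: Quotient.pi_add. Qed.

Definition quotm_scale (a : A) (q : quotm K) : quotm K := \pi_(quotm K) (a *: repr q).

Lemma quotmZ a x : \pi_(quotm K) (a *: x) = quotm_scale a (\pi_(quotm K) x).
Proof.
have [K0 KZ] := smodP K; apply/quotm_eq; rewrite -scalerBr -[_ *: _]addr0.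
by apply: KZ => //; apply/quotm_eq; rewrite reprK.
Qed.

Fact quotm_scaleA a b q : quotm_scale a (quotm_scale b q) = quotm_scale (a * b) q.
Proof.
by rewrite -[q]reprK -(quotmZ b (repr q)) -(quotmZ _ (repr q)) -quotmZ scalerA.
Qed.
Fact quotm_scale1 : left_id 1 quotm_scale.
Proof. by move=> q; rewrite -[q]reprK -(quotmZ _ (repr q)) scale1r. Qed.
Fact quotm_scaleDr : right_distributive quotm_scale +%R.
Proof.
move=> a p q; rewrite -[p]reprK -[q]reprK -quotmD -(quotmZ _ (repr p)).
by rewrite -(quotmZ _ (repr q)) -quotmZ -quotmD scalerDr.
Qed.
Fact quotm_scaleDl q : {morph quotm_scale^~ q : a b / a + b}.
Proof. move=> a b; rewrite -[q]reprK -!(quotmZ _ (repr q)) -quotmD.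
by rewrite scalerDl. Qed.

HB.instance Definition _ := GRing.Zmodule_isLmodule.Build A (quotm K)
  quotm_scaleA quotm_scale1 quotm_scaleDr quotm_scaleDl.

Lemma quotient_map : exists q : {linear V -> quotm K},
  (forall x, exists v, q v = x) /\ forall v, q v = 0 <-> K v.
Proof.
have [|q qE] := @linear_bundle _ V (quotm K) (fun x => \pi_(quotm K) x).
  by move=> a x y; rewrite quotmD quotmZ.
exists q; split=> [x|v]; first by exists (repr x); rewrite qE reprK.
have -> : (0 : quotm K) = q 0 by rewrite linear0.
by rewrite !qE quotm_eq subr0.
Qed.

End Quotm.

Definition short_exact Y E X (i : {linear Y -> E}) (q : {linear E -> X}) : Prop :=
  [/\ injective i, forall x, exists e, q e = x
    & forall e, q e = 0 <-> exists y, e = i y].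

Lemma linear_eq0_inj M N (f : {linear M -> N}) : (forall x, f x = 0 -> x = 0) -> injective f.
Proof.
by move=> f0 x y /eqP; rewrite -subr_eq0 -linearB => /eqP/f0/subr0_eq.
Qed.

Lemma Ext1_retraction X Y E (i : {linear Y -> E}) (q : {linear E -> X}) :
  Ext1_eq0 X Y -> short_exact i q -> exists r : {linear E -> Y}, forall y, r (i y) = y.
Proof.
move=> ext [inj surj ex]; have [h [hi _]] := ext (Extension inj surj ex).
by exists (fst \o h) => y; have /= -> := hi y.
Qed.

Lemma Ext1_section X Y E (i : {linear Y -> E}) (q : {linear E -> X}) :
  Ext1_eq0 X Y -> short_exact i q -> exists s : {linear X -> E}, forall x, q (s x) = x.
Proof.
move=> ext seq; have [r ri] := Ext1_retraction ext seq.
have [inj surj ex] := seq.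
have [|||s sP] := @linear_of_relation _ X E (fun x e => q e = x /\ r e = 0).
- by move=> a x e x' e' [<- re] [<- re']; rewrite !linearP re re' scaler0 addr0.
- move=> x; have [e qe] := surj x; exists (e - i (r e)).
  have qi : q (i (r e)) = 0 by apply/ex; exists (r e).
  by rewrite !linearB /= qi ri subr0 subrr.
- by move=> e [/ex[y ->]]; rewrite ri => ->; rewrite linear0.
by exists s => x; have [] := sP x.
Qed.

Lemma Ext1_of_retraction X Y :
  (forall E (i : {linear Y -> E}) (q : {linear E -> X}), short_exact i q ->
     exists r : {linear E -> Y}, forall y, r (i y) = y) -> Ext1_eq0 X Y.
Proof.
move=> retr E; case: E => E i q inj surj ex; have [//|r ri] := retr E i q.
have [|h hE] := @linear_bundle _ E (Y * X)%type (fun e => (r e, q e)).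
  by move=> a x y; rewrite !linearP.
exists h; split=> [y|e] /=; rewrite hE //= ri.
by congr pair; apply/ex; exists y.
Qed.

Lemma Ext1_of_section X Y :
  (forall E (i : {linear Y -> E}) (q : {linear E -> X}), short_exact i q ->
     exists s : {linear X -> E}, forall x, q (s x) = x) -> Ext1_eq0 X Y.
Proof.
move=> sec; apply: Ext1_of_retraction => E i q seq.
have [inj surj ex] := seq; have [s sq] := sec E i q seq.
have [|||r rP] := @linear_of_relation _ E Y (fun e y => i y = e - s (q e)).
- move=> a e y e' y' ye ye'; rewrite linearP ye ye' [q (_ + _)]linearP [s (_ + _)]linearP.
  by rewrite scalerBr opprD addrACA.
- move=> e; have [|y yE] := (ex (e - s (q e))).1; last by exists y.
  by rewrite linearB /= sq subrr.
- by move=> y; rewrite !linear0 addr0 -(linear0 i) => /inj.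
by exists r => y; apply: inj; rewrite rP (ex (i y)).2 ?linear0 ?linear0 ?addr0 //; exists y.
Qed.

(** R is the graph of a linear map from ker q to Z. The pushout of E along it is an extension of Q
    by Z, and a retraction of this extension onto Z extends the map to E. *)
Lemma Ext1_extend Q Z E (q : {linear E -> Q}) (R : E -> Z -> Prop) :
  Ext1_eq0 Q Z -> (forall x, exists e, q e = x) ->
  (forall a x y x' y', R x y -> R x' y' -> R (a *: x + x') (a *: y + y')) ->
  (forall z, R 0 z -> z = 0) -> (forall e, q e = 0 <-> exists z, R e z) ->
  exists g : {linear E -> Z}, forall e z, R e z -> g e = z.
Proof.
move=> ext surj Rlin R0 ex.
have R00 : R 0 0.
  have [z Rz] := (ex 0).1 (linear0 q).
  by rewrite -(R0 _ Rz).
have [|K KE] := @smod_exists (Z * E)%type (fun p => R p.2 (- p.1)).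
  split=> [|a x y Rx Ry] /=; first by rewrite oppr0.
  by rewrite opprD -scalerN; apply: Rlin.
have [c [csurj cK]] := quotient_map K.
have cker z e : c (z, e) = 0 <-> R e (- z) by rewrite cK KE.
have [i iE] : exists i : {linear Z -> quotm K}, forall z, i z = c (z, 0).
  have [|i iE] := @linear_bundle _ Z (quotm K) (fun z => c (z, 0)).
    by move=> a x y; rewrite -linearP; congr (c (_, _)); rewrite /= scaler0 addr0.
  by exists i.
have [j jE] : exists j : {linear E -> quotm K}, forall e, j e = c (0, e).
  have [|j jE] := @linear_bundle _ E (quotm K) (fun e => c (0, e)).
    by move=> a x y; rewrite -linearP; congr (c (_, _)); rewrite /= scaler0 addr0.
  by exists j.
have cij z e : c (z, e) = i z + j e.
  by rewrite iE jE -linearD; congr (c (_, _)); rewrite /= ?addr0 ?add0r.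
have [|||o oP] := @linear_of_relation _ (quotm K) Q
    (fun w x => exists z e, w = c (z, e) /\ x = q e).
- move=> a _ _ _ _ [z [e [-> ->]]] [z' [e' [-> ->]]].
  by exists (a *: z + z'), (a *: e + e'); rewrite -!linearP.
- by move=> w; have [[z e] <-] := csurj w; exists (q e), z, e.
- by move=> _ [z [e [/esym/cker Re ->]]]; apply/ex; exists (- z).
have ocE z e : o (c (z, e)) = q e.
  have [z' [e' [/eqP]]] := oP (c (z, e)); rewrite -subr_eq0 -linearB.
  move=> /eqP/(cker (z - z') (e - e')) Re ->.
  by apply/esym/subr0_eq; rewrite -linearB; apply/ex; eexists; exact: Re.
have [|r ri] := @Ext1_retraction Q Z (quotm K) i o ext.
  split.
  - apply: linear_eq0_inj => z; rewrite iE => /cker/R0/eqP.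
    by rewrite oppr_eq0 => /eqP.
  - by move=> x; have [e <-] := surj x; exists (c (0, e)).
  - move=> w; have [[z e] <-] := csurj w; rewrite ocE; split.
      move=> /ex[z' Re]; exists (z + z'); apply/subr0_eq; rewrite iE -linearB.
      apply/(cker (z - (z + z')) (e - 0)).
      by rewrite subr0 opprB addrC addKr.
    by move=> [z' e']; rewrite -(ocE z e) e' iE ocE linear0.
exists (r \o j) => e z Re /=; rewrite -[RHS]ri; congr (r _).
apply/subr0_eq; rewrite iE jE -linearB; apply/(cker (0 - z) (e - 0)).
by rewrite sub0r opprK subr0.
Qed.

Lemma submod_valP V (N : submodClosed V) a (x y : submod N) :
  val (a *: x + y) = a *: val x + val y.
Proof. exact: linearP. Qed.

Lemma submod_exists V (N : submodClosed V) x :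
  x \in N -> exists b : submod N, val b = x.
Proof. by move=> Nx; exists (exist (fun x => x \in N) x Nx). Qed.

(** A section of the pullback of q along f, followed by the projection to E. *)
Lemma Ext1_lift M Y E X (i : {linear Y -> E}) (q : {linear E -> X}) (f : {linear M -> X}) :
  Ext1_eq0 M Y -> short_exact i q -> exists l : {linear M -> E}, forall m, q (l m) = f m.
Proof.
move=> ext [inj surj ex].
have [|K KE] := @smod_exists (E * M)%type (fun p => q p.1 = f p.2).
  by split=> [|a x y ex' ey] /=; rewrite ?linear0 // !linearP ex' ey.
have KP (b : submod (smod_mem K)) : q (val b).1 = f (val b).2.
  by have /smod_memP := valP b; rewrite KE.
have mk e m : q e = f m -> exists b : submod (smod_mem K), val b = (e, m).
  move=> qf; have Kem : (e, m) \in smod_mem K by apply/smod_memP; rewrite KE.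
  exact: submod_exists Kem.
have [|||j jP] := @linear_of_relation _ Y (submod (smod_mem K)) (fun y b => val b = (i y, 0)).
- move=> a y b y' b' vb vb'.
  rewrite submod_valP vb vb' linearP.
  by congr pair; rewrite /= scaler0 addr0.
- move=> y; apply: mk; rewrite linear0; apply/ex; by exists y.
- by move=> b; rewrite linear0 => vb; apply: val_inj; rewrite vb linear0.
have [p pE] : exists p : {linear submod (smod_mem K) -> M}, forall b, p b = (val b).2.
  have [|p pE] := @linear_bundle _ (submod (smod_mem K)) M (fun b => (val b).2).
    by move=> a x y; rewrite linearP.
  by exists p.
have [|s sp] := @Ext1_section M Y (submod (smod_mem K)) j p ext.
  split.
  - apply: linear_eq0_inj => y jy; have := jP y; rewrite jy linear0 => -[/esym iy].
    by apply: inj; rewrite iy linear0.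
  - move=> m; have [e qe] := surj (f m); have [b vb] := mk e m qe.
    by exists b; rewrite pE vb.
  - move=> b; rewrite pE; split.
      move=> b2; have := KP b; rewrite b2 linear0 => /ex[y iy].
      by exists y; apply: val_inj; rewrite jP -iy -b2; case: (val b).
    by move=> [y ->]; rewrite jP.
have [|l lE] := @linear_bundle _ M E (fun m => (val (s m)).1).
  by move=> a x y; rewrite !linearP.
by exists l => m; rewrite lE KP -pE sp.
Qed.

(** For an extension V of E by Z, the map i lifts to l : Y -> V. The kernel of V -> X is the direct
    sum of j Z and l Y, and its projection onto Z extends to V. *)
Lemma Ext1_extension_left Y E X Z (i : {linear Y -> E}) (q : {linear E -> X}) :
  short_exact i q -> Ext1_eq0 Y Z -> Ext1_eq0 X Z -> Ext1_eq0 E Z.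
Proof.
move=> [inj surj ex] extY extX; apply: Ext1_of_retraction => V j p seq.
have [l lP] := Ext1_lift i extY seq; have [jinj psurj pex] := seq.
have pj z : p (j z) = 0 by apply/pex; exists z.
have [||||r rP] := @Ext1_extend X Z V (q \o p)
    (fun v z => exists y, v = j z + l y) extX.
- move=> x; have [e <-] := surj x; have [v <-] := psurj e; by exists v.
- move=> a v z v' z' [y ->] [y' ->]; exists (a *: y + y').
  by rewrite !linearP scalerDr addrACA.
- move=> z [y /esym jl]; have := congr1 p jl.
  rewrite linearD linear0 pj lP add0r -(linear0 i) => /inj y0.
  by apply: jinj; move: jl; rewrite y0 linear0 addr0 linear0.
- move=> v /=; split.
    move=> /ex[y py]; have [|z zE] := (pex (v - l y)).1.
      by rewrite linearB /= lP py subrr.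
    by exists z, y; rewrite -zE subrK.
  by move=> [z [y ->]]; apply/ex; exists y; rewrite linearD pj lP add0r.
by exists r => z; apply: rP; exists 0; rewrite linear0 addr0.
Qed.

(** For an extension V of Q by E, the map q extends along j to w : V -> X. The kernel of (p, w) : V
    -> Q x X is Y, so x |-> (x, 0) lifts through it, and the lift is a section of p. *)
Lemma Ext1_extension_right Q Y E X (i : {linear Y -> E}) (q : {linear E -> X}) :
  short_exact i q -> Ext1_eq0 Q Y -> Ext1_eq0 Q X -> Ext1_eq0 Q E.
Proof.
move=> [inj surj ex] extY extX; apply: Ext1_of_section => V j p [jinj psurj pex].
have pj e : p (j e) = 0 by apply/pex; exists e.
have [||||w wP] := @Ext1_extend Q X V p (fun v x => exists e, v = j e /\ x = q e) extX.
- exact: psurj.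
- move=> a v x v' x' [e [-> ->]] [e' [-> ->]]; exists (a *: e + e').
  by rewrite !linearP.
- by move=> x [e [/esym/eqP]]; rewrite -(linear0 j) => /eqP/jinj -> ->; rewrite linear0.
- move=> v; split=> [/pex[e ->]|[x [e [-> _]]]] //; by exists (q e), e.
have wj e : w (j e) = q e by apply: wP; exists e.
have [|pw pwE] := @linear_bundle _ V (Q * X)%type (fun v => (p v, w v)).
  by move=> a x y; rewrite !linearP.
have [|f fE] := @linear_bundle _ Q (Q * X)%type (fun x => (x, 0)).
  by move=> a x y; congr pair; rewrite /= scaler0 addr0.
have [|l lP] := @Ext1_lift Q Y V _ (j \o i) pw f extY.
  split.
  - by move=> y y' /= /jinj/inj.
  - move=> [x x']; have [v pv] := psurj x; have [e qe] := surj (x' - w v).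
    exists (v + j e); rewrite pwE !linearD /= pj wj qe pv addr0.
    by rewrite addrC subrK.
  - move=> v; rewrite pwE; split=> [[/pex[e ->]]|[y ->]] /=.
      by rewrite wj => /ex[y ->]; exists y.
    by rewrite pj wj; congr pair; apply/ex; exists y.
by exists l => x; have := lP x; rewrite pwE fE => -[].
Qed.

Lemma Ext1_retract_right Q X Z (i : {linear Z -> X}) (p : {linear X -> Z}) :
  (forall z, p (i z) = z) -> Ext1_eq0 Q X -> Ext1_eq0 Q Z.
Proof.
move=> pi extX; apply: Ext1_of_retraction => V j q [jinj qsurj qex].
have [||||g gP] := @Ext1_extend Q X V q (fun v x => exists z, v = j z /\ x = i z) extX.
- exact: qsurj.
- move=> a v x v' x' [e [-> ->]] [e' [-> ->]]; exists (a *: e + e').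
  by rewrite !linearP.
- by move=> x [e [/esym/eqP]]; rewrite -(linear0 j) => /eqP/jinj -> ->; rewrite linear0.
- move=> v; split=> [/qex[e ->]|[x [e [-> _]]]]; first by exists (i e), e.
  by apply/qex; exists e.
by exists (p \o g) => z /=; rewrite (gP _ (i z)) //; exists z.
Qed.

End Modules.

Lemma choice_dep (X : Type) (Y : X -> Type) (P : forall x, Y x -> Prop) :
  (forall x, exists y, P x y) -> exists f, forall x, P x (f x).
Proof. by move=> h; exists (fun x => projT1 (cid (h x))) => x; case: cid. Qed.

Section RelationOrder.
Variables (T : Type) (R : T -> T -> Prop).
Hypotheses (Rrefl : forall x, R x x) (Ranti : forall x y, R x y -> R y x -> x = y)
  (Rtrans : forall x y z, R x y -> R y z -> R x z).

(** An alias of T whose parameters carry the order axioms, so that an order instance can be attached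
    to it. *)
Definition rel_order of (forall x, R x x) & (forall x y, R x y -> R y x -> x = y)
  & (forall x y z, R x y -> R y z -> R x z) : Type := T.
Local Notation I := (rel_order Rrefl Ranti Rtrans).

HB.instance Definition _ := gen_eqMixin I.
HB.instance Definition _ := gen_choiceMixin I.

Definition rel_le : rel I := fun x y => `[< R x y >].

Fact rel_le_refl : reflexive rel_le. Proof. by move=> x; apply/asboolP. Qed.
Fact rel_le_anti : antisymmetric rel_le.
Proof. by move=> x y /andP[/asboolP xy /asboolP yx]; apply: Ranti. Qed.
Fact rel_le_trans : transitive rel_le.
Proof. by move=> y x z /asboolP xy /asboolP yz; apply/asboolP/Rtrans/yz. Qed.

HB.instance Definition _ := Order.Le_isPOrder.Build (Order.Disp tt tt) I
  rel_le_refl rel_le_anti rel_le_trans.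

End RelationOrder.

(** * Classes closed under direct limits *)

Section Limits.
Variable A : pzRingType.
Implicit Types (X Y Z L V : lmodType A) (F C : lmodType A -> Prop).

Lemma linear_relation_functional X Y (R : X -> Y -> Prop) x y y' :
  (forall a x y x' y', R x y -> R x' y' -> R (a *: x + x') (a *: y + y')) ->
  (forall y, R 0 y -> y = 0) -> R x y -> R x y' -> y = y'.
Proof.
move=> Rlin R0 /(Rlin (-1) _ _ _ _) h /h; rewrite !scaleN1r addNr => /R0 e.
by apply/esym/subr0_eq; rewrite addrC.
Qed.

Lemma direct_limit_criterion (d : Order.disp_t) (I : porderType d)
    (X_ : I -> lmodType A) (f : forall i j, (i <= j)%O -> {linear X_ i -> X_ j})
    L (u : forall i, {linear X_ i -> L}) :
  direct_system f -> cocone f u -> (forall w, exists i x, w = u i x) ->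
  (forall i x, u i x = 0 -> exists j (le_ij : (i <= j)%O), f i j le_ij x = 0) ->
  direct_limit f u.
Proof.
move=> [_ dir _ _] cu surj ker; split=> // L' v cv.
pose R w y := exists i x, w = u i x /\ y = v i x.
have Rlin a x y x' y' : R x y -> R x' y' -> R (a *: x + x') (a *: y + y').
  move=> [i [z [-> ->]]] [j [z' [-> ->]]]; have [k [ik jk]] := dir i j.
  exists k, (a *: f i k ik z + f j k jk z'); rewrite !linearP.
  have /= -> := cu i k ik z; have /= -> := cu j k jk z'.
  by have /= -> := cv i k ik z; have /= -> := cv j k jk z'.
have R0 y : R 0 y -> y = 0.
  move=> [i [x [/esym/ker[j [ij fx]] ->]]].
  by have /= <- := cv i j ij x; rewrite fx linear0.
have Rtot w : exists y, R w y.
  by have [i [x ->]] := surj w; exists (v i x), i, x.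
have [g gR] := linear_of_relation Rlin Rtot R0.
have gu i x : g (u i x) = v i x.
  by apply: (linear_relation_functional Rlin R0 (gR _)); exists i, x.
exists g; split=> // g' g'u w; have [i [x ->]] := surj w.
by rewrite gu; exact: g'u.
Qed.

(** Realised by germs at infinity: families I -> X modulo those eventually 0, and among them the
    classes of j |-> h i j x, set to 0 where j is not above i. *)
Lemma constant_direct_limit X (d : Order.disp_t) (I : porderType d)
    (h : I -> I -> {linear X -> X}) :
  inhabited I -> (forall i j : I, exists k : I, (i <= k)%O /\ (j <= k)%O) ->
  (forall i, h i i =1 id) ->
  (forall i j k, (i <= j)%O -> (j <= k)%O -> h j k \o h i j =1 h i k) ->
  exists L (u : I -> {linear X -> L}),
    [/\ forall i j, (i <= j)%O -> u j \o h i j =1 u i,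
      forall w, exists i x, w = u i x,
      forall i x, u i x = 0 -> exists2 j, (i <= j)%O & h i j x = 0
      & forall F, closed_under_direct_limits F -> F X -> F L].
Proof.
move=> I0 dir hid hcomp.
have [|Z ZE] := @smod_exists _ (I -> X : lmodType A)
    (fun p => exists k, forall j, (k <= j)%O -> p j = 0).
  split=> [|a p q [k pk] [l ql]]; first by case: I0 => i; exists i.
  have [m [km lm]] := dir k l; exists m => j mj.
  change (a *: p j + q j = 0); rewrite pk ?ql ?scaler0 ?addr0 //.
    exact: le_trans lm mj.
  exact: le_trans km mj.
have [q [qsurj qZ]] := quotient_map Z.
have qP p : q p = 0 <-> exists k, forall j, (k <= j)%O -> p j = 0 by rewrite qZ ZE.
have qeq p p' k : (forall j, (k <= j)%O -> p j = p' j) -> q p = q p'.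
  move=> pp'; apply/subr0_eq; rewrite -linearB; apply/qP; exists k => j kj.
  by change (p j - p' j = 0); rewrite pp' // subrr.
pose w i x : I -> X := fun j => if (i <= j)%O then h i j x else 0.
have wlin i a x y : q (w i (a *: x + y)) = a *: q (w i x) + q (w i y).
  rewrite -linearP; apply: (qeq _ _ i) => j ij.
  by change (w i (a *: x + y) j = a *: w i x j + w i y j); rewrite /w ij linearP.
have wh i j x : (i <= j)%O -> q (w j (h i j x)) = q (w i x).
  move=> ij; apply: (qeq _ _ j) => k jk; rewrite /w jk (le_trans ij jk).
  exact: hcomp.
have [|K KE] := @smod_exists _ (quotm Z) (fun v => exists i x, v = q (w i x)).
  split=> [|a v v' [i [x ->]] [j [y ->]]].
    case: I0 => i; exists i, 0; apply/esym/qP; exists i => j ij.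
    by rewrite /w ij linear0.
  have [k [ik jk]] := dir i j; exists k, (a *: h i k x + h j k y).
  by rewrite wlin !wh.
have mk i x : exists b : submod (smod_mem K), val b = q (w i x).
  by apply: submod_exists; apply/smod_memP; rewrite KE; exists i, x.
have uex i : exists u : {linear X -> submod (smod_mem K)}, forall x, val (u x) = q (w i x).
  apply: (@linear_of_relation _ X (submod (smod_mem K))
    (fun x b => val b = q (w i x))) => [a x b x' b' vb vb'|x|b vb].
  - by rewrite submod_valP vb vb' wlin.
  - exact: mk.
  - apply: val_inj; rewrite vb linear0; apply/qP; exists i => j ij.
    by rewrite /w ij linear0.
have [u uE] := choice uex.
have cu i j : (i <= j)%O -> u j \o h i j =1 u i.
  by move=> ij x; apply: val_inj; rewrite /= !uE wh.
have su b : exists i x, b = u i x.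
  have /smod_memP := valP b; rewrite KE => -[i [x bE]].
  by exists i, x; apply: val_inj; rewrite uE.
have ku i x : u i x = 0 -> exists2 j, (i <= j)%O & h i j x = 0.
  move=> ux; have /qP[k wk] : q (w i x) = 0 by rewrite -uE ux linear0.
  have [m [im km]] := dir i k; exists m => //.
  by have := wk m km; rewrite /w im.
exists (submod (smod_mem K)), u; split=> // F Flim FX.
have dsys : direct_system (fun i j (_ : (i <= j)%O) => h i j).
  by split=> // i j k ij jk _; exact: hcomp.
apply: (Flim _ I (fun=> X) (fun i j _ => h i j) _ u dsys) => //.
apply: direct_limit_criterion => //.
by move=> i x /ku[j ij hx]; exists j, ij.
Qed.

(** Z is the direct limit of X -> X -> ... with every map equal to the idempotent i p. *)
Lemma closed_retract F X Z (i : {linear Z -> X}) (p : {linear X -> Z}) :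
  closed_under_direct_limits F -> (forall z, p (i z) = z) -> F X -> F Z.
Proof.
move=> Flim pi FX.
pose f (m n : nat) (_ : (m <= n)%O) : {linear X -> X} :=
  if m == n then (idfun : {linear X -> X}) else (i \o p : {linear X -> X}).
have pf m n mn x : p (f m n mn x) = p x by rewrite /f; case: (m == n) => //=.
have dsys : direct_system f.
  split; first exact: (inhabits 0%N).
  - by move=> m n; exists (maxn m n); rewrite leEnat leq_maxl leq_maxr.
  - by move=> m mm x; rewrite /f eqxx.
  - move=> l m n lm mn ln x /=; rewrite /f; case: (eqVneq l m) => [->//|nlm].
    have -> : (l == n) = false.
      apply/negP => /eqP ln'; case/negP: nlm; rewrite eq_le lm /=.
      by rewrite ln' in lm *.
    by case: (m == n) => //=; rewrite pi.
apply: (Flim _ nat (fun=> X) f _ (fun=> p) dsys) => //.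
apply: direct_limit_criterion => //.
- by move=> z; exists 0%N, (i z).
- move=> m x px; exists m.+1; exists (leqnSn m).
  rewrite /f; case: eqP => [/eqP|_ /=]; last by rewrite px linear0.
  by rewrite ltn_eqF.
Qed.

(** V/U is the direct limit of the V/N, with the members N of K ordered by inclusion. *)
Lemma closed_directed_union F V (U : smod V) (K : smod V -> Prop) :
  closed_under_direct_limits F -> (exists N, K N) ->
  (forall N N', K N -> K N' -> exists M, [/\ K M, forall x, N x -> M x
     & forall x, N' x -> M x]) ->
  (forall x, U x <-> exists2 N, K N & N x) ->
  (forall N, K N -> F (quotm N)) -> F (quotm U).
Proof.
move=> Flim [N0 KN0] dir UE FK.
pose T := {N | K N}.
pose R (x y : T) := forall v, sval x v -> sval y v.
have Rrefl x : R x x by [].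
have Ranti x y : R x y -> R y x -> x = y.
  case: x y => [x Kx] [y Ky] xy yx.
  have xyE : x = y by apply: smod_eq => v; split; [exact: xy|exact: yx].
  by subst y; rewrite (Prop_irrelevance Kx Ky).
have Rtrans x y z : R x y -> R y z -> R x z by move=> xy yz v /xy/yz.
pose I := rel_order Rrefl Ranti Rtrans.
have [q qP] : exists q : forall N : smod V, {linear V -> quotm N},
    forall N, (forall x, exists v, q N v = x) /\ forall v, q N v = 0 <-> N v.
  exact: (choice_dep (fun N => quotient_map N)).
have map_ex (N M : smod V) : (forall v, N v -> M v) ->
    exists g : {linear quotm N -> quotm M}, forall v, g (q N v) = q M v.
  move=> LM; pose Q w y := exists v, w = q N v /\ y = q M v.
  have Qlin a x y x' y' : Q x y -> Q x' y' -> Q (a *: x + x') (a *: y + y').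
    by move=> [v [-> ->]] [v' [-> ->]]; exists (a *: v + v'); rewrite !linearP.
  have Q0 y : Q 0 y -> y = 0.
    by move=> [v [/esym/(qP N).2/LM/(qP M).2 qv ->]].
  have [|g gQ] := linear_of_relation Qlin _ Q0.
    by move=> w; have [v <-] := (qP N).1 w; exists (q M v), v.
  exists g => v; apply: (linear_relation_functional Qlin Q0 (gQ _)).
  by exists v.
have fex (i j : I) : exists g : {linear quotm (sval i) -> quotm (sval j)},
    (i <= j)%O -> forall v, g (q _ v) = q _ v.
  have [/asboolP ij|nij] := boolP (i <= j)%O.
    by have [g gE] := map_ex _ _ ij; exists g.
  by exists \0.
have [f fE] : exists f : forall i j : I, {linear quotm (sval i) -> quotm (sval j)},
    forall i j, (i <= j)%O -> forall v, f i j (q _ v) = q _ v.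
  by have [f fE] := choice_dep (fun i => choice_dep (fex i)); exists f.
have uex (i : I) : exists g : {linear quotm (sval i) -> quotm U},
    forall v, g (q _ v) = q U v.
  by apply: map_ex => v iv; apply/UE; exists (sval i) => //; exact: (svalP i).
have [u uE] := choice_dep uex.
have dsys : direct_system (fun i j (_ : (i <= j)%O) => f i j).
  split; first by exists; exists N0.
  - move=> [x Kx] [y Ky]; have [M [KM xM yM]] := dir x y Kx Ky.
    by exists (exist _ M KM); split; apply/asboolP.
  - by move=> i ii w; have [v <-] := (qP (sval i)).1 w; rewrite fE.
  - move=> i j k ij jk ik w; have [v <-] := (qP (sval i)).1 w.
    by rewrite /= !fE.
apply: (Flim _ I (fun i => quotm (sval i)) _ _ u dsys).
  by move=> i; apply/FK/(svalP i).
apply: direct_limit_criterion => //.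
- by move=> i j ij w; have [v <-] := (qP (sval i)).1 w; rewrite /= fE // !uE.
- move=> w; have [v <-] := (qP U).1 w.
  by exists (exist _ N0 KN0), (q _ v); rewrite uE.
- move=> i w; have [v <-] := (qP (sval i)).1 w.
  rewrite uE => /(qP U).2/UE[N KN Lv].
  have [M [KM iM LM]] := dir _ _ (svalP i) KN.
  have ij : (i <= (exist _ M KM : I))%O by apply/asboolP.
  exists (exist _ M KM), ij; rewrite fE //; apply/(qP M).2; exact: LM.
Qed.

End Limits.

(** * Cocones over chains of pairs *)

Section PairCocones.
Variables (A : pzRingType) (X : lmodType A) (F : lmodType A -> Prop).
Hypothesis Flim : closed_under_direct_limits F.
Hypothesis FX : F X.
Hypothesis extX : forall L, F L -> Ext1_eq0 L X.
Local Notation S := (lmodEnd X).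

Section Chain.
Variables (disp : Order.disp_t) (I : porderType disp) (h k : I -> I -> S) (a b : I -> S).
Hypothesis I0 : inhabited I.
Hypothesis dir : forall i j : I, exists k : I, (i <= k)%O /\ (j <= k)%O.
Hypotheses (hid : forall i, h i i = 1) (kid : forall i, k i i = 1).
Hypothesis hcomp : forall i j l, (i <= j)%O -> (j <= l)%O -> h j l * h i j = h i l.
Hypothesis kcomp : forall i j l, (i <= j)%O -> (j <= l)%O -> k j l * k i j = k i l.
Hypothesis ha : forall i j, (i <= j)%O -> h i j * a i = a j.
Hypothesis kb : forall i j, (i <= j)%O -> k i j * b i = b j.
Hypothesis ab : forall i, a i + b i = 1.

Let abE i z : a i z + b i z = z.
Proof. by have := congr1 (fun f : S => f z) (ab i). Qed.

Let baC i : b i * a i = a i * b i.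
Proof.
have -> : b i = 1 - a i by rewrite -(ab i); nc.
by nc.
Qed.

(** The map between the right-hand terms of the sequences of the pairs i and j that is compatible
    with h and k on the middle terms; see [dE]. *)
Let d i j : S := b j * h i j + a j * k i j.

Let db i j : (i <= j)%O -> d i j * b i = b j * h i j.
Proof.
move=> ij; have bE : b i = 1 - a i by rewrite -(ab i); nc.
have -> : d i j * b i = b j * h i j * b i + a j * (k i j * b i) by rewrite /d; nc.
rewrite kb // {1}bE -baC.
have -> : b j * h i j * (1 - a i) = b j * h i j - b j * (h i j * a i) by nc.
by rewrite ha // subrK.
Qed.

Let da i j : (i <= j)%O -> d i j * a i = a j * k i j.
Proof.
move=> ij; have aE : a i = 1 - b i by rewrite -(ab i); nc.
have -> : d i j * a i = b j * (h i j * a i) + a j * k i j * a i by rewrite /d; nc.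
rewrite ha // {1}aE baC.
have -> : a j * k i j * (1 - b i) = a j * k i j - a j * (k i j * b i) by nc.
by rewrite kb // addrC subrK.
Qed.

Let dE i j x y : (i <= j)%O ->
  d i j (b i x - a i y) = b j (h i j x) - a j (k i j y).
Proof.
move=> ij; rewrite linearB.
have /= -> := congr1 (fun f : S => f x) (db ij).
by have /= -> := congr1 (fun f : S => f y) (da ij).
Qed.

Let did i : d i i = 1.
Proof. by rewrite /d hid kid !mulr1 addrC. Qed.

Let dcomp i j l : (i <= j)%O -> (j <= l)%O -> d j l * d i j = d i l.
Proof.
move=> ij jl; rewrite {2}/d mulrDr !mulrA db // da // -!mulrA.
by rewrite hcomp // kcomp.
Qed.

(** u i and v i are the components, at stage i, of a retraction r of c : X -> La x Lb; the last
    clause says that r c is the identity. *)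
Lemma constant_chain_cocone : exists u v : I -> S,
  [/\ forall i j, (i <= j)%O -> u j * h i j = u i,
      forall i j, (i <= j)%O -> v j * k i j = v i
    & forall i, u i * a i + v i * b i = 1].
Proof.
have mapE (f g l : S) : f * g = l -> forall z, f (g z) = l z by move=> <-.
have [La [ua [ca sa na _]]] := constant_direct_limit I0 dir
  (fun i z => congr1 (fun f : S => f z) (hid i))
  (fun i j l ij jl z => congr1 (fun f : S => f z) (hcomp ij jl)).
have [Lb [ub [cb sb nb _]]] := constant_direct_limit I0 dir
  (fun i z => congr1 (fun f : S => f z) (kid i))
  (fun i j l ij jl z => congr1 (fun f : S => f z) (kcomp ij jl)).
have [Ld [ud [cd sd nd Fd]]] := constant_direct_limit I0 dir
  (fun i z => congr1 (fun f : S => f z) (did i))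
  (fun i j l ij jl z => congr1 (fun f : S => f z) (dcomp ij jl)).
pose R (w : La * Lb) z := exists i x y,
  [/\ w = (ua i x, ub i y) & z = ud i (b i x - a i y)].
have Rup i j x y : (i <= j)%O ->
    [/\ ua i x = ua j (h i j x), ub i y = ub j (k i j y)
      & ud i (b i x - a i y) = ud j (b j (h i j x) - a j (k i j y))].
  move=> ij; have /= -> := ca i j ij x; have /= -> := cb i j ij y.
  by rewrite -dE //; have /= -> := cd i j ij (b i x - a i y).
have Rlin c x y x' y' : R x y -> R x' y' -> R (c *: x + x') (c *: y + y').
  move=> [i [z [z' [-> ->]]]] [j [w [w' [-> ->]]]]; have [l [il jl]] := dir i j.
  have [-> -> ->] := Rup i l z z' il; have [-> -> ->] := Rup j l w w' jl.
  exists l, (c *: h i l z + h j l w), (c *: k i l z' + k j l w').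
  split; first by congr pair; rewrite /= linearP.
  rewrite -linearP; congr (ud l _).
  by rewrite [b l (_ + _)]linearP [a l (_ + _)]linearP scalerBr opprD addrACA.
have R0 z : R 0 z -> z = 0.
  move=> [i [x [y [[/esym/na[j1 ij1 hx] /esym/nb[j2 ij2 ky]] ->]]]].
  have [l [j1l j2l]] := dir j1 j2.
  have [_ _ ->] := Rup i l x y (le_trans ij1 j1l).
  rewrite -(mapE _ _ _ (hcomp ij1 j1l)) hx -(mapE _ _ _ (kcomp ij2 j2l)) ky.
  by rewrite !linear0 addr0 linear0.
have Rtot w : exists z, R w z.
  case: w => w w'; have [i [x ->]] := sa w; have [j [y ->]] := sb w'.
  have [l [il jl]] := dir i j.
  have [-> _ _] := Rup i l x 0 il; have [_ -> _] := Rup j l 0 y jl.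
  by eexists; exists l, (h i l x), (k j l y).
have [q qR] := linear_of_relation Rlin Rtot R0.
have qE i x y : q (ua i x, ub i y) = ud i (b i x - a i y).
  by apply: (linear_relation_functional Rlin R0 (qR _)); exists i, x, y.
case: (I0) => i0.
have [|c cE] := @linear_bundle _ X (La * Lb)%type (fun z => (ua i0 (a i0 z), ub i0 (b i0 z))).
  by move=> r x y; rewrite !linearP.
have cup i z : c z = (ua i (a i z), ub i (b i z)).
  have [l [il i0l]] := dir i i0; rewrite cE.
  have [-> -> _] := Rup i0 l (a i0 z) (b i0 z) i0l.
  have [-> -> _] := Rup i l (a i z) (b i z) il.
  by rewrite !(mapE _ _ _ (ha _)) // !(mapE _ _ _ (kb _)).
have seq : short_exact c q.
  split.
  - apply: linear_eq0_inj => z; rewrite (cup i0) => -[/na[j1 ij1 hx] /nb[j2 ij2 ky]].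
    have [l [j1l j2l]] := dir j1 j2; rewrite -(abE l z).
    rewrite -(mapE _ _ _ (ha (le_trans ij1 j1l))) -(mapE _ _ _ (hcomp ij1 j1l)) hx.
    rewrite -(mapE _ _ _ (kb (le_trans ij2 j2l))) -(mapE _ _ _ (kcomp ij2 j2l)) ky.
    by rewrite !linear0 addr0.
  - move=> w; have [i [z ->]] := sd w; exists (ua i z, ub i (- z)).
    by rewrite qE linearN opprK addrC abE.
  - move=> [w w']; split; last first.
      move=> [z ->]; rewrite (cup i0) qE (mapE _ _ _ (baC i0)) subrr; exact: linear0.
    have [i [x [y [-> qz]]]] := qR (w, w'); rewrite qz => /nd[j ij].
    rewrite dE // => /subr0_eq bha; exists (h i j x + k i j y); rewrite (cup j).
    have [-> -> _] := Rup i j x y ij; congr (ua j _, ub j _).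
      by rewrite linearD -bha abE.
    by rewrite linearD bha abE.
have [r rc] := Ext1_retraction (extX (Fd F Flim FX)) seq.
have uex i : exists u : S, forall x, u x = r (ua i x, 0).
  have [|u uE] := @linear_bundle _ X X (fun x => r (ua i x, 0)).
    by move=> s x y; rewrite -linearP; congr (r (_, _)); rewrite /= ?linearP // scaler0 addr0.
  by exists u.
have vex i : exists u : S, forall x, u x = r (0, ub i x).
  have [|u uE] := @linear_bundle _ X X (fun x => r (0, ub i x)).
    by move=> s x y; rewrite -linearP; congr (r (_, _)); rewrite /= ?linearP // scaler0 addr0.
  by exists u.
have [u uE] := choice uex; have [v vE] := choice vex.
exists u, v; split=> [i j ij|i j ij|i]; apply: lmodEnd_ext => x.
- by rewrite lmodEndM !uE; have /= -> := ca i j ij x.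
- by rewrite lmodEndM !vE; have /= -> := cb i j ij x.
change (u i (a i x) + v i (b i x) = x).
rewrite uE vE -linearD -[RHS]rc (cup i); congr (r (_, _)); first exact: addr0.
exact: add0r.
Qed.

End Chain.

Theorem pair_cocones : chain_cocones (@pair_mul A X) (@pair_sum1 A X).
Proof.
move=> D lt x t D0 irr ltT ltot Ox tx tt.
pose R i j := i = j \/ lt i j.
have Rrefl i : R i i by left.
have Ranti i j : R i j -> R j i -> i = j.
  by move=> [//|ij] [//|ji]; case: (irr i); exact: ltT ji.
have Rtrans i j l : R i j -> R j l -> R i l.
  by move=> [->//|ij] [<-|jl]; right => //; exact: ltT jl.
pose I := rel_order Rrefl Ranti Rtrans.
(* The given arrows are constrained only for distinct indices; the diagonal is filled with
   identities. *)
pose T (i j : I) : S * S := if pselect (i = j) then (1, 1) else t i j.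
have TE (i j : I) : lt i j -> T i j = t i j.
  move=> ij; rewrite /T; case: pselect => // e.
  by case: (irr j); rewrite -{1}e.
have Tid (i : I) : T i i = (1, 1) by rewrite /T; case: pselect.
have leP (i j : I) : (i <= j)%O -> i = j \/ lt i j by move=> /asboolP.
have m1 z : pair_mul (1, 1) z = z :> S * S by case: z => z z'; rewrite /pair_mul !mul1r.
have m2 z : pair_mul z (1, 1) = z :> S * S by case: z => z z'; rewrite /pair_mul !mulr1.
have Tx (i j : I) : (i <= j)%O -> pair_mul (T i j) (x i) = x j.
  by case/leP=> [->|ij]; rewrite ?Tid ?m1 // TE // tx.
have Tcomp (i j l : I) : (i <= j)%O -> (j <= l)%O -> pair_mul (T j l) (T i j) = T i l.
  case/leP=> [->|ij]; first by rewrite Tid m2.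
  case/leP=> [<-|jl]; first by rewrite Tid m1.
  by rewrite !TE ?tt //; exact: ltT jl.
have [||||||||u [v [uh vk uv]]] := @constant_chain_cocone _ I
    (fun i j => (T i j).1) (fun i j => (T i j).2) (fun i => (x i).1) (fun i => (x i).2) D0.
- move=> i j; have [ij|->|ji] := ltot i j.
  + by exists j; split; apply/asboolP; [right|left].
  + by exists j; split; apply/asboolP; left.
  + by exists i; split; apply/asboolP; [left|right].
- by move=> i; rewrite Tid.
- by move=> i; rewrite Tid.
- by move=> i j l ij jl; exact: (congr1 fst (Tcomp i j l ij jl)).
- by move=> i j l ij jl; exact: (congr1 snd (Tcomp i j l ij jl)).
- by move=> i j ij; exact: (congr1 fst (Tx i j ij)).
- by move=> i j ij; exact: (congr1 snd (Tx i j ij)).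
- by move=> i; exact: Ox.
have uT (i j : I) : lt i j -> pair_mul (u j, v j) (t i j) = (u i, v i).
  move=> ij; have le_ij : (i <= j)%O by apply/asboolP; right.
  by rewrite -TE // /pair_mul /= uh // vk.
have ux (i j : I) : lt i j -> pair_mul (u j, v j) (x j) = pair_mul (u i, v i) (x i).
  by move=> ij; rewrite -(tx i j ij) pair_mul_assoc uT.
have [i0] := D0.
exists (pair_mul (u i0, v i0) (x i0)), (fun i => (u i, v i)); split.
- exact: uv.
- by move=> i; have [/ux|->|/ux] := ltot i i0.
- exact: uT.
Qed.

End PairCocones.

(** * The endomorphism ring modulo its radical *)

Section EndomorphismRing.
Variables (A : pzRingType) (X : lmodType A) (F : lmodType A -> Prop).
Hypothesis Flim : closed_under_direct_limits F.
Hypothesis FX : F X.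
Hypothesis extX : forall L, F L -> Ext1_eq0 L X.
Local Notation S := (lmodEnd X).
Local Notation "'π' x" := (\pi_(jacobson_quot S) x) (at level 8, x at level 2).

(** Some 1 - x a has no left inverse. The idempotent attached to the pair (x a, 1 - x a) lies in S
    a; were it 0, then al = 0, and 1 = be would be a left multiple of 1 - x a. *)
Lemma End_semipotent (a : S) : a \notin @jacobson S ->
  exists y g : S, [/\ g = y * a, g * g = g & g != 0].
Proof.
move=> Ja.
have [x nx] : exists x, ~ exists z, z * (1 - x * a) = 1.
  apply: contrapT => nx; case/negP: Ja; apply: jacobson_char => y.
  by apply: contrapT => ny; apply: nx; exists y.
have [|al [be [e [ya [yb [y [[alE beE ab1] [ee eE eal]]]]]]]] :=
  pair_idempotent (pair_cocones Flim FX extX) (a := x * a) (b := 1 - x * a).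
  by rewrite addrC subrK.
exists (y * ya * x), e; split=> //; first by rewrite eE alE !mulrA.
apply/eqP => e0; apply: nx; exists yb.
by rewrite -beE -ab1 -eal e0 mul0r add0r.
Qed.

(** Modulo the radical al f = al and be f = 0, so f = (al + be) f = al. As e lies in S al and e al =
    al, also e = e f = e al = f. *)
Theorem End_idempotents_lift : idempotents_lift_mod_jacobson S.
Proof.
move=> t; rewrite -[t]reprK; set f := repr t => ff.
have [|al [be [e [ya [yb [y [[alE beE ab1] [ee eE eal]]]]]]]] :=
  pair_idempotent (pair_cocones Flim FX extX) (a := f) (b := 1 - f).
  by rewrite addrC subrK.
exists e; split=> //.
have alf : π al * π f = π al by rewrite alE jpiM -mulrA ff.
have bef : π be * π f = 0 by rewrite beE jpiM -mulrA jpiB mulrBl mul1r ff subrr mulr0.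
have ef : π e * π f = π e by rewrite eE jpiM -mulrA alf.
have falE : π f = π al.
  by rewrite -[LHS]mul1r -[1]/(π 1) -ab1 pi_jquotD mulrDl alf bef addr0.
by rewrite -ef falE -jpiM eal.
Qed.

Definition generated (B : X -> Prop) : smod X :=
  @Smod A X (fun x => forall L : smod X, (forall y, B y -> L y) -> L x)
    (conj (fun L _ => (smodP L).1)
      (fun a x y hx hy L BL => (smodP L).2 a x y (hx L BL) (hy L BL))).

Lemma generated_in (B : X -> Prop) x : B x -> generated B x.
Proof. by move=> Bx L; apply. Qed.

Lemma generated_eq (B : X -> Prop) (f g : S) :
  (forall x, B x -> f x = g x) -> forall x, generated B x -> f x = g x.
Proof.
move=> fg x; have [|L LE] := @smod_exists _ X (fun x => f x = g x).
  by split=> [|a y z fy fz]; rewrite ?linear0 // !linearP fy fz.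
by move/(_ L); rewrite LE; apply=> y By; rewrite LE; exact: fg.
Qed.

Lemma smod_sum (L : smod X) (I : eqType) (r : seq I) (f : I -> X) :
  (forall i, i \in r -> L (f i)) -> L (\sum_(i <- r) f i).
Proof.
have [L0 LZ] := smodP L; elim: r => [|i r IH] Lf; first by rewrite big_nil.
rewrite big_cons -[f i]scale1r; apply: LZ; first exact: Lf (mem_head _ _).
by apply: IH => j jr; apply: Lf; rewrite inE jr orbT.
Qed.

Lemma lmodEnd_sumE (I : Type) (r : seq I) (f : I -> S) x :
  (\sum_(i <- r) f i) x = \sum_(i <- r) f i x.
Proof.
by elim: r => [|i r IH]; rewrite ?big_nil // !big_cons -IH.
Qed.

(** 1 - p embeds X/L in X, with the quotient map as retraction. *)
Lemma closed_quotient_idempotent (L : smod X) (p : S) :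
  (forall x, L (p x)) -> (forall x, L x -> p x = x) -> F (quotm L).
Proof.
move=> Lp pL; have [q [qsurj qker]] := quotient_map L.
pose R w y := exists x, w = q x /\ y = x - p x.
have Rlin a x y x' y' : R x y -> R x' y' -> R (a *: x + x') (a *: y + y').
  move=> [z [-> ->]] [z' [-> ->]]; exists (a *: z + z').
  split; first by rewrite linearP.
  by rewrite [p (_ + _)]linearP scalerBr opprD addrACA.
have [||i iR] := linear_of_relation Rlin.
- by move=> w; have [x <-] := qsurj w; exists (x - p x), x.
- by move=> y [x [/esym/qker/pL px ->]]; rewrite px subrr.
apply: (closed_retract Flim (i := i) (p := q)) => // w.
have [x [-> ->]] := iR w; rewrite linearB -[RHS]subr0; congr (_ - _).
exact/qker.
Qed.

Section Families.
Variable a : S.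
Implicit Types (E : set S) (s : seq S).

(** For idempotents e this says that a maps the external direct sum of the e X injectively to X,
    each finite partial sum having a direct summand of X as image. *)
Definition independent E : Prop :=
  forall s, (forall e, e \in s -> E e) -> exists y : S -> S,
    forall e e', e \in s -> e' \in s -> y e * (a * e') = if e == e' then e' else 0.

Lemma independent_sum (s : seq S) (y tau : S -> S) e :
  (forall e e', e \in s -> e' \in s -> y e * (a * e') = if e == e' then e' else 0) ->
  e \in s -> (\sum_(e' <- undup s) tau e' * y e') * (a * e) = tau e * e.
Proof.
move=> yP es; rewrite mulr_suml (bigD1_seq e) ?undup_uniq ?mem_undup //=.
rewrite -mulrA yP // eqxx big_seq_cond big1 ?addr0 // => e' /andP[].
by rewrite mem_undup => e's /negPf ne; rewrite -mulrA yP // ne mulr0.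
Qed.

(** On finite subfamilies the sums of tau e y e do it, and they agree on the union U of the finite
    sums of the a e X. X/U lies in F as a direct limit of quotients by summands, so the map on U
    extends to X. *)
Lemma independent_extend E (tau : S -> S) :
  (forall e, E e -> e * e = e) -> independent E ->
  exists z : S, forall e, E e -> z * (a * e) = tau e * e.
Proof.
move=> idE indE.
pose B s x := exists e v, e \in s /\ x = a (e v).
pose U := generated (fun x => exists e v, E e /\ x = a (e v)).
pose sub s := forall e, e \in s -> E e.
have subU s s' : sub s -> sub s' -> sub (s ++ s').
  by move=> sE s'E e; rewrite mem_cat => /orP[/sE|/s'E].
have gen_mono s s' : (forall e, e \in s -> e \in s') ->
    forall x, generated (B s) x -> generated (B s') x.
  move=> ss' x gx L BL; apply: gx => y [e [v [es ->]]].
  by apply: BL; exists e, v; split=> //; exact: ss'.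
have genl s s' x : generated (B s) x -> generated (B (s ++ s')) x.
  by apply: gen_mono => e es; rewrite mem_cat es.
have genr s s' x : generated (B s') x -> generated (B (s ++ s')) x.
  by apply: gen_mono => e es; rewrite mem_cat es orbT.
have UP x : U x <-> exists2 s, sub s & generated (B s) x.
  split=> [Ux|[s sE gx] L BL]; last first.
    by apply: gx => y [e [v [/sE Ee ->]]]; apply: BL; exists e, v.
  have [|L LE] := @smod_exists _ X (fun x => exists2 s, sub s & generated (B s) x).
    split; first by exists [::] => // L _; exact: (smodP L).1.
    move=> c y z [s sE gy] [s' s'E gz]; exists (s ++ s'); first exact: subU.
    by apply: (smodP _).2; [exact: genl|exact: genr].
  have := Ux L; rewrite LE; apply=> y [e [v [Ee ->]]]; rewrite LE.
  exists [:: e]; first by move=> e'; rewrite inE => /eqP ->.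
  by apply: generated_in; exists e, v; rewrite inE eqxx.
have psi_ex s : sub s -> exists psi : S, forall e, e \in s -> psi * (a * e) = tau e * e.
  move=> /indE[y yP]; exists (\sum_(e' <- undup s) tau e' * y e') => e es.
  exact: independent_sum.
pose R x z := exists s psi, [/\ sub s, forall e, e \in s -> psi * (a * e) = tau e * e,
  generated (B s) x & z = psi x].
have Runiq s s' (psi psi' : S) x : (forall e, e \in s -> e \in s') ->
    (forall e, e \in s -> psi * (a * e) = tau e * e) ->
    (forall e, e \in s' -> psi' * (a * e) = tau e * e) ->
    generated (B s) x -> psi x = psi' x.
  move=> ss' p1 p2; apply: generated_eq => _ [e [v [es ->]]].
  have h : psi * (a * e) = psi' * (a * e) by rewrite p1 // p2 //; exact: ss'.
  exact: (congr1 (fun f : S => f v) h).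
have FU : F (quotm U).
  apply: (closed_directed_union (K := fun L => exists2 s, sub s & L = generated (B s))) => //.
  - by exists (generated (B [::])); exists [::].
  - move=> _ _ [s sE ->] [s' s'E ->]; exists (generated (B (s ++ s'))); split.
    + by exists (s ++ s') => //; exact: subU.
    + exact: genl.
    + exact: genr.
  - move=> x; rewrite UP; split=> [[s sE gx]|[_ [s sE ->] gx]]; last by exists s.
    by exists (generated (B s)) => //; exists s.
  - move=> _ [s sE ->]; have [y yP] := indE s sE.
    pose p : S := \sum_(e <- undup s) a * e * y e.
    have pE e : e \in s -> p * (a * e) = a * e.
      by move=> es; rewrite (independent_sum (fun e => a * e) yP es) -mulrA idE //; exact: sE.
    apply: (closed_quotient_idempotent (p := p)) => x.
      rewrite lmodEnd_sumE; apply: smod_sum => e; rewrite mem_undup => es.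
      by apply: generated_in; exists e, (y e x).
    apply: (@generated_eq _ p 1) => _ [e [v [es ->]]].
    exact: (congr1 (fun f : S => f v) (pE e es)).
have [q [qsurj qker]] := quotient_map U.
have [||||z zP] := Ext1_extend (extX FU) (q := q) (R := R).
- exact: qsurj.
- move=> c x z x' z' [s [psi [sE pE gx ->]]] [s' [psi' [s'E p'E gx' ->]]].
  have [psi2 p2E] := psi_ex (s ++ s') (subU _ _ sE s'E).
  exists (s ++ s'), psi2; split=> //.
  + exact: subU.
  + by apply: (smodP _).2; [exact: genl|exact: genr].
  rewrite linearP; congr (c *: _ + _).
    by apply: (Runiq s (s ++ s')) gx => // e es; rewrite mem_cat es.
  by apply: (Runiq s' (s ++ s')) gx' => // e es; rewrite mem_cat es orbT.
- by move=> z [s [psi [_ _ _ ->]]]; rewrite linear0.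
- move=> x; rewrite qker UP; split=> [[s sE gx]|[z [s [psi [sE _ gx _]]]]]; last by exists s.
  by have [psi pE] := psi_ex s sE; exists (psi x), s, psi.
exists z => e Ee; apply: lmodEnd_ext => v; apply: zP.
have [|psi pE] := psi_ex [:: e].
  by move=> e'; rewrite inE => /eqP ->.
exists [:: e], psi; split=> //.
- by move=> e'; rewrite inE => /eqP ->.
- by apply: generated_in; exists e, v; rewrite inE eqxx.
by have := congr1 (fun f : S => f v) (pE e (mem_head _ _)).
Qed.

Lemma maximal_independent (B : S -> Prop) : exists E,
  [/\ forall e, E e -> B e, forall e, E e -> e * e = e, independent E
    & forall g, B g -> g * g = g ->
      (forall s, (forall e, e \in s -> E e) -> exists2 y,
         y * (a * g) = g & forall e, e \in s -> y * (a * e) = 0) -> E g].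
Proof.
pose P E := [/\ forall e, E e -> B e, forall e, E e -> e * e = e & independent E].
have [||E [[EB Eid Eind] _ Emax]] := @zorn_set S P set0.
- by split=> // s sE; exists (fun=> 0) => e e' /sE.
- move=> H [E0 HE0] HP tot; split.
  + by move=> e [E /HP[+ _ _] Ee]; apply.
  + by move=> e [E /HP[_ + _] Ee]; apply.
  + move=> s sH; suff [E HE sE] : exists2 E, H E & forall e, e \in s -> E e.
      by have [_ _] := HP _ HE; apply.
    elim: s sH => [|e s IH] sH; first by exists E0.
    have [|E HE sE] := IH; first by move=> e' e's; apply: sH; rewrite inE e's orbT.
    have [E' HE' E'e] := sH e (mem_head _ _).
    case: (tot E E' HE HE') => h.
      by exists E' => // e'; rewrite inE => /orP[/eqP ->//|/sE/h].
    by exists E => // e'; rewrite inE => /orP[/eqP ->|/sE//]; exact: h.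
exists E; split=> // g Bg gg gE.
pose E' e := E e \/ e = g.
suff /Emax/(_ _ g) : P E' by apply; [move=> e; left|right].
split.
- by move=> e [/EB|->].
- by move=> e [/Eid|->].
move=> s sE'; pose s1 := [seq e <- s | e != g].
have s1E e : e \in s1 -> E e.
  by rewrite mem_filter => /andP[/eqP ne /sE'[]].
have [y yP] := Eind s1 s1E; have [y0 y0g y0e] := gE s1 s1E.
(* Subtracting y e a g y0 makes y e kill a g; its values at the other a e' are kept because y0 kills
   those. *)
exists (fun e => if e == g then y0 else y e - y e * (a * g) * y0) => e e' es e's.
have [eg|neg] := eqVneq e g; have [e'g|ne'g] := eqVneq e' g.
- by rewrite eg e'g eqxx.
- by rewrite eg eq_sym (negPf ne'g) y0e // mem_filter ne'g.
- rewrite e'g (negPf neg).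
  have -> : (y e - y e * (a * g) * y0) * (a * g) =
    y e * (a * g) - y e * (a * (g * (y0 * (a * g)))) by nc.
  by rewrite y0g gg subrr.
- rewrite mulrBl -[_ * y0 * _]mulrA y0e ?mem_filter ?ne'g // mulr0 subr0.
  by rewrite yP // mem_filter ?neg ?ne'g.
Qed.

End Families.

(** Take z with z a e = e on a maximal independent family. If a - a z a were outside the radical, a
    nonzero idempotent g = y (a - a z a) would be separated from the family by y (1 - a z), hence
    belong to it; but z a g = g forces g = 0. *)
Theorem End_regular : von_neumann_regular (jacobson_quot S).
Proof.
move=> t; rewrite -[t]reprK; set a := repr t.
have [E [_ Eid Eind Emax]] := maximal_independent a (fun=> True).
have [z zE] := independent_extend (fun=> 1) Eid Eind.
exists (π z); rewrite -!jpiM; apply/jpi_eq.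
rewrite -rpredN opprB; apply: contraT => Jd.
have [y [g [gE gg /eqP g0]]] := End_semipotent Jd.
have Eg : E g.
  apply: Emax => // s sE; exists (y * (1 - a * z)).
    have -> : y * (1 - a * z) * (a * g) = y * (a - a * z * a) * g by nc.
    by rewrite -gE gg.
  move=> e /sE/zE; rewrite mul1r => zae.
  have -> : y * (1 - a * z) * (a * e) = y * a * e - y * a * (z * (a * e)) by nc.
  by rewrite zae subrr.
have zag := zE g Eg; rewrite mul1r in zag.
case: g0; rewrite -gg {1}gE.
have -> : y * (a - a * z * a) * g = y * a * g - y * a * (z * (a * g)) by nc.
by rewrite zag subrr.
Qed.

(** z represents G on a maximal independent family of idempotents with classes in the domain. A
    failure at x would produce an idempotent e0, with class in the right ideal of x, that is
    separated from the family and on which z is wrong. *)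
Theorem End_self_injective : right_self_injective (jacobson_quot S).
Proof.
move=> G [G0 GB GM] Gfun.
have Guniq x y y' : G (x, y) -> G (x, y') -> y = y'.
  by move=> Gy /(GB _ _ _ _ Gy); rewrite subrr => /Gfun/subr0_eq.
have GD x y x' y' : G (x, y) -> G (x', y') -> G (x + x', y + y').
  by move=> Gx /(GB _ _ _ _ G0); rewrite !sub0r => /(GB _ _ _ _ Gx); rewrite !opprK.
have [E [EB Eid Eind Emax]] := maximal_independent 1 (fun e => exists y, G (π e, y)).
have [tau tauP] : exists tau : S -> S, forall e, E e -> G (π e, π (tau e)).
  apply: (choice_dep (P := fun e y => E e -> G (π e, π y))) => e.
  have [Ee|nEe] := pselect (E e); last by exists 0.
  by have [y Gy] := EB e Ee; exists (repr y); rewrite reprK.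
have [z zE] := independent_extend tau Eid Eind.
have GE e : E e -> G (π e, π z * π e).
  move=> Ee; have /(congr1 (fun x => π x)) := zE e Ee; rewrite mul1r !jpiM => ->.
  by have := GM _ _ (π e) (tauP e Ee); rewrite -!jpiM Eid.
exists (π z) => x y Gxy; apply/esym/eqP; rewrite -subr_eq0; apply/negP => /negP dl0.
set dl := y - _ in dl0.
have [u dud] := End_regular dl; pose q := u * dl.
have dq : dl * q = dl by rewrite /q mulrA.
have [v xvx] := End_regular (x * q).
(* If z is right at x q r, then dl r = 0, hence q r = u dl r = 0. *)
have key r : G (x * q * r, π z * (x * q * r)) -> x * q * r = 0.
  move=> Gz; have h := GM _ _ r (GM _ _ q Gxy).
  have dqr : dl * r = 0.
    rewrite -dq; have -> : dl * q * r = y * q * r - π z * (x * q * r).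
      by rewrite /dl; nc.
    by rewrite (Guniq _ _ _ h Gz) subrr.
  by rewrite /q -!mulrA dqr !mulr0.
have [|e0 [ee0 e0E]] := End_idempotents_lift (a := x * q * v).
  by rewrite /idempotent_elt mulrA xvx.
have [] : x * q * v <> 0.
  move=> xqv0; case/eqP: dl0; rewrite -dq.
  have xq0 : x * q = 0 by rewrite -xvx xqv0 mul0r.
  have /Gfun yq : G (0, y * q) by rewrite -xq0; exact: GM.
  have -> : dl * q = y * q - π z * (x * q) by rewrite /dl; nc.
  by rewrite yq xq0 mulr0 subrr.
suff Ee0 : E e0 by rewrite -e0E; have := GE e0 Ee0; rewrite e0E => /key.
apply: Emax => //; first by exists (y * q * v); rewrite e0E; exact: (GM _ _ v (GM _ _ q Gxy)).
move=> s sE; have [yy yyP] := Eind s sE.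
pose p : S := \sum_(e <- undup s) e * yy e.
have pe e : e \in s -> p * e = e.
  move=> es; have := independent_sum (fun e => e) yyP es.
  by rewrite mul1r Eid //; exact: sE.
have Gp r : G (π p * r, π z * (π p * r)).
  have {}sE : forall e, e \in undup s -> E e by move=> e; rewrite mem_undup; exact: sE.
  rewrite /p; elim: (undup s) sE => [|e s' IH] sE.
    by rewrite big_nil (jpi_eq0 0).2 ?rpred0 // mul0r mulr0.
  have Ee : E e by apply: sE; exact: mem_head.
  rewrite big_cons pi_jquotD mulrDl mulrDr; apply: GD.
    by have := GM _ _ (π (yy e) * r) (GE e Ee); rewrite jpiM !mulrA.
  by apply: IH => e' e's; apply: sE; rewrite inE e's orbT.
(* p projects onto a finite sum of the e X, where z represents G; a multiple of e0 falling into it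
   vanishes by [key]. *)
have canc r : π ((1 - p) * e0) * r = 0 -> π e0 * r = 0.
  rewrite jpiM jpiB -mulrA mulrBl mul1r => /subr0_eq h.
  have := Gp (π e0 * r); rewrite -h e0E => Gz.
  by have := key (v * r); rewrite !mulrA in Gz *; exact.
pose c := (1 - p) * e0.
have [w cwc] := End_regular (π c).
have e0c : π e0 = π e0 * (w * π c).
  apply/eqP; rewrite -subr_eq0 -{1}[π e0]mulr1 -mulrBr; apply/eqP/canc.
  by rewrite mulrBr mulr1 mulrA cwc subrr.
(* Regularity of the quotient gives e0 = e0 w c only modulo the radical; the unit m' absorbs the
   error. *)
have Jm : e0 - e0 * repr w * c \in @jacobson S.
  by apply/jpi_eq; rewrite (jpiM (e0 * repr w) c) (jpiM e0) reprK -mulrA.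
have [m' [_ m'm]] := jacobson_invertible Jm.
exists (m' * (e0 * repr w * (1 - p))).
  have h : (1 - (e0 - e0 * repr w * c)) * e0 = e0 * repr w * c.
    have -> : (1 - (e0 - e0 * repr w * c)) * e0 = e0 - e0 * e0 + e0 * repr w * (1 - p) * (e0 * e0).
      by rewrite /c; nc.
    by rewrite ee0 subrr add0r mulrA.
  have -> : m' * (e0 * repr w * (1 - p)) * (1 * e0) = m' * (e0 * repr w * c).
    by rewrite /c; nc.
  by rewrite -h mulrA m'm mul1r.
move=> e es; have -> : m' * (e0 * repr w * (1 - p)) * (1 * e) =
    m' * (e0 * repr w) * (e - p * e) by nc.
by rewrite pe // subrr mulr0.
Qed.

End EndomorphismRing.

(** * Character modules *)

Section Divisible.
Variable D : zmodType.
Hypothesis Ddiv : forall (d : D) (n : nat), (0 < n)%N -> exists d', d' *+ n = d.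

Definition zgraph (V : zmodType) (G : set (V * D)) : Prop :=
  [/\ G (0, 0),
      forall x y x' y', G (x, y) -> G (x', y') -> G (x - x', y - y')
    & forall y, G (0, y) -> y = 0].

Lemma zgraphMz (V : zmodType) (G : set (V * D)) x y (k : int) :
  zgraph G -> G (x, y) -> G (x *~ k, y *~ k).
Proof.
move=> [G0 GB _] Gxy.
have GN a b : G (a, b) -> G (- a, - b) by move=> /(GB _ _ _ _ G0); rewrite !sub0r.
have Gn (n : nat) : G (x *+ n, y *+ n).
  elim: n => [|n IH]; first by rewrite !mulr0n.
  by have := GB _ _ _ _ IH (GN _ _ Gxy); rewrite !opprK -!mulrSr.
case: k => n; first exact: Gn.
by rewrite !NegzE !mulrNz; exact/GN/Gn.
Qed.

(** Baer's argument: a maximal partial additive map is total, since divisibility supplies a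
    compatible value at any missing v. *)
Lemma divisible_extend (V : zmodType) (G0 : set (V * D)) : zgraph G0 ->
  exists f : V -> D, (forall x y, f (x - y) = f x - f y) /\
    forall x y, G0 (x, y) -> f x = y.
Proof.
move=> zG0.
have [||G [zG G0G Gmax]] := @zorn_set (V * D) (@zgraph V) G0 => //.
  move=> F [A0 FA0] FP tot; split.
  - by exists A0 => //; have [] := FP _ FA0.
  - move=> x y x' y' Fx Fx'; have [A [FA Ax Ax']] := chain2 tot Fx Fx'.
    by exists A => //; have [_ + _] := FP _ FA; apply.
  - by move=> y [A FA Ay]; have [_ _] := FP _ FA; apply.
have [G00 GB Gfun] := zG.
have Guniq x y y' : G (x, y) -> G (x, y') -> y = y'.
  by move=> Gy /(GB _ _ _ _ Gy); rewrite subrr => /Gfun/subr0_eq.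
have Gtot v : exists y, G (v, y).
  apply: contrapT => nv.
  (* n generates the k with k v in the domain, and d is an n-th part of the value at n v. For n = 0
     no nonzero multiple of v is in the domain, and d = 0. *)
  have [n [d [n0 Gn]]] : exists (n : nat) d, [/\ (0 < n)%N \/ d = 0, G (v *+ n, d *+ n)
      & forall k : int, (exists y, G (v *~ k, y)) -> (n %| `|k|)%N].
    have [[n [n0 [y Gy]]]|none] :=
      pselect (exists n : nat, (0 < n)%N /\ exists y, G (v *+ n, y)); last first.
      exists 0%N, 0; split; [by right|by rewrite !mulr0n|].
      move=> k [y Gy]; rewrite dvd0n; apply: contrapT => /negP k0.
      apply: none; exists `|k|%N; split; first by rewrite lt0n.
      case: k Gy {k0} => m Gy; first by exists y.
      exists (- y); have := GB _ _ _ _ G00 Gy.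
      by rewrite !sub0r NegzE mulrNz opprK.
    pose p n := (0 < n)%N && `[< exists y, G (v *+ n, y) >].
    have exp : exists n, p n by exists n; rewrite /p n0; apply/asboolP; exists y.
    case: (ex_minnP exp) => m /andP[m0 /asboolP[d Gd]] mmin.
    have [d' d'E] := Ddiv d m0; exists m, d'; split; [by left|by rewrite d'E|].
    move=> k [z Gz].
    have Gr : exists y, G (v *+ (`|k| %% m)%N, y).
      have [z' Gz'] : exists y, G (v *+ `|k|%N, y).
        case: k Gz => l Gz; first by exists z.
        exists (- z); have := GB _ _ _ _ G00 Gz.
        by rewrite !sub0r NegzE mulrNz opprK.
      exists (z' - d *~ (`|k| %/ m)%N).
      have := GB _ _ _ _ Gz' (zgraphMz (`|k| %/ m)%N zG Gd).
      congr (G (_, _)); rewrite {1}(divn_eq `|k| m) addrC mulrnDr.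
      by rewrite -pmulrn -mulrnA mulnC addKr.
    rewrite /dvdn; apply: contraT; rewrite -lt0n => r0.
    have := mmin (`|k| %% m)%N; rewrite /p r0 /= => /(_ (asboolT Gr)).
    by rewrite leqNgt ltn_pmod.
  move=> ndvd.
  pose G' : set (V * D) := fun z => exists x y (k : int),
    G (x, y) /\ z = (x + v *~ k, y + d *~ k).
  have zG' : zgraph G'.
    split.
    - by exists 0, 0, 0; rewrite !mulr0z !addr0.
    - move=> x y x' y' [a [b [k [Gab [-> ->]]]]] [a' [b' [k' [Gab' [-> ->]]]]].
      exists (a - a'), (b - b'), (k - k'); split; first exact: GB.
      by rewrite !mulrzBr !opprD !(addrACA _ _ (- _)).
    - move=> y [a [b [k [Gab [/esym av ->]]]]].
      have aE : a = v *~ (- k) by rewrite mulrNz; apply/eqP; rewrite -addr_eq0 av.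
      have /ndvd : exists y, G (v *~ (- k), y) by exists b; rewrite -aE.
      rewrite abszN => /dvdnP[q kq].
      have [l kE] : exists l : int, k = n%:Z * l.
        case: k kq {aE av} => m /= mE; first by exists q%:Z; rewrite mE mulnC.
        by exists (- q%:Z); rewrite NegzE mE mulnC mulrN.
      have := zgraphMz (- l) zG Gn; rewrite !pmulrn -!mulrzA mulrN -kE -aE.
      move=> /(Guniq _ _ _ Gab) ->; by rewrite mulrNz addNr.
  have GG' : (G `<=` G')%classic.
    by move=> [x y] Gxy; exists x, y, 0; rewrite !mulr0z !addr0.
  apply: nv; exists d; apply: (Gmax G' zG' GG').
  by exists 0, 0, 1; rewrite !mulr1z !add0r.
have [f fG] := choice Gtot.
exists f; split=> x y; first by apply: Guniq (fG _) _; apply: GB.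
by move=> /G0G; exact: Guniq.
Qed.

Hypothesis Dtors : forall n : nat, (1 < n)%N -> exists c : D, c != 0 /\ c *+ n = 0.

Lemma divisible_separates (V : zmodType) (m : V) : m != 0 ->
  exists f : V -> D, (forall x y, f (x - y) = f x - f y) /\ f m != 0.
Proof.
move=> m0.
have [n [n1 ndvd]] : exists n : nat, (1 < n)%N /\
    forall k : nat, m *+ k = 0 -> (n %| k)%N.
  have [[n [n0 mn]]|none] := pselect (exists n : nat, (0 < n)%N /\ m *+ n = 0); last first.
    (* m has infinite order, so any n > 1 would do. *)
    exists 2%N; split=> // k mk; rewrite (_ : k = 0%N) //.
    by apply: contrapT => /eqP; rewrite -lt0n => k0; apply: none; exists k.
  have exp : exists n, (0 < n)%N && (m *+ n == 0) by exists n; rewrite n0 mn eqxx.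
  case: (ex_minnP exp) => l /andP[l0 /eqP ml] lmin; exists l; split.
    rewrite ltn_neqAle l0 andbT; apply/eqP => l1; move: ml m0.
    by rewrite -l1 mulr1n => ->; rewrite eqxx.
  move=> k mk; rewrite /dvdn; apply: contraT; rewrite -lt0n => r0.
  have := lmin (k %% l)%N; rewrite r0 /=.
  have -> : m *+ (k %% l) = 0.
    have := mk; rewrite {1}(divn_eq k l) mulrnDr mulnC mulrnA ml mul0rn add0r //.
  by rewrite eqxx => /(_ isT); rewrite leqNgt ltn_pmod.
have [c [c0 cn]] := Dtors n1.
have [|f [fB fG]] := @divisible_extend V (fun z => exists k : int, z = (m *~ k, c *~ k)).
  split.
  - by exists 0; rewrite !mulr0z.
  - by move=> x y x' y' [k [-> ->]] [l [-> ->]]; exists (k - l); rewrite !mulrzBr.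
  - move=> y [k [/esym mk ->]].
    have /ndvd/dvdnP[q kq] : m *+ `|k|%N = 0.
      case: k mk => l; first by [].
      by rewrite NegzE mulrNz => /eqP; rewrite oppr_eq0 => /eqP.
    have ck : c *+ `|k|%N = 0 by rewrite kq mulnC mulrnA cn mul0rn.
    by case: k {mk kq} ck => l //= ck; rewrite NegzE mulrNz -pmulrn ck oppr0.
exists f; split=> //; rewrite (fG m c) //; by exists 1; rewrite !mulr1z.
Qed.

Section CharacterModule.
Variable A : pzRingType.

Definition biadditive_mem : {pred A -> D} :=
  fun p => `[< forall x y, p (x - y) = p x - p y >].

Lemma biadditive_memP (p : A -> D) :
  reflect (forall x y, p (x - y) = p x - p y) (p \in biadditive_mem).
Proof. exact: asboolP. Qed.

Fact biadditive_zmod_closed : zmod_closed biadditive_mem.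
Proof.
split=> [|p q /biadditive_memP pB /biadditive_memP qB]; apply/biadditive_memP => x y.
  by change (0 = 0 - 0 :> D); rewrite subr0.
change (p (x - y) - q (x - y) = (p x - q x) - (p y - q y)).
by rewrite pB qB !opprD addrACA.
Qed.

HB.instance Definition _ :=
  GRing.isZmodClosed.Build (A -> D) biadditive_mem biadditive_zmod_closed.

(** Hom_Z(A, D) with (a p) x = p (x a). For D = Q/Z it is injective, hence in C, and separates
    points, which forces C-envelopes to be injective maps. *)
Definition charmod := {p : A -> D | p \in biadditive_mem}.
HB.instance Definition _ := Choice.on charmod.
HB.instance Definition _ := SubType.on charmod.
HB.instance Definition _ := [SubChoice_isSubZmodule of charmod by <:].

Lemma charmodB (p : charmod) x y : val p (x - y) = val p x - val p y.
Proof. by have /biadditive_memP := valP p. Qed.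

Fact charmod_scale_subproof (a : A) (p : charmod) :
  (fun x => val p (x * a)) \in biadditive_mem.
Proof. by apply/biadditive_memP => x y; rewrite mulrBl charmodB. Qed.

Definition charmod_scale (a : A) (p : charmod) : charmod :=
  exist (fun p => p \in biadditive_mem) _ (charmod_scale_subproof a p).

Lemma charmod_eq (p q : charmod) : (forall x, val p x = val q x) -> p = q.
Proof. by move=> pq; apply: val_inj; apply: functional_extensionality_dep. Qed.

Lemma charmod_valD (p q : charmod) x : val (p + q) x = val p x + val q x.
Proof. by []. Qed.

Lemma charmodD (p : charmod) x y : val p (x + y) = val p x + val p y.
Proof.
have p0 : val p 0 = 0 by rewrite -(subrr (0 : A)) charmodB subrr.
have pN : val p (- y) = - val p y by rewrite -[- y]sub0r charmodB p0 sub0r.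
by have := charmodB p x (- y); rewrite opprK pN opprK.
Qed.

Fact charmod_scaleA a b p : charmod_scale a (charmod_scale b p) = charmod_scale (a * b) p.
Proof. by apply: charmod_eq => x /=; rewrite mulrA. Qed.
Fact charmod_scale1 : left_id 1 charmod_scale.
Proof. by move=> p; apply: charmod_eq => x /=; rewrite mulr1. Qed.
Fact charmod_scaleDr : right_distributive charmod_scale +%R.
Proof. by move=> a p q; apply: charmod_eq. Qed.
Fact charmod_scaleDl p : {morph charmod_scale^~ p : a b / a + b}.
Proof.
move=> a b; apply: charmod_eq => x; rewrite charmod_valD /=.
by rewrite mulrDr charmodD.
Qed.

HB.instance Definition _ := GRing.Zmodule_isLmodule.Build A charmod
  charmod_scaleA charmod_scale1 charmod_scaleDr charmod_scaleDl.

Lemma charmod_valZ (a : A) (p : charmod) x : val (a *: p) x = val p (x * a).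
Proof. by []. Qed.

Lemma charmod_of (V : lmodType A) (f : V -> D) :
  (forall x y, f (x - y) = f x - f y) ->
  exists g : {linear V -> charmod}, forall v x, val (g v) x = f (x *: v).
Proof.
move=> fB.
have f0 : f 0 = 0 by rewrite -(subrr (0 : V)) fB subrr.
have fD x y : f (x + y) = f x + f y.
  have fN : f (- y) = - f y by rewrite -[- y]sub0r fB f0 sub0r.
  by have := fB x (- y); rewrite opprK fN opprK.
have mem v : (fun x : A => f (x *: v)) \in biadditive_mem.
  by apply/biadditive_memP => x y; rewrite scalerBl fB.
have [|g gE] := @linear_bundle _ V charmod
    (fun v => exist (fun p => p \in biadditive_mem) _ (mem v)).
  move=> a u v; apply: charmod_eq => x; rewrite charmod_valD charmod_valZ /=.
  by rewrite scalerDr fD scalerA.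
by exists g => v x; rewrite gE.
Qed.

(** Linear maps to Hom_Z(A, D) correspond to additive maps to D through evaluation at 1. *)
Lemma charmod_injective (X : lmodType A) : Ext1_eq0 X charmod.
Proof.
apply: Ext1_of_retraction => E i q [inj _ _].
have [|f [fB fG]] := @divisible_extend E (fun z => exists p : charmod, z = (i p, val p 1)).
  split.
  - by exists 0; rewrite linear0.
  - move=> x y x' y' [p [-> ->]] [p' [-> ->]]; exists (p - p').
    by rewrite linearB.
  - by move=> y [p [/esym ip ->]]; rewrite (inj p 0) // ip linear0.
have [g gE] := charmod_of fB; exists g => p; apply: charmod_eq => x.
have fx : f (i (x *: p)) = val (x *: p) 1 by apply: fG; exists (x *: p).
by rewrite gE -linearZ fx charmod_valZ mul1r.
Qed.

Lemma charmod_separates (V : lmodType A) (m : V) : m != 0 ->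
  exists f : {linear V -> charmod}, f m != 0.
Proof.
move=> /divisible_separates[f [fB fm]]; have [g gE] := charmod_of fB.
exists g; apply: contra fm => /eqP gm.
by rewrite -[m]scale1r -gE gm.
Qed.

End CharacterModule.
End Divisible.

Section RationalsModIntegers.

Definition rat_int_mem : {pred rat} := fun x => `[< exists k : int, x = k%:~R >].

Fact rat_int_zmod_closed : zmod_closed rat_int_mem.
Proof.
split=> [|x y /asboolP[k ->] /asboolP[l ->]]; apply/asboolP; first by exists 0.
by exists (k - l); rewrite rmorphB.
Qed.

HB.instance Definition _ :=
  GRing.isZmodClosed.Build rat rat_int_mem rat_int_zmod_closed.

Definition QmodZ := Quotient.quot (GRing.ZmodClosed.clone rat rat_int_mem _).
HB.instance Definition _ := GRing.Zmodule.on QmodZ.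
HB.instance Definition _ : EqQuotient rat _ QmodZ := EqQuotient.on QmodZ.

Lemma QmodZD (x y : rat) : \pi_QmodZ (x + y) = \pi_QmodZ x + \pi_QmodZ y.
Proof. exact: Quotient.pi_add. Qed.

Lemma QmodZ_Mn (x : rat) n : \pi_QmodZ (x *+ n) = \pi_QmodZ x *+ n.
Proof.
elim: n => [|n IH]; last first.
  by rewrite !mulrSr -IH QmodZD.
by rewrite !mulr0n; apply: (addrI (\pi_QmodZ 0)); rewrite -QmodZD !addr0.
Qed.

Lemma QmodZ_eq0 (x : rat) : (\pi_QmodZ x == 0) = (x \in rat_int_mem).
Proof.
have -> : (0 : QmodZ) = \pi_QmodZ 0 by rewrite -(mulr0n (0 : rat)) QmodZ_Mn mulr0n.
by rewrite -[x in RHS]subr0 Quotient.idealrBE.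
Qed.

Lemma QmodZ_divisible (d : QmodZ) (n : nat) : (0 < n)%N -> exists d', d' *+ n = d.
Proof.
move=> n0; exists (\pi_QmodZ (repr d / n%:R)); rewrite -QmodZ_Mn.
by rewrite -(mulr_natr (repr d / n%:R)) divfK ?reprK // pnatr_eq0 -lt0n.
Qed.

Lemma QmodZ_torsion (n : nat) : (1 < n)%N -> exists c : QmodZ, c != 0 /\ c *+ n = 0.
Proof.
move=> n1; have n0 : (n%:R : rat) != 0 by rewrite pnatr_eq0 -lt0n ltnW.
exists (\pi_QmodZ n%:R^-1); split; last first.
  rewrite -QmodZ_Mn -(mulr_natr n%:R^-1) mulVf //; apply/eqP; rewrite QmodZ_eq0.
  by apply/asboolP; exists 1.
rewrite QmodZ_eq0; apply/negP => /asboolP[k kE].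
have : (n%:Z * k)%:~R == 1%:~R :> rat by rewrite rmorphM /= -kE mulfV.
rewrite eqr_int => /eqP/(congr1 absz); rewrite abszM /= => /eqP.
by rewrite muln_eq1 => /andP[/eqP nE _]; rewrite nE in n1.
Qed.

End RationalsModIntegers.

(** * Envelopes, covers and direct sums *)

Section Approximations.
Variables (A : pzRingType) (F C : lmodType A -> Prop).
Implicit Types (M X Y : lmodType A).
Hypothesis hFC : cotorsion_pair F C.

Lemma linear_inverse X Y (f : {linear X -> Y}) : bijective f ->
  exists g : {linear Y -> X}, cancel f g /\ cancel g f.
Proof.
case=> g0 fg gf; have [|g gE] := @linear_bundle _ Y X g0.
  by move=> a x y; apply: (can_inj fg); rewrite linearP !gf.
by exists g; split=> x; rewrite gE.
Qed.

Lemma lmodEnd_invertible X (f : lmodEnd X) : bijective f -> invertible f.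
Proof.
move=> /linear_inverse[g [fg gf]]; exists g.
by split; apply: lmodEnd_ext => x; [exact: gf|exact: fg].
Qed.

Lemma lmodEnd_bijective X (f : lmodEnd X) : invertible f -> bijective f.
Proof.
move=> [g [fg gf]]; exists g => x.
  exact: (congr1 (fun h : lmodEnd X => h x) gf).
exact: (congr1 (fun h : lmodEnd X => h x) fg).
Qed.

Lemma cotorsion_ext X Y : F X -> C Y -> Ext1_eq0 X Y.
Proof. by move=> FX CY; exact: (hFC.1 X).1 FX Y CY. Qed.

(** The middle term E of an extension of X by Y in C lies in C, and u lifts to E since M is in F.
    Factoring the lift through u gives k with q k u = u, so q k is an automorphism and q splits. The
    cover case below is dual. *)
Lemma envelope_in_left M X (u : {linear M -> X}) : F M -> is_envelope C u -> F X.
Proof.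
move=> FM [[CX fac] aut]; apply/(hFC.1 X) => Y CY.
apply: Ext1_of_section => E i q seq.
have CE : C E.
  apply/(hFC.2 E) => Q FQ.
  by apply: (Ext1_extension_right seq); apply: cotorsion_ext.
have [l ql] := Ext1_lift u (cotorsion_ext FM CY) seq.
have [k ku] := fac E l CE.
have [|g [_ hg]] := linear_inverse (aut (q \o k) _).
  by move=> m /=; have /= -> := ku m; rewrite ql.
by exists (k \o g) => x; exact: hg.
Qed.

Lemma cover_in_right M X (p : {linear X -> M}) : C M -> is_cover F p -> C X.
Proof.
move=> CM [[FX fac] aut]; apply/(hFC.2 X) => Q FQ.
apply: Ext1_of_retraction => E i q seq.
have FE : F E.
  by apply/(hFC.1 E) => Y CY; apply: (Ext1_extension_left seq); apply: cotorsion_ext.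
have [inj surj ex] := seq.
have [||||g gP] := Ext1_extend (cotorsion_ext FQ CM) (q := q)
    (R := fun e m => exists x, e = i x /\ m = p x).
- exact: surj.
- move=> a e m e' m' [x [-> ->]] [x' [-> ->]]; exists (a *: x + x').
  by rewrite !linearP.
- by move=> m [x [/esym ix ->]]; rewrite (inj x 0) ?linear0.
- move=> e; split=> [/ex[x ->]|[m [x [-> _]]]]; first by exists (p x), x.
  by apply/ex; exists x.
have [k kg] := fac E g FE.
have [|g' [hg _]] := linear_inverse (aut (k \o i) _).
  by move=> x /=; have /= -> := kg (i x); apply: gP; exists x.
by exists (g' \o k) => x; exact: hg.
Qed.

Lemma envelope_injective M X (u : {linear M -> X}) : is_envelope C u -> injective u.
Proof.
move=> [[CX fac] _]; apply: linear_eq0_inj => m um.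
apply/eqP; apply: contraT => m0.
have [f fm] := charmod_separates QmodZ_divisible QmodZ_torsion m0.
have [|g gu] := fac _ f.
  by apply/(hFC.2 _) => Y _; exact: (charmod_injective QmodZ_divisible).
by move: fm; have /= <- := gu m; rewrite um linear0 eqxx.
Qed.

(** The regular module is projective, hence in F, so the map sending 1 to m factors through p. *)
Lemma cover_surjective M X (p : {linear X -> M}) : is_cover F p ->
  forall m, exists x, p x = m.
Proof.
move=> [[FX fac] _] m; pose A1 : lmodType A := A^o.
have [|g gE] := @linear_bundle _ A1 M (fun a : A => a *: m).
  by move=> a x y; rewrite scalerDl scalerA.
have [|k kg] := fac A1 g.
  apply/(hFC.1 A1) => Y _; apply: Ext1_of_section => E i q [_ surj _].
  have [e qe] := surj (1 : A).
  have [|s sE] := @linear_bundle _ A1 E (fun a : A => a *: e).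
    by move=> a x y; rewrite scalerDl scalerA.
  by exists s => a; rewrite sE linearZ /= qe; exact: mulr1.
by exists (k (1 : A)); have /= -> := kg (1 : A); rewrite gE scale1r.
Qed.

End Approximations.

(** * Direct sums and finite exchange *)

Section DirectSums.
Variable A : pzRingType.
Implicit Types (M V W : lmodType A).

Lemma direct_sum_projections V (I : finType) (B : I -> submodClosed V) :
  direct_sum B -> exists p : I -> lmodEnd V,
    [/\ forall i x, p i x \in B i, forall i x, x \in B i -> p i x = x,
        forall i j x, i != j -> x \in B j -> p i x = 0
      & forall x, \sum_i p i x = x].
Proof.
move=> dB.
have [b bP] := choice dB.
have buniq x (c : {ffun I -> V}) : (forall i, c i \in B i) -> x = \sum_i c i -> b x = c.
  by move=> cB cx; have [_ h] := bP x; apply: h.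
have bin x i : b x i \in B i by have [[h _] _] := bP x.
have bsum x : x = \sum_i b x i by have [[_ h] _] := bP x.
have pex i : exists p : lmodEnd V, forall x, p x = b x i.
  have [|f fE] := @linear_bundle _ V V (fun x => b x i); last by exists f.
  move=> a x y; rewrite (buniq _ [ffun i => a *: b x i + b y i]) ?ffunE //.
    by move=> j; rewrite ffunE rpredD ?rpredZ.
  rewrite {1}(bsum x) {1}(bsum y) scaler_sumr -big_split.
  by apply: eq_bigr => j _; rewrite ffunE.
have [p pE] := choice pex.
have bB x j : x \in B j -> b x = [ffun i => if i == j then x else 0].
  move=> xB; apply: buniq => [i|]; first by rewrite ffunE; case: eqP => [->|_]; rewrite ?rpred0.
  by rewrite (bigD1 j) //= ffunE eqxx big1 ?addr0 // => i /negPf ij; rewrite ffunE ij.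
exists p; split=> [i x|i x xB|i j x ij xB|x].
- by rewrite pE.
- by rewrite pE (bB _ _ xB) ffunE eqxx.
- by rewrite pE (bB _ _ xB) ffunE (negPf ij).
- by rewrite [RHS]bsum; apply: eq_bigr => i _; rewrite pE.
Qed.

Lemma direct_sum_of_projections V (I : finType) (B : I -> submodClosed V)
    (p : I -> lmodEnd V) :
  (forall i x, p i x \in B i) -> (forall i x, x \in B i -> p i x = x) ->
  (forall i j x, i != j -> x \in B j -> p i x = 0) ->
  (forall x, \sum_i p i x = x) -> direct_sum B.
Proof.
move=> pB pid p0 psum x; exists [ffun i => p i x]; split.
  split=> [i|]; first by rewrite ffunE.
  by rewrite -[LHS]psum; apply: eq_bigr => i _; rewrite ffunE.
move=> c [cB ->]; apply/ffunP => i; rewrite ffunE linear_sum (bigD1 i) //=.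
rewrite pid // big1 ?addr0 // => j ji; apply: p0 (cB j).
by rewrite eq_sym.
Qed.

(** The components pi pr_i io of the identity of M sum to 1 and yield orthogonal idempotents e_i.
    The maps g_i factor through V_i and restrict to e_i on M, so io after their sum projects onto
    M', and its kernel is the direct sum of the V_i meet ker g_i. *)
Theorem clean_finite_exchange M : clean_module M -> finite_exchange_property M.
Proof.
move=> Mcl V M' N I V_ [phi bphi] dMN dV.
have [psi [phiK psiK]] := linear_inverse bphi.
have [p2 [p2in p2id _ _]] := direct_sum_projections dMN.
have [pr [prin prid pr0 prsum]] := direct_sum_projections dV.
have in0 x : p2 ord0 x \in M' by exact: (p2in ord0 x).
have [pi0 pi0E] : exists f : {linear V -> submod M'}, forall x, val (f x) = p2 ord0 x.
  apply: (@linear_of_relation _ V (submod M') (fun x b => val b = p2 ord0 x)).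
  - by move=> a x b x' b' vb vb'; rewrite submod_valP vb vb' linearP.
  - by move=> x; apply: submod_exists.
  - by move=> b vb; apply: val_inj; rewrite vb !linear0.
have [io ioE] : exists f : {linear M -> V}, forall m, f m = val (psi m).
  have [|f fE] := @linear_bundle _ M V (fun m => val (psi m)); last by exists f.
  by move=> a x y; rewrite linearP submod_valP.
pose pi : {linear V -> M} := phi \o pi0.
have piio m : pi (io m) = m.
  rewrite /pi /= -[RHS]psiK; congr (phi _); apply: val_inj.
  rewrite pi0E ioE; apply: (p2id ord0); exact: (valP (psi m)).
have ioM m : io m \in M' by rewrite ioE; exact: (valP (psi m)).
have iopi x : x \in M' -> io (pi x) = x.
  by move=> xM; rewrite ioE /pi /= phiK pi0E; exact: (p2id ord0).
pose f i : lmodEnd M := pi \o (pr i \o io).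
have fE i m : f i m = pi (pr i (io m)) by [].
pose n := #|I|.
pose fn k : lmodEnd M := if insub k is Some o then f (enum_val (o : 'I_n)) else 0.
have fnE (o : 'I_n) : fn o = f (enum_val o) by rewrite /fn valK.
have sum_enum (g : I -> lmodEnd M) : \sum_(o < n) g (enum_val o) = \sum_i g i.
  by rewrite (reindex (@enum_val I predT)) //; exact: onW_bij (enum_val_bij I).
have fsum : \sum_(o < n) fn o = 1.
  rewrite (eq_bigr (fun o => f (enum_val o))) => [|o _]; last exact: fnE.
  rewrite sum_enum; apply: lmodEnd_ext => m; rewrite lmodEnd_sumE.
  rewrite -[RHS]piio -[in RHS](prsum (io m)) linear_sum.
  by apply: eq_bigr.
have [e [r [er ee e1]]] := clean_orthogonal_exchange Mcl fsum.
pose rk i : 'I_n := enum_rank i.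
pose g i : {linear V -> M} := (e (rk i) * r (rk i) : lmodEnd M) \o (pi \o pr i).
have gE i v : g i v = (e (rk i) * r (rk i) : lmodEnd M) (pi (pr i v)) by [].
have eerk i j : e (rk i) * e (rk j) = if i == j then e (rk i) else 0.
  by rewrite ee ?ltn_ord // (inj_eq val_inj) (inj_eq enum_rank_inj).
have gio i m : g i (io m) = e (rk i) m.
  have fi : f i = fn (rk i) by rewrite fnE enum_rankK.
  by rewrite gE -fE fi -lmodEndM -mulrA -er ?ltn_ord // eerk eqxx.
have eg i j v : e (rk j) (g i v) = if j == i then g i v else 0.
  by rewrite gE -lmodEndM mulrA eerk; case: eqP => [->|]; rewrite ?mul0r.
have gpr i v : g i (pr i v) = g i v by rewrite !gE (prid _ _ (prin i v)).
have e1' m : \sum_i e (rk i) m = m.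
  have := congr1 (fun h : lmodEnd M => h m) e1; rewrite lmodEnd_sumE => h.
  rewrite -[RHS]h (reindex rk) //; exact: onW_bij (enum_rank_bij I).
have [pN pNE] : exists p : lmodEnd V, forall v, p v = io (\sum_i g i v).
  have [|p pE] := @linear_bundle _ V V (fun v => io (\sum_i g i v)); last by exists p.
  move=> a x y; rewrite -linearP; congr (io _).
  by rewrite scaler_sumr -big_split; apply: eq_bigr => i _; rewrite linearP.
have gpN i v : g i (pN v) = g i v.
  rewrite pNE gio linear_sum (bigD1 i) //= eg eqxx big1 ?addr0 // => j ji.
  by rewrite eg eq_sym (negPf ji).
have Kex i : exists K : smod V, forall x, K x = (x \in V_ i /\ g i x = 0).
  apply: smod_exists; split; first by rewrite rpred0 linear0.
  move=> a x y [Vx gx] [Vy gy]; rewrite rpredD ?rpredZ //.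
  by rewrite linearP gx gy scaler0 addr0.
have [K KE] := choice Kex.
exists (fun i => GRing.SubmodClosed.clone A V (smod_mem (K i)) _).
have KP i x : reflect (x \in V_ i /\ g i x = 0) (x \in smod_mem (K i)).
  by rewrite -KE; exact: smod_memP.
split=> [i x /KP[]//|].
pose p (o : option I) : lmodEnd V := if o is Some i then pr i * (1 - pN) else pN.
have pS i v : p (Some i) v = pr i (v - pN v) by [].
have pNM v : pN v \in M' by rewrite pNE.
have pNid v : v \in M' -> pN v = v.
  move=> vM; rewrite -[in LHS](iopi v vM) pNE -[RHS](iopi v vM); congr (io _).
  by rewrite -[RHS]e1'; apply: eq_bigr => i _; rewrite gio.
have pN0 i v : v \in smod_mem (K i) -> pN v = 0.
  move=> /KP[vV gv]; rewrite pNE big1 ?linear0 // => j _.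
  have [->//|ji] := eqVneq j i.
  by rewrite gE (pr0 j i) // !linear0.
apply: (direct_sum_of_projections (p := p)).
- move=> [i|] v; last exact: pNM.
  apply/KP; rewrite pS; split; first exact: prin.
  by rewrite gpr linearB gpN subrr.
- move=> [i|] v; last exact: pNid.
  by move=> vK; rewrite pS (pN0 i) // subr0 prid //; have /KP[] := vK.
- move=> [i|] [j|] v // ij vB.
  + rewrite pS (pN0 j) // subr0; apply: (pr0 i j); last by have /KP[] := vB.
    by apply: contra ij => /eqP ->.
  + by rewrite pS pNid // subrr linear0.
  + exact: (pN0 j).
- move=> v; rewrite -[RHS](subrK (pN v)) -[in RHS](prsum (v - pN v)) addrC.
  rewrite (bigD1 None) //=; congr (_ + _).
  rewrite (reindex_omap Some id) /=; last by case.
  by apply: eq_big => [i|i _]; rewrite ?eqxx.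
Qed.
End DirectSums.

(** * Summands cut out by idempotents *)

Section IdempotentParts.
Variable A : pzRingType.
Implicit Types (M V W L X : lmodType A).

Lemma idempotent_part V (e : lmodEnd V) : e * e = e ->
  exists (W : submodClosed V) (i : {linear submod W -> V}) (r : {linear V -> submod W}),
    [/\ forall w, i w = val w, forall w, r (i w) = w, forall x, i (r x) = e x
      & forall x, x \in W <-> e x = x].
Proof.
move=> ee; have eex x : e (e x) = e x by exact: (congr1 (fun f : lmodEnd V => f x) ee).
have [|K KE] := @smod_exists _ V (fun x => e x = x).
  by split=> [|a x y ex ey]; rewrite ?linear0 // linearP ex ey.
have KP x : x \in smod_mem K <-> e x = x.
  by rewrite -KE; split=> /smod_memP.
pose W : submodClosed V := GRing.SubmodClosed.clone A V (smod_mem K) _.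
have [|i iE] := @linear_bundle _ (submod W) V (fun w => val w).
  by move=> a x y; rewrite submod_valP.
have [|||r rE] := @linear_of_relation _ V (submod W) (fun x w => val w = e x).
- by move=> a x w x' w' vw vw'; rewrite submod_valP vw vw' linearP.
- by move=> x; apply: submod_exists; apply/KP.
- by move=> w; rewrite linear0 => vw; apply: val_inj; rewrite vw linear0.
exists W, i, r; split=> // [w|x].
  by apply: val_inj; rewrite rE iE; apply/KP; exact: (valP w).
by rewrite iE rE.
Qed.

Lemma direct_sum_idempotent V (h : lmodEnd V) (N L : submodClosed V) : h * h = h ->
  (forall x, x \in N <-> (1 - h : lmodEnd V) x = x) ->
  (forall x, x \in L <-> h x = x) -> direct_sum_of [tuple N; L].
Proof.
move=> hh NP LP.
have hhx x : h (h x) = h x by exact: (congr1 (fun f : lmodEnd V => f x) hh).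
have NE x : x \in N <-> h x = 0.
  rewrite NP; change (x - h x = x <-> h x = 0); split=> [|->]; last by rewrite subr0.
  by move/eqP; rewrite -subr_eq0 addrC addKr oppr_eq0 => /eqP.
have [p [p0 p1]] : exists p : 'I_2 -> lmodEnd V,
    (forall lt_02 x, p (@Ordinal 2 0 lt_02) x = x - h x) /\
    (forall lt_12 x, p (@Ordinal 2 1 lt_12) x = h x).
  by exists (fun i => if i == ord0 then 1 - h else h).
apply: (direct_sum_of_projections (p := p)).
- move=> [[|[|//]] lt_i2] x; rewrite (tnth_nth N) /=.
    by apply/NE; rewrite p0 linearB /= hhx subrr.
  by apply/LP; rewrite p1 hhx.
- move=> [[|[|//]] lt_i2] x; rewrite (tnth_nth N) /=.
    by move/NE => hx; rewrite p0 hx subr0.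
  by move/LP; rewrite p1.
- move=> [[|[|//]] lt_i2] [[|[|//]] lt_j2] x // _; rewrite (tnth_nth N) /=.
    by move=> /LP hx; rewrite p0 hx subrr.
  by move/NE; rewrite p1.
- by move=> x; rewrite !big_ord_recl big_ord0 addr0 p0 p1 subrK.
Qed.

(** The isomorphism of B1 with B2, extended by 0, is a square-zero s in the corner of 1 - h, hence
    in the radical. With t from its inverse, s t is the projection onto B2: an idempotent in the
    radical, so 0. *)
Lemma square_free_of_nilpotent_radical M (h : lmodEnd M) (N : submodClosed M)
    (i : {linear submod N -> M}) (r : {linear M -> submod N}) :
  (forall w, r (i w) = w) -> (forall x, i (r x) = (1 - h : lmodEnd M) x) ->
  (forall x, (1 - h) * x * (1 - h) = x -> x * x = 0 -> x \in @jacobson (lmodEnd M)) ->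
  square_free (submod N).
Proof.
move=> ri ir nil [B1 [B2 [B3 [dB [phi /linear_inverse[psi [phiK psiK]]] [x xB x0]]]]].
have [p [pin pid p0 _]] := direct_sum_projections dB.
pose o0 : 'I_3 := @Ordinal 3 0 isT; pose o1 : 'I_3 := @Ordinal 3 1 isT.
have [a aE] : exists a : {linear submod N -> submod B1}, forall w, val (a w) = p o0 w.
  apply: (@linear_of_relation _ _ (submod B1) (fun w b => val b = p o0 w)).
  - by move=> c w b w' b' vb vb'; rewrite submod_valP vb vb' linearP.
  - by move=> w; apply: submod_exists; exact: (pin o0 w).
  - by move=> b vb; apply: val_inj; rewrite vb !linear0.
have [b bE] : exists b : {linear submod N -> submod B2}, forall w, val (b w) = p o1 w.
  apply: (@linear_of_relation _ _ (submod B2) (fun w b => val b = p o1 w)).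
  - by move=> c w b w' b' vb vb'; rewrite submod_valP vb vb' linearP.
  - by move=> w; apply: submod_exists; exact: (pin o1 w).
  - by move=> b vb; apply: val_inj; rewrite vb !linear0.
have [s sE] : exists s : lmodEnd M, forall m, s m = i (val (phi (a (r m)))).
  have [|s sE] := @linear_bundle _ M M (fun m => i (val (phi (a (r m))))).
    by move=> c m m'; rewrite linearP linearP linearP submod_valP linearP.
  by exists s.
have [t tE] : exists t : lmodEnd M, forall m, t m = i (val (psi (b (r m)))).
  have [|t tE] := @linear_bundle _ M M (fun m => i (val (psi (b (r m))))).
    by move=> c m m'; rewrite linearP linearP linearP submod_valP linearP.
  by exists t.
have st m : s (t m) = i (p o1 (r m)).
  rewrite sE tE ri -bE; congr (i (val _)); rewrite -[RHS]psiK; congr (phi _).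
  by apply: val_inj; rewrite aE; apply: (pid o0); exact: (valP (psi _)).
have Js : s \in @jacobson (lmodEnd M).
  apply: nil; apply: lmodEnd_ext => m; rewrite !lmodEndM.
    by rewrite -!ir [in LHS]sE !ri -sE.
  rewrite !sE ri (_ : a (val _) = 0) ?linear0 //.
  apply: val_inj; rewrite aE; apply: (p0 o0 o1) => //; exact: (valP (phi _)).
have Jst := jacobsonMr t Js.
have st0 : s * t = 0.
  apply: jacobson_idempotent Jst; apply: lmodEnd_ext => m; rewrite !lmodEndM !st ri.
  congr (i _); apply: (pid o1); exact: (pin o1).
case/eqP: x0; have := congr1 (fun f : lmodEnd M => f (i x)) st0.
rewrite lmodEndM st ri (pid o1) // => ix.
by rewrite -(ri x) ix linear0.
Qed.

End IdempotentParts.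

(** * Invariance of the summand given by the matrix part *)

Section Invariance.
Variables (A : pzRingType) (F C : lmodType A -> Prop).
Implicit Types (M L X : lmodType A).

(** u restricts to an envelope of L, the image of h, in the summand e X. *)
Lemma endomorphism_invariant_part M X (u : {linear M -> X}) (e : lmodEnd X)
    (h : lmodEnd M) L (i : {linear L -> M}) (r : {linear M -> L}) :
  cotorsion_pair F C -> is_envelope C u -> e * e = e -> (forall m, u (h m) = e (u m)) ->
  (forall x : lmodEnd X, exists f : lmodEnd M, forall m, u (f m) = (e * x * e) (u m)) ->
  (forall y, r (i y) = y) -> (forall m, i (r m) = h m) -> endomorphism_invariant C L.
Proof.
move=> hFC [[CX fac] aut] ee uh dom ri ir.
have [W [j [q [_ qj jq _]]]] := idempotent_part ee.
have ej w : e (j w) = j w by rewrite -jq qj.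
have qe x : q (e x) = q x by rewrite -jq qj.
exists (submod W), (q \o (u \o i)); split.
  split.
    split.
      apply/(hFC.2 _) => Q FQ; apply: (Ext1_retract_right qj).
      exact: (hFC.2 X).1 CX Q FQ.
    move=> X' g CX'; have [k kg] := fac X' (g \o r) CX'.
    exists (k \o j) => y /=; rewrite jq -uh -ir ri.
    by have /= -> := kg (i y); rewrite ri.
  move=> g gu.
  (* Extending g by the identity on (1 - e) X gives a map fixing u, to which the envelope property
     of u applies. *)
  have [|g' g'E] := @linear_bundle _ X X (fun x => j (g (q x)) + (x - e x)).
    move=> a x y; rewrite [q (_ + _)]linearP [g (_ + _)]linearP [j (_ + _)]linearP.
    rewrite [e (_ + _)]linearP scalerDr scalerBr opprD.
    by rewrite [RHS]addrACA; congr (_ + _); rewrite addrACA.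
  have bg' : bijective g'.
    apply: aut => m /=; rewrite g'E; have /= := gu (r m).
    by rewrite ir uh qe => ->; rewrite jq addrC subrK.
  have [k [gk kg]] := linear_inverse bg'.
  exists (fun w => q (k (j w))) => w.
    have -> : j (g w) = g' (j w) by rewrite g'E qj ej subrr addr0.
    by rewrite gk qj.
  have := congr1 q (kg (j w)); rewrite g'E linearD qj linearB /= qe subrr addr0.
  by rewrite qj.
(* Extended by 0 to X, g lies in the corner of e and so induces a map on M. *)
move=> g; have [f fE] := dom (j \o (g \o q)).
exists (r \o (f \o i)) => y /=.
by rewrite ir uh fE !lmodEndM /= qe ej qj qe.
Qed.

Lemma endomorphism_coinvariant_part M X (p : {linear X -> M}) (e : lmodEnd X)
    (h : lmodEnd M) L (i : {linear L -> M}) (r : {linear M -> L}) :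
  closed_under_direct_limits F -> is_cover F p -> e * e = e ->
  (forall x, h (p x) = p (e x)) ->
  (forall x : lmodEnd X, exists f : lmodEnd M, forall y, f (p y) = p ((e * x * e) y)) ->
  (forall y, r (i y) = y) -> (forall m, i (r m) = h m) -> endomorphism_coinvariant F L.
Proof.
move=> Flim [[FX fac] aut] ee hp dom ri ir.
have [W [j [q [_ qj jq _]]]] := idempotent_part ee.
have ej w : e (j w) = j w by rewrite -jq qj.
have qe x : q (e x) = q x by rewrite -jq qj.
have rh m : r (h m) = r m by rewrite -ir ri.
exists (submod W), (r \o (p \o j)); split.
  split.
    split; first exact: (closed_retract Flim qj).
    move=> X' g FX'; have [k kg] := fac X' (i \o g) FX'.
    exists (q \o k) => y /=; rewrite jq -hp rh.
    by have /= -> := kg y; rewrite ri.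
  move=> g gp.
  have [|g' g'E] := @linear_bundle _ X X (fun x => j (g (q x)) + (x - e x)).
    move=> a x y; rewrite [q (_ + _)]linearP [g (_ + _)]linearP [j (_ + _)]linearP.
    rewrite [e (_ + _)]linearP scalerDr scalerBr opprD.
    by rewrite [RHS]addrACA; congr (_ + _); rewrite addrACA.
  have bg' : bijective g'.
    apply: aut => x /=; rewrite g'E linearD linearB /=.
    have pj w : p (j w) = i (r (p (j w))) by rewrite ir hp ej.
    rewrite pj; have /= -> := gp (q x); rewrite -pj jq.
    by rewrite addrC subrK.
  have [k [gk kg]] := linear_inverse bg'.
  exists (fun w => q (k (j w))) => w.
    have -> : j (g w) = g' (j w) by rewrite g'E qj ej subrr addr0.
    by rewrite gk qj.
  have := congr1 q (kg (j w)); rewrite g'E linearD qj linearB /= qe subrr addr0.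
  by rewrite qj.
move=> g; have [f fE] := dom (j \o (g \o q)).
exists (r \o (f \o i)) => w /=.
by rewrite ir hp ej fE !lmodEndM /= qe ej qj.
Qed.

End Invariance.

Section Main.
Variables (A : pzRingType) (F C : lmodType A -> Prop).
Implicit Types (M L X : lmodType A).
Hypothesis hFC : cotorsion_pair F C.
Hypothesis Flim : closed_under_direct_limits F.

Lemma endomorphism_transfer M X (Q : lmodEnd X -> lmodEnd M -> Prop) :
  F X -> C X -> Q 1 1 ->
  (forall g g' f f', Q g f -> Q g' f' -> Q (g - g') (f - f')) ->
  (forall g g' f f', Q g f -> Q g' f' -> Q (g * g') (f * f')) ->
  (forall f, exists g, Q g f) -> (forall g, invertible g -> exists f, Q g f) ->
  (forall g, Q g 0 -> g \in @jacobson (lmodEnd X)) -> (forall f, Q 0 f -> f = 0) ->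
  [/\ von_neumann_regular (jacobson_quot (lmodEnd M)),
      idempotents_lift_mod_jacobson (lmodEnd M), clean_module M
    & exists (N L : submodClosed M) (e : lmodEnd X) (h : lmodEnd M)
        (i : {linear submod L -> M}) (r : {linear M -> submod L}),
      [/\ direct_sum_of [tuple N; L], square_free (submod N), e * e = e /\ Q e h,
          forall x, exists f, Q (e * x * e) f
        & (forall y, r (i y) = y) /\ (forall m, i (r m) = h m)]].
Proof.
move=> FX CX Q1 QB QM Qsurj Qunit Qker Qfun.
have extX L (FL : F L) : Ext1_eq0 L X := cotorsion_ext hFC FL CX.
have Treg := End_regular Flim FX extX.
have Tinj := End_self_injective Flim FX extX.
have Slift := End_idempotents_lift Flim FX extX.
split.
- exact: (transfer_regular Q1 QB QM Qsurj Qunit Qfun Treg Tinj).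
- exact: (transfer_lift Q1 QB QM Qsurj Qunit Qker Qfun Treg Tinj Slift).
- exact: (transfer_clean Q1 QB QM Qsurj Qunit Qfun Treg Tinj Slift).
have [e [h [ee Qeh hh dom nil]]] :=
  transfer_decomposition Q1 QB QM Qsurj Qunit Qker Qfun Treg Tinj Slift.
have [|N [i' [r' [_ ri' ir' NP]]]] := @idempotent_part _ M (1 - h).
  by rewrite mulrBl mul1r mulrBr mulr1 hh subrr subr0.
have [L [i [r [_ ri ir LP]]]] := idempotent_part hh.
exists N, L, e, h, i, r; split=> //.
  exact: direct_sum_idempotent hh NP LP.
exact: (square_free_of_nilpotent_radical ri' ir' nil).
Qed.

Theorem automorphism_invariant_decomposition M : F M -> automorphism_invariant C M ->
  [/\ [/\ von_neumann_regular (jacobson_quot (lmodEnd M)),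
          idempotents_lift_mod_jacobson (lmodEnd M)
        & finite_exchange_property M],
      exists N L : submodClosed M,
        [/\ direct_sum_of [tuple N; L], square_free (submod N)
          & endomorphism_invariant C (submod L)]
    & clean_module M].
Proof.
move=> FM [X [u [envu inv]]]; have [[CX fac] aut] := envu.
have FX := envelope_in_left hFC FM envu.
have uinj := envelope_injective hFC envu.
pose Q (g : lmodEnd X) (f : lmodEnd M) := forall m, u (f m) = g (u m).
have [|||||||reg lift cl [N [L [e [h [i [r [dNL sqN [ee Qeh] dom [ri ir]]]]]]]]] :=
    @endomorphism_transfer M X Q FX CX.
- by [].
- by move=> g g' f f' Qf Qf' m; rewrite linearB /= Qf Qf'.
- by move=> g g' f f' Qf Qf' m; rewrite !lmodEndM Qf Qf'.
- by move=> f; have [g gu] := fac X (u \o f) CX; exists g => m; exact: esym (gu m).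
- by move=> g /lmodEnd_bijective/inv[f fu]; exists f => m; exact: fu.
(* g kills the image of u, so 1 - y g fixes u and is an automorphism. *)
- move=> g Qg; apply: jacobson_char => y.
  have [|z [_ zg]] := @lmodEnd_invertible _ _ (1 - y * g : lmodEnd X); last by exists z.
  apply: aut => m; change (u m - y (g (u m)) = u m).
  have -> : g (u m) = 0 by rewrite -Qg; exact: linear0.
  by rewrite linear0 subr0.
- by move=> f Qf; apply: lmodEnd_ext => m; apply: uinj; rewrite Qf linear0.
split=> //; first by split=> //; exact: clean_finite_exchange.
exists N, L; split=> //.
exact: (endomorphism_invariant_part hFC envu ee Qeh dom ri ir).
Qed.

Theorem automorphism_coinvariant_decomposition M :
  C M -> automorphism_coinvariant F M ->
  [/\ [/\ von_neumann_regular (jacobson_quot (lmodEnd M)),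
          idempotents_lift_mod_jacobson (lmodEnd M)
        & finite_exchange_property M],
      exists N L : submodClosed M,
        [/\ direct_sum_of [tuple N; L], square_free (submod N)
          & endomorphism_coinvariant F (submod L)]
    & clean_module M].
Proof.
move=> CM [X [p [covp inv]]]; have [[FX fac] aut] := covp.
have CX := cover_in_right hFC CM covp.
have psurj := cover_surjective hFC covp.
pose Q (g : lmodEnd X) (f : lmodEnd M) := forall x, f (p x) = p (g x).
have [|||||||reg lift cl [N [L [e [h [i [r [dNL sqN [ee Qeh] dom [ri ir]]]]]]]]] :=
    @endomorphism_transfer M X Q FX CX.
- by [].
- move=> g g' f f' Qf Qf' x; change (f (p x) - f' (p x) = p (g x - g' x)).
  by rewrite linearB /= Qf Qf'.
- by move=> g g' f f' Qf Qf' x; rewrite !lmodEndM Qf' Qf.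
- by move=> f; have [g gp] := fac X (f \o p) FX; exists g => x; exact: esym (gp x).
- by move=> g /lmodEnd_bijective/inv[f fp]; exists f => x; exact: fp.
(* Since p g = 0, the cover property makes 1 - g y invertible; the radical criterion wants a left
   inverse of 1 - y g, which is 1 + y w g. *)
- move=> g Qg; apply: jacobson_char => y.
  have [|w [_ wg]] := @lmodEnd_invertible _ _ (1 - g * y : lmodEnd X).
    apply: aut => x; change (p (x - g (y x)) = p x).
    by rewrite linearB /= -Qg; exact: subr0.
  exists (1 + y * w * g).
  have -> : (1 + y * w * g) * (1 - y * g) = 1 - y * g + y * (w * (1 - g * y)) * g by nc.
  by rewrite wg mulr1 subrK.
- move=> f Qf; apply: lmodEnd_ext => m; have [x <-] := psurj m.
  by rewrite Qf linear0.
split=> //; first by split=> //; exact: clean_finite_exchange.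
exists N, L; split=> //.
exact: (endomorphism_coinvariant_part Flim covp ee Qeh dom ri ir).
Qed.

End Main.

Theorem theorem5p2 (R : pzRingType) (F C : rmodType R -> Prop)
    (hFC : cotorsion_pair F C)
    (hF : closed_under_direct_limits F)
    (hcover : forall M : rmodType R,
       exists (X : rmodType R) (p : {linear X -> M}), is_cover F p) :
  (forall M : rmodType R, F M -> automorphism_invariant C M ->
     [/\ [/\ von_neumann_regular (jacobson_quot (lmodEnd M)),
             idempotents_lift_mod_jacobson (lmodEnd M)
           & finite_exchange_property M],
         exists N L : submodClosed M,
           [/\ direct_sum_of [tuple N; L],
               square_free (submod N)
             & endomorphism_invariant C (submod L)]
       & clean_module M]) /\
  (forall M : rmodType R, C M -> automorphism_coinvariant F M ->
     [/\ [/\ von_neumann_regular (jacobson_quot (lmodEnd M)),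
             idempotents_lift_mod_jacobson (lmodEnd M)
           & finite_exchange_property M],
         exists N L : submodClosed M,
           [/\ direct_sum_of [tuple N; L],
               square_free (submod N)
             & endomorphism_coinvariant F (submod L)]
       & clean_module M]).
Proof.
split=> M.
  exact: automorphism_invariant_decomposition.
exact: automorphism_coinvariant_decomposition.
Qed.
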